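(* Fix an integer $m\geq1$, $p\in(0,1)$, $q=1-p$, and $u\in(0,1)$. (1) Let $N$ be geometrically distributed with $\mathbb{P}(N=n)=(1-u)u^n$, $n\ge 0$, and, conditional on $N=n$, let $\pi$ have the law $\nu^{(p)}_{n,m}$. Then every finite subcollection of $N_1(\pi),N_2(\pi),\ldots$ is independent, and the probability generating function of $N_i=N_i(\pi)$ is $$G^{(m,p)}_{i,u}(x):=\mathbb{E}[x^{N_i}]=\exp\left\{\sum_{r\ge1}\frac{x^r-1}{ir}B^{(m,p)}_{i,r}u^{ir}\right\}.$$ (2) Let $\pi_n\sim\nu^{(p)}_{n,m}$. Then, for every finite set $I\subseteq\mathbb{N}=\{1,2,\ldots\}$, as $n\to\infty$ the random variables $\{N_i(\pi_n): i\in I\}$ converge jointly in distribution to independent random variables with marginal probability generating functions $$G^{(m,p)}_{i,1}(x)=\exp\left\{\sum_{r\ge1}\frac{x^r-1}{ir}B^{(m,p)}_{i,r}\right\},\qquad i\in I.$$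
   Context: Asymmetric shelf shuffle: let $m\ge 1$ be an integer, $p\in(0,1)$, $q=1-p$. A deck of $n$ cards labelled $1,\ldots,n$ from top to bottom is dealt sequentially from the bottom (card $n$ first, card $1$ last). Each card is assigned to one of $m$ labelled shelves independently and uniformly at random, and is placed at the top of the existing pile on that shelf with probability $p$ and at the bottom with probability $q$, independently of everything else. The shuffled deck is formed by joining the piles in shelf order (shelf $1$ on top, then shelf $2$, and so on). The resulting random permutation is $\pi=(\pi_1,\ldots,\pi_n)\in S_n$, where $\pi_i$ is the label of the card in position $i$ from the top, and $\nu^{(p)}_{n,m}$ denotes its law on $S_n$. For $\pi\in S_n$, $N_i(\pi)$ is the number of cycles of length $i$ of $\pi$ (for $n=0$ the permutation is empty and all $N_i=0$). For $i,r\ge1$, $$B^{(m,p)}_{i,r}:=\sum_{d\mid i}\mu(d)\, m^{\,i/d-ir}\bigl(p^{dr}-(-q)^{dr}\bigr)^{i/d},$$ where $\mu$ is the number-theoretic Möbius function. Probability generating functions are considered for $|x|\le 1$. *)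

(* Defs.v *)
From mathcomp Require Import all_boot all_order all_algebra perm.
From mathcomp Require Import finmap.
From mathcomp Require Import all_classical all_reals all_analysis.

Set Implicit Arguments.
Unset Strict Implicit.
Unset Printing Implicit Defensive.

Import Order.TTheory GRing.Theory Num.Theory.
Import numFieldNormedType.Exports.

Local Open Scope classical_set_scope.
Local Open Scope ring_scope.

(* Shelf and pile end chosen for a card; [true] means the top of the pile. *)
Definition choice_of_place (m : nat) : finType := ('I_m * bool)%type.

(* Positions and card labels are counted from 0, and every pile is listed from
   top to bottom. *)
Definition place (n m : nat) (c : 'I_n) (a : choice_of_place m)
    (piles : 'I_m -> seq 'I_n) : 'I_m -> seq 'I_n :=
  fun s => if s == a.1 then (if a.2 then c :: piles s else rcons (piles s) c)
           else piles s.

(* [foldr] treats the last card of [enum 'I_n] first: the deck is dealt from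
   the bottom. *)
Definition deal (n m : nat) (w : 'I_n -> choice_of_place m) :
    'I_m -> seq 'I_n :=
  foldr (fun c piles => place c (w c) piles) (fun=> [::]) (enum 'I_n).

Definition shuffled_deck (n m : nat) (w : 'I_n -> choice_of_place m) :
    seq 'I_n :=
  flatten [seq deal w s | s <- enum 'I_m].

(* Probability that the shuffled deck, read from the top, is s 0, s 1, .... *)
Definition shelf_law (R : realType) (m : nat) (p : R) (n : nat) (s : 'S_n) : R :=
  \sum_(w : {ffun 'I_n -> choice_of_place m}
          | shuffled_deck w == [seq s j | j <- enum 'I_n])
    \prod_(c < n) (m%:R^-1 * (if (w c).2 then p else 1 - p)).

Definition sized_perm (n : nat) (s : 'S_n) : {k : nat & 'S_k} :=
  Tagged (fun k => 'S_k) s.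

Definition ncycles (i n : nat) (s : 'S_n) : nat :=
  #|[set C : {set 'I_n} in porbits s | #|C| == i]|.

(* Only used for positive arguments. *)
Definition moebius (d : nat) : int :=
  if all (fun l => logn l d == 1)%N (primes d) then (-1) ^+ size (primes d)
  else 0.

Definition shelf_B (R : realType) (m : nat) (p : R) (i r : nat) : R :=
  let q := 1 - p in
  \sum_(d <- divisors i)
    (moebius d)%:~R * m%:R ^ ((i %/ d)%N%:Z - (i * r)%N%:Z) *
    (p ^+ (d * r) - (- q) ^+ (d * r)) ^+ (i %/ d).

Definition shelf_exponent_term (R : realType) (m : nat) (p u : R) (i : nat)
    (x : R) (r : nat) : R :=
  (x ^+ r - 1) / (i * r)%:R * shelf_B m p i r * u ^+ (i * r).

Definition shelf_pgf (R : realType) (m : nat) (p u : R) (i : nat) (x : R) : R :=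
  expR (limn (fun k => \sum_(1 <= r < k) shelf_exponent_term m p u i x r)).

(* [shelf_pgf] is a limit, hence meaningful only when this holds. *)
Definition shelf_pgf_defined (R : realType) (m : nat) (p u : R) (i : nat)
    (x : R) : Prop :=
  cvgn (fun k => \sum_(1 <= r < k) shelf_exponent_term m p u i x r).

Definition cond_prob d (T : measurableType d) (R : realType)
    (P : probability T R) (A B : set T) : R :=
  fine (P (A `&` B)) / fine (P B).

(* The product rule for subfamilies is obtained by taking A i = setT. *)
Definition mutually_independent d (T : measurableType d) (R : realType)
    (P : probability T R) (I : finType) d' (T' : measurableType d')
    (X : I -> T -> T') : Prop :=
  forall A : I -> set T', (forall i, measurable (A i)) ->
    P (\bigcap_(i in [set: I]) (X i @^-1` A i)) =
    (\prod_(i : I) P (X i @^-1` A i))%E.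

(* The variables X n may live on different probability spaces. *)
Definition cvg_in_distribution (R : realType) (V : topologicalType)
    (d : nat -> measure_display) (T : forall n, measurableType (d n))
    (P : forall n, probability (T n) R) (X : forall n, T n -> V)
    d' (T' : measurableType d') (Q : probability T' R) (Y : T' -> V) : Prop :=
  forall f : V -> R, continuous f -> (exists M, forall v, `|f v| <= M) ->
    (fun n => ('E_(P n)[f \o X n])%E) @ \oo --> ('E_Q[f \o Y])%E.

(* Main.v *)
From HB Require Import structures.
Require Import Defs.
From mathcomp Require Import all_boot all_order all_algebra fingroup perm.
From mathcomp Require Import finmap.
From mathcomp Require Import zify ring lra.
From mathcomp Require Import all_classical all_reals all_analysis.
From mathcomp Require Import measurable_realfun.

Set Implicit Arguments.
Unset Strict Implicit.
Unset Printing Implicit Defensive.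

Import Order.TTheory GRing.Theory Num.Theory.
Import numFieldNormedType.Exports.

Local Open Scope classical_set_scope.
Local Open Scope ring_scope.

(** Write on each card the letter (shelf, top or bottom) that it draws. Within a
    shelf, the cards put on top come first and in increasing order, and those
    put at the bottom follow in decreasing order. The inverse of the shuffle is
    therefore the standardization of the word of letters, for an ordered
    alphabet of [2m] letters in which every bottom letter reverses the order of
    the cards that carry it ([std_before]).

    The cycle structure of such a permutation is found as in the work of Gessel
    and Reutenauer. Give to each position its itinerary, the periodic sequence
    of letters met along its cycle. Positions are ordered as their itineraries,
    for the lexicographic order reversed after each bottom letter, so that the
    multiset of the itineraries determines the word ([itinerary_fiber_inj]).
    Going once around an itinerary permutes the cards that share it and
    preserves or reverses their order according to the parity of the number of
    bottom letters. In the first case each of these cards closes a cycle after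
    one turn; in the second case the cards are exchanged in pairs, up to one
    fixed card ([fiber_cycles]). Hence an orbit of [k] rotated itineraries, of
    weight [W], shared by [M] cards each, contributes [M] cycles of length [k],
    or [M mod 2] cycles of length [k] and [M / 2] cycles of length [2 k].

    If every assignment of multiplicities to the orbits came from exactly one
    word, then the generating function of the cycle structure, in the size of
    the deck, would be a product of one explicit factor for each orbit. Words
    inject into such assignments, and preserve weights. The total weights agree:
    the logarithmic derivative of the product is a sum over periodic words,
    which Moebius inversion evaluates to the numbers [shelf_B], and without
    cycle markers it reduces to that of [1 / (1 - X)]. As all weights are
    positive, the injection is onto ([word_sum_cycle_series]). It follows that
    the generating function is [1 / (1 - X)] times the product over the marked
    lengths [i] of the exponentials of the series with general term
    [(x^r - 1) B_(i,r) X^(i r) / (i r)] ([shelf_monomial_sum]).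

    These identities are polynomial in the markers, and so extend from the
    powers [x^(N_i)] to arbitrary functions [h_i (N_i)] ([shelf_meanE]): the
    mean of the product of the [h_i (N_i)] over decks of size [n] is the
    coefficient of degree [n] of [1 / (1 - X)] times a product of series
    [count_series i h_i]. Because [p] and [1 - p] are smaller than 1, these
    series converge absolutely up to [X = 1], uniformly for [h_i] bounded by 1.
    For a deck of geometric size one evaluates at [X = u], and the factor
    [1 / (1 - X)] cancels the normalization; for decks of fixed size [n] the
    factor [1 / (1 - X)] forms partial sums, which converge to the value at
    [X = 1]. In both cases the product form is independence, and the powers
    [x^(N_i)] give the generating functions. Convergence of the joint point
    masses to those of a probability law gives convergence in distribution. *)

(** * Formal power series *)

Definition fps (R : comNzRingType) := nat -> R.

HB.instance Definition _ (R : comNzRingType) :=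
  GRing.Zmodule.copy (fps R) (nat -> R).

Section FpsRing.
Variable R : comNzRingType.
Implicit Types f g h : fps R.

Definition fps_one : fps R := fun n => (n == 0%N)%:R.
Definition fps_mul f g : fps R := fun n => \sum_(i < n.+1) f i * g (n - i)%N.

Let trunc N f : {poly R} := \poly_(i < N) f i.

Let fps_mul_trunc N f g n : (n < N)%N ->
  fps_mul f g n = (trunc N f * trunc N g)`_n.
Proof.
move=> nN; rewrite coefM; apply: eq_bigr => i _.
have iN : (i < N)%N by apply: leq_ltn_trans nN; rewrite -ltnS.
by rewrite !coef_poly iN (leq_ltn_trans (leq_subr _ _) nN).
Qed.

Fact fps_mulC : commutative fps_mul.
Proof.
by move=> f g; apply/funext => n; rewrite !(@fps_mul_trunc n.+1) // mulrC.
Qed.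

Fact fps_mulA : associative fps_mul.
Proof.
move=> f g h; apply/funext => n.
transitivity ((trunc n.+1 f * (trunc n.+1 g * trunc n.+1 h))`_n).
  rewrite coefM; apply: eq_bigr => i _; rewrite coef_poly ltn_ord.
  by rewrite (@fps_mul_trunc n.+1) // ltnS leq_subr.
rewrite mulrA coefM; apply: eq_bigr => i _.
by rewrite (@fps_mul_trunc n.+1 f g) ?ltn_ord // [in LHS]coef_poly ltnS leq_subr.
Qed.

Fact fps_mul1 : left_id fps_one fps_mul.
Proof.
move=> f; apply/funext => n; rewrite /fps_mul big_ord_recl subn0 mul1r.
by rewrite big1 ?addr0 // => i _; rewrite mul0r.
Qed.

Fact fps_mulDl : left_distributive fps_mul +%R.
Proof.
move=> f g h; apply/funext => n; rewrite -[RHS]big_split /=.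
by apply: eq_bigr => i _; rewrite -mulrDl.
Qed.

Fact fps_one_neq0 : fps_one != 0.
Proof.
apply/eqP => /(congr1 (fun f : fps R => f 0%N)) /eqP.
by rewrite /fps_one /= oner_eq0.
Qed.

HB.instance Definition _ := GRing.Zmodule_isComNzRing.Build (fps R)
  fps_mulA fps_mulC fps_mul1 fps_mulDl fps_one_neq0.

Lemma fps1E n : (1 : fps R) n = (n == 0%N)%:R. Proof. by []. Qed.
Lemma fpsDE f g n : (f + g) n = f n + g n. Proof. by []. Qed.
Lemma fpsNE f n : (- f) n = - f n. Proof. by []. Qed.
Lemma fpsME f g n : (f * g) n = \sum_(i < n.+1) f i * g (n - i)%N.
Proof. by []. Qed.

Lemma fps_sumE (I : Type) (r : seq I) (P : pred I) (F : I -> fps R) n :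
  (\sum_(i <- r | P i) F i) n = \sum_(i <- r | P i) F i n.
Proof. by elim/big_rec2: _ => // i x y _ <-. Qed.

Lemma fpsM_0 f g : (f * g) 0%N = f 0%N * g 0%N.
Proof. by rewrite fpsME big_ord1. Qed.

Lemma fps_prod_0 (I : Type) (r : seq I) (P : pred I) (F : I -> fps R) :
  (\prod_(i <- r | P i) F i) 0%N = \prod_(i <- r | P i) F i 0%N.
Proof. by elim/big_rec2: _ => // i x y _ <-; rewrite fpsM_0. Qed.

Definition fmono (c : R) (k : nat) : fps R := fun n => if n == k then c else 0.

Lemma fmonoM c k f n :
  (fmono c k * f) n = if (k <= n)%N then c * f (n - k)%N else 0.
Proof.
rewrite fpsME; case: leqP => kn; last first.
  rewrite big1 // => i _; rewrite /fmono; case: eqP => [ik|]; rewrite ?mul0r //.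
  by move: (ltn_ord i); rewrite ik ltnS leqNgt kn.
rewrite (bigD1 (Ordinal (kn : (k < n.+1)%N))) //= /fmono eqxx big1 ?addr0 // => i.
by rewrite -val_eqE /= => /negPf ->; rewrite mul0r.
Qed.

Lemma fmono_mul c k d l : fmono c k * fmono d l = fmono (c * d) (k + l).
Proof.
apply/funext => n; rewrite fmonoM /fmono; case: leqP => kn.
  by rewrite -(eqn_add2l k) subnKC //; case: eqP; rewrite ?mulr0.
by case: eqP => // nE; rewrite nE ltnNge leq_addr in kn.
Qed.

Lemma fmono_prod (I : Type) (r : seq I) (P : pred I) (c : I -> R) (k : I -> nat) :
  \prod_(i <- r | P i) fmono (c i) (k i) =
  fmono (\prod_(i <- r | P i) c i) (\sum_(i <- r | P i) k i).
Proof.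
elim: r => [|i r IHr].
  by rewrite !big_nil; apply/funext => n; rewrite /fmono fps1E; case: eqP.
by rewrite !big_cons; case: (P i); rewrite ?IHr ?fmono_mul.
Qed.

Lemma eq_fpsM N f f' g g' :
  (forall n, (n <= N)%N -> f n = f' n) -> (forall n, (n <= N)%N -> g n = g' n) ->
  forall n, (n <= N)%N -> (f * g) n = (f' * g') n.
Proof.
move=> ef eg n nN; rewrite !fpsME; apply: eq_bigr => i _.
rewrite ef ?eg //; first exact: leq_trans (leq_subr _ _) nN.
by apply: leq_trans nN; rewrite -ltnS.
Qed.

(** Only the coefficients of degree at most [n] of the factors matter, and
    on these a factor is a sum of monomials: distributivity does the rest. *)
Lemma fps_prodE (I : finType) (F : I -> fps R) n :
  (\prod_i F i) n =
  \sum_(phi : {ffun I -> 'I_n.+1} | (\sum_i phi i == n)%N)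
     \prod_i F i (phi i).
Proof.
pose T i : fps R := \sum_(j < n.+1) fmono (F i j) j.
transitivity ((\prod_i T i) n).
  suff: forall k, (k <= n)%N -> (\prod_i F i) k = (\prod_i T i) k by apply.
  elim/big_rec2: _ => // i y1 y2 _ IH; apply: eq_fpsM => // k kn.
  rewrite /T fps_sumE (bigD1 (Ordinal (kn : (k < n.+1)%N))) //= /fmono eqxx.
  rewrite big1 ?addr0 // => j; rewrite -val_eqE eq_sym => /=.
  by case: eqP.
rewrite /T bigA_distr_bigA /= fps_sumE [RHS]big_mkcond /=.
by apply: eq_bigr => phi _; rewrite fmono_prod /fmono eq_sym.
Qed.

(** The derivation [X d/dX]. *)
Definition fder f : fps R := fun n => f n *+ n.

Lemma fderM f g : fder (f * g) = fder f * g + f * fder g.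
Proof.
apply/funext => n; rewrite fpsDE /fder !fpsME -sumrMnl -big_split /=.
apply: eq_bigr => i _; rewrite mulrnAl mulrnAr -mulrnDr subnKC //.
by rewrite -ltnS.
Qed.

Lemma fder1 : fder 1 = 0.
Proof. by apply/funext => -[|n] //; rewrite /fder fps1E mul0rn. Qed.

Lemma fderD f g : fder (f + g) = fder f + fder g.
Proof. by apply/funext => n; rewrite /fder !fpsDE mulrnDl. Qed.

Lemma fder_prod (I : Type) (r : seq I) (P : pred I) (F B : I -> fps R) :
  (forall i, P i -> fder (F i) = B i * F i) ->
  fder (\prod_(i <- r | P i) F i) =
  (\sum_(i <- r | P i) B i) * \prod_(i <- r | P i) F i.
Proof.
move=> dF; elim/big_rec2: _ => [|i b f Pi dE]; first by rewrite fder1 mul0r.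
by rewrite fderM dE dF // mulrDl !mulrA; congr (_ + _); rewrite mulrAC [_ * b]mulrC mulrA.
Qed.

Lemma fder_exp b f n : fder f = b -> fder (f ^+ n) = (b * f ^+ n.-1) *+ n.
Proof.
move=> df; elim: n => [|n IH]; first by rewrite fder1 mulr0n.
rewrite exprS fderM df IH mulrS /=; congr (_ + _).
by rewrite mulrnAr mulrCA; case: n {IH} => [|n]; rewrite ?mulr0n // -exprS.
Qed.

(** The geometric series [1 / (1 - y X^k)] and its logarithmic derivative. *)
Definition fgeo (y : R) (k : nat) : fps R :=
  fun n => if (k %| n)%N then y ^+ (n %/ k) else 0.
Definition dlog_fgeo (y : R) (k : nat) : fps R :=
  fun n => if (k %| n)%N && (0 < n)%N then y ^+ (n %/ k) *+ k else 0.

Lemma fgeoK y k : (0 < k)%N -> fgeo y k * (1 - fmono y k) = 1.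
Proof.
move=> k0; rewrite mulrC mulrBl mul1r; apply/funext => n.
rewrite fpsDE fpsNE fmonoM fps1E /fgeo; case: leqP => kn.
  rewrite -(subnK kn); set j := (n - k)%N; rewrite addnK dvdn_addl ?dvdnn //.
  rewrite divnDr ?dvdnn // divnn k0 addn1 exprS addn_eq0 andbC eqn0Ngt k0.
  by case: ifP; rewrite ?mulr0 subrr.
rewrite subr0; case: n kn => [|n] kn; first by rewrite dvdn0 div0n.
by rewrite gtnNdvd.
Qed.

Lemma fder_fgeo y k : (0 < k)%N -> fder (fgeo y k) = dlog_fgeo y k * fgeo y k.
Proof.
move=> k0.
have dK : fder (fgeo y k) * (1 - fmono y k) = fgeo y k * fmono (y *+ k) k.
  have := fderM (fgeo y k) (1 - fmono y k); rewrite fgeoK // fder1 fderD fder1.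
  rewrite add0r; have -> : fder (- fmono y k) = - fmono (y *+ k) k.
    apply/funext => n; rewrite /fder !fpsNE /fmono; case: eqP => [->|_].
      by rewrite mulNrn.
    by rewrite oppr0 mul0rn.
  by rewrite mulrN => /esym/eqP; rewrite subr_eq0 => /eqP.
have -> : dlog_fgeo y k = fgeo y k * fmono (y *+ k) k.
  apply/funext => n; rewrite mulrC fmonoM /dlog_fgeo /fgeo; case: (leqP k n) => kn.
    rewrite -(subnK kn); set j := (n - k)%N; rewrite addnK dvdn_addl ?dvdnn //.
    rewrite divnDr ?dvdnn // divnn k0 addn1 exprS addn_gt0 k0 orbT andbT.
    by case: ifP; rewrite ?mulr0 // mulrnAl.
  by case: n kn => [|n] kn; rewrite ?andbF // gtnNdvd.
by rewrite -dK mulrAC -mulrA fgeoK // mulr1.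
Qed.

Lemma fder_binomial y k : (0 < k)%N ->
  fder (1 + fmono y k) = - dlog_fgeo (- y) k * (1 + fmono y k).
Proof.
move=> k0; have yK : 1 + fmono y k = 1 - fmono (- y) k.
  by congr (_ + _); apply/funext => n; rewrite fpsNE /fmono; case: eqP;
    rewrite ?opprK ?oppr0.
have gK := fgeoK (- y) k0; rewrite -yK in gK.
have := fderM (fgeo (- y) k) (1 + fmono y k); rewrite gK fder1.
rewrite fder_fgeo // -mulrA gK mulr1 => /esym/eqP.
by rewrite addrC addr_eq0 => /eqP E; rewrite -E mulrAC gK mul1r.
Qed.

(** In the variable [t = X^k], this is [(1 + y t) / (1 - z t^2)]: the exponent of
    [y] is the parity of the degree, and that of [z] is half the degree. *)
Lemma fgeo_binomial y z k n : (0 < k)%N ->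
  ((1 + fmono y k) * fgeo z k.*2) n =
  if (k %| n)%N then y ^+ odd (n %/ k) * z ^+ (n %/ k)./2 else 0.
Proof.
move=> k0; rewrite mulrDl mul1r fpsDE fmonoM /fgeo.
have dvd2 j : (k.*2 %| j * k)%N = ~~ odd j.
  by rewrite -mul2n dvdn_pmul2r // dvdn2.
have div2 j : (j * k %/ k.*2 = j./2)%N by rewrite -mul2n divnMr // divn2.
case: (boolP (k %| n)%N) => kn; last first.
  have k2 j : ~~ (k %| j)%N -> (k.*2 %| j)%N = false.
    by apply: contraNF; apply: dvdn_trans; rewrite -mul2n dvdn_mull.
  rewrite k2 //= add0r; case: leqP => // le; rewrite k2 ?mulr0 //.
  by rewrite -(dvdn_addl _ (dvdnn k)) subnK.
move/dvdnP: kn => [j ->]; rewrite mulnK // dvd2 div2.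
case: leqP => [kj|jk]; last first.
  have -> : j = 0%N by case: j jk => // j; rewrite mulSn ltnNge leq_addr.
  by rewrite addr0 mul1r.
have j0 : (0 < j)%N by case: j kj => //; rewrite mul0n leqNgt k0.
have -> : (j * k - k = j.-1 * k)%N by rewrite -{2}[k]mul1n -mulnBl subn1.
rewrite dvd2 div2; case: j j0 {kj} => // j _ /=; rewrite negbK uphalf_half.
by case: (odd j) => /=; rewrite ?expr0 ?expr1 ?mul1r ?mulr0 ?addr0 ?add0r.
Qed.

End FpsRing.
Arguments fmono {R} c k.

(** The coefficient of degree [n] of [fder f = b * f] expresses [n f_n] through
    the coefficients of [f] of smaller degree. The bound [N] is there because
    the series attached to words of a fixed length have the expected
    logarithmic derivative only up to some degree. *)
Lemma dlog_unique (R : numDomainType) (f f' b b' : fps R) N :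
  f 0%N = f' 0%N -> b 0%N = 0 -> b' 0%N = 0 ->
  (forall n, (n <= N)%N -> b n = b' n) ->
  fder f = b * f -> fder f' = b' * f' ->
  forall n, (n <= N)%N -> f n = f' n.
Proof.
move=> f0 b0 b'0 bb' df df'; elim/ltn_ind => -[|n] IH nN //.
have /(congr1 (fun h => h n.+1)) := df; have /(congr1 (fun h => h n.+1)) := df'.
rewrite /fder !fpsME !(big_ord_recl n.+1) b0 b'0 !mul0r !add0r.
move=> e' e; apply: (@pmulrnI _ n.+1) => //; rewrite e e'.
apply: eq_bigr => i _; rewrite lift0 subSS bb'; last first.
  by apply: leq_trans nN; rewrite ltn_ord.
by rewrite IH // ?ltnS ?leq_subr // (leq_trans (leq_subr _ _)) ?(ltnW nN).
Qed.

(** * The shelf shuffle as the standardization of a signed word *)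

(** Letters are ranked shelf by shelf, the top of a shelf before its bottom. *)
Definition code (m : nat) (a : choice_of_place m) : nat := (a.1).*2 + ~~ a.2.

Lemma code_inj m : injective (@code m).
Proof.
move=> [a b] [a' b'] /= H; rewrite /code /= in H.
have hb : b = b'.
  by move/(congr1 odd): H; rewrite !oddD !odd_double !oddb => /negb_inj.
by congr (_, _) => //; apply/val_inj/double_inj; move: H; rewrite hb => /addIn.
Qed.

Lemma code_lt m (a : choice_of_place m) : (code a < m.*2)%N.
Proof.
by rewrite /code; have := ltn_ord a.1; case: a.2 => /=; lia.
Qed.

(** The larger labels are dealt first. Hence, within a shelf, the cards put on
    top end up in increasing order, and the cards put at the bottom follow them
    in decreasing order. *)
Definition before (n m : nat) (w : 'I_n -> choice_of_place m) (c c' : 'I_n) :=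
  (code (w c) < code (w c'))%N ||
  (w c == w c') && (if (w c).2 then c < c' else c' < c)%N.

Section Deck.
Variables (n m : nat) (w : 'I_n -> choice_of_place m).

Lemma dealE (l : seq 'I_n) a :
  foldr (fun c piles => place c (w c) piles) (fun=> [::]) l a =
  [seq c <- l | w c == (a, true)] ++ rev [seq c <- l | w c == (a, false)].
Proof.
elim: l => //= c l IH; rewrite {1}/place; case: (w c) => b t /=.
case: t; rewrite !xpair_eqE /= ?andbT ?andbF [a == b]eq_sym.
  by case: eqP => _; rewrite IH.
by case: eqP => _; rewrite IH ?rev_cons ?rcons_cat.
Qed.

Lemma enum_ord_pairwise k : pairwise (fun i j : 'I_k => (i < j)%N) (enum 'I_k).
Proof.
rewrite -(pairwise_map val ltn) val_enum_ord.
by rewrite -sorted_pairwise ?iota_ltn_sorted //; apply: ltn_trans.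
Qed.

Lemma mem_deal a c : (c \in deal w a) = ((w c).1 == a).
Proof.
rewrite /deal dealE mem_cat mem_rev !(mem_filter _ c (enum 'I_n)) mem_enum !andbT.
by case: (w c) => b [] /=; rewrite !xpair_eqE /= ?andbT ?andbF ?orbF.
Qed.

Lemma deal_pairwise a : pairwise (before w) (deal w a).
Proof.
have sub (b : bool) (r : rel 'I_n) :
    (forall c c', r c c' -> w c = (a, b) -> w c' = (a, b) -> before w c c') ->
    forall l : seq 'I_n, pairwise r l -> {subset l <= [pred c | w c == (a, b)]} ->
    pairwise (before w) l.
  move=> H l rl /allP sl; move: rl.
  apply: (@sub_in_pairwise _ [pred c | w c == (a, b)]) => //.
  by move=> c c' /eqP hc /eqP hc' /H; apply.
rewrite /deal dealE pairwise_cat; apply/and3P; split.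
- apply/allrelP => c c'; rewrite mem_rev !(mem_filter _ _ (enum 'I_n)) => /andP[/eqP hc _].
  by move=> /andP[/eqP hc' _]; rewrite /before /code hc hc' /= addn0 addn1 ltnSn.
- apply: (sub true (fun i j : 'I_n => (i < j)%N)).
  + by move=> c c' cc' hc hc'; rewrite /before hc hc' eqxx /= cc' orbT.
  + exact/pairwise_filter/enum_ord_pairwise.
  + by move=> c; rewrite mem_filter inE => /andP[].
apply: (sub false (fun i j : 'I_n => (j < i)%N)).
- by move=> c c' cc' hc hc'; rewrite /before hc hc' eqxx /= cc' orbT.
- rewrite -sorted_pairwise ?rev_sorted; last by move=> x y z /[swap]; apply: ltn_trans.
  rewrite sorted_pairwise; last by move=> x y z; apply: ltn_trans.
  exact/pairwise_filter/enum_ord_pairwise.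
by move=> c; rewrite mem_rev mem_filter inE => /andP[].
Qed.

Lemma deck_pairwise : pairwise (before w) (shuffled_deck w).
Proof.
rewrite /shuffled_deck; have := enum_ord_pairwise m.
elim: (enum 'I_m) => //= a l IH /andP[al /IH {}IH].
rewrite pairwise_cat deal_pairwise IH /= andbT; apply/allrelP => c c'.
rewrite mem_deal => /eqP hc /flatten_mapP[b bl]; rewrite mem_deal => /eqP hc'.
apply/orP; left; rewrite /code hc hc'; move/allP: al => /(_ b bl) /= ab.
apply: (@leq_trans (a.+1.*2)); last by rewrite (leq_trans _ (leq_addr _ _)) ?leq_double.
by rewrite doubleS -addn2 -addnS leq_add2l; case: (w c).2.
Qed.

Lemma deck_uniq : uniq (shuffled_deck w).
Proof.
apply: pairwise_uniq deck_pairwise => c.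
by rewrite /before !ltnn if_same andbF.
Qed.

Lemma deck_perm : perm_eq (shuffled_deck w) (enum 'I_n).
Proof.
apply: uniq_perm; rewrite ?deck_uniq ?enum_uniq // => c.
rewrite mem_enum; apply/flatten_mapP; exists (w c).1; rewrite ?mem_enum //.
by rewrite mem_deal.
Qed.

Lemma size_deck : size (shuffled_deck w) = n.
Proof. by rewrite (perm_size deck_perm) size_enum_ord. Qed.

Let std_fun (j : 'I_n) : 'I_n := nth j (shuffled_deck w) j.

Fact std_inj : injective std_fun.
Proof.
move=> j j'; rewrite /std_fun (set_nth_default j') ?size_deck // => /eqP.
by rewrite nth_uniq ?deck_uniq ?size_deck // => /eqP /val_inj.
Qed.

(** The permutation from positions to labels produced by the choices [w]. Its
    inverse is the standardization of the word [w] for the order of letters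
    above, the letters that put a card at the bottom being numbered from right
    to left. *)
Definition std : 'S_n := perm std_inj.

Lemma deck_std (s : 'S_n) :
  (shuffled_deck w == [seq s j | j <- enum 'I_n]) = (std == s).
Proof.
have stdE : shuffled_deck w = [seq std j | j <- enum 'I_n].
  case: (posnP n) => [n0|n0].
    rewrite [LHS]size0nil ?size_deck // [RHS]size0nil //.
    by rewrite size_map size_enum_ord.
  apply: (@eq_from_nth _ (Ordinal n0)); first by rewrite size_map size_enum_ord size_deck.
  move=> i; rewrite size_deck => iN.
  rewrite (nth_map (Ordinal n0)) ?size_enum_ord // permE /std_fun.
  by rewrite nth_enum_ord // (set_nth_default (Ordinal n0)) ?size_deck.
rewrite stdE; apply/eqP/eqP => [|-> //].
by move/eq_in_map => H; apply/permP => j; apply: H; rewrite mem_enum.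
Qed.

Lemma std_before (j j' : 'I_n) : (j < j')%N -> before w (std j) (std j').
Proof.
move=> jj'; have n0 : (0 < n)%N by apply: leq_ltn_trans (ltn_ord j).
have /(pairwiseP (std j)) := deck_pairwise => /(_ j j').
by rewrite !inE size_deck !ltn_ord !permE /std_fun => /(_ isT isT jj');
  rewrite ![nth (nth _ _ _) _ _](set_nth_default j) ?size_deck //
    [nth j' _ _](set_nth_default j) ?size_deck.
Qed.

End Deck.

Lemma shelf_law_sum (R : realType) (m : nat) (p : R) n (F : 'S_n -> R) :
  \sum_(s : 'S_n) shelf_law m p s * F s =
  \sum_(w : {ffun 'I_n -> choice_of_place m})
    (\prod_(c < n) (m%:R^-1 * (if (w c).2 then p else 1 - p))) * F (std w).
Proof.
rewrite /shelf_law; under eq_bigr do rewrite mulr_suml.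
rewrite (exchange_big_dep predT) //=; apply: eq_bigr => w _.
by under eq_bigl do rewrite deck_std eq_sym; rewrite big_pred1_eq.
Qed.

(** * Orbits of a permutation *)

Lemma porbit_fix (T : finType) (s : {perm T}) x i :
  ((s ^+ i)%g x == x) = (#|porbit s x| %| i)%N.
Proof.
set k := #|porbit s x|.
have k0 : (0 < k)%N by rewrite lt0n card_porbit_neq0.
have sk j : (s ^+ (j * k))%g x = x.
  elim: j => [|j IH]; first by rewrite mul0n expg0 perm1.
  by rewrite mulSn expgnDr permM [(s ^+ k)%g x]permX iter_porbit IH.
apply/eqP/idP => [|/dvdnP[j ->] //].
rewrite {1}(divn_eq i k) expgnDr permM sk => e.
apply/eqP; have rk : (i %% k < k)%N by rewrite ltn_mod.
have := uniq_traject_porbit s x; rewrite -/k => /(nth_uniq x) u.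
have := u (i %% k)%N 0%N; rewrite size_traject !nth_traject // => /(_ rk k0).
by rewrite -permX e eqxx => /esym/eqP.
Qed.

Lemma big_porbit (T : finType) (R : Type) (idx : R) (op : Monoid.com_law idx)
    (s : {perm T}) x (F : T -> R) :
  \big[op/idx]_(y in porbit s x) F y =
  \big[op/idx]_(t < #|porbit s x|) F ((s ^+ t)%g x).
Proof.
have -> : \big[op/idx]_(y in porbit s x) F y =
    \big[op/idx]_(y <- traject s x #|porbit s x|) F y.
  by rewrite big_uniq ?uniq_traject_porbit //; apply: eq_bigl => y; rewrite porbit_traject.
rewrite (big_nth x) size_traject big_mkord; apply: eq_bigr => t _.
by rewrite nth_traject // permX.
Qed.

Notation orbit_of s := {O : {set _} | O \in porbits s}.

Definition to_orbit (T : finType) (s : {perm T}) (x : T) : orbit_of s :=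
  exist _ (porbit s x) (imset_f (porbit s) (erefl (x \in predT))).

Lemma to_orbitE (T : finType) (s : {perm T}) (O : orbit_of s) x :
  (to_orbit s x == O) = (x \in val O).
Proof.
rewrite -val_eqE SubK.
by case/imsetP: (valP O) => y _ ->; rewrite eq_porbit_mem.
Qed.

Lemma sum_orbits (T : finType) (V : nmodType) (s : {perm T}) (F : orbit_of s -> V) :
  \sum_x F (to_orbit s x) = \sum_(O : orbit_of s) F O *+ #|val O|.
Proof.
rewrite (partition_big (to_orbit s) predT) //=; apply: eq_bigr => O _.
rewrite (eq_bigr (fun=> F O)) => [|x /eqP -> //].
by rewrite sumr_const; congr (_ *+ _); apply: eq_card => x; apply: to_orbitE.
Qed.

Lemma prod_orbits (T : finType) (R : comNzRingType) (s : {perm T}) (F : T -> R) :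
  \prod_x F x = \prod_(O : orbit_of s) \prod_(x in val O) F x.
Proof.
rewrite (partition_big (to_orbit s) predT) //=; apply: eq_bigr => O _.
by apply: eq_bigl => x; apply: to_orbitE.
Qed.

Lemma orbit_gt0 (T : finType) (s : {perm T}) (O : orbit_of s) : (0 < #|val O|)%N.
Proof.
by case: O => O /= /imsetP[y _ ->]; rewrite lt0n card_porbit_neq0.
Qed.

(** The iterates of a point moved by [s] would form a strictly monotone
    sequence, which cannot come back to its origin. *)
Lemma perm_increasing_id n (s : 'S_n) (S : pred 'I_n) :
  (forall c, S c -> S (s c)) ->
  (forall c c', S c -> S c' -> (c < c')%N -> (s c < s c')%N) ->
  forall c, S c -> s c = c.
Proof.
move=> Ss inc c Sc.
have Sit t : S (iter t s c) by elim: t => //= t; apply: Ss.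
case: (ltngtP (s c) c) => [lt|gt|/val_inj //].
- have H t : (iter t.+1 s c < c)%N.
    elim: t => // t IH; apply: ltn_trans IH.
    by elim: t.+1 => //= t' IH; apply: inc => //; apply: (Sit t'.+1).
  have := iter_porbit s c; have := card_porbit_neq0 s c.
  by case: #|porbit s c| => // t _ e; have := H t; rewrite e ltnn.
- have H t : (c < iter t.+1 s c)%N.
    elim: t => // t IH; apply: ltn_trans IH _.
    by elim: t.+1 => //= t' IH; apply: inc => //; apply: (Sit t'.+1).
  have := iter_porbit s c; have := card_porbit_neq0 s c.
  by case: #|porbit s c| => // t _ e; have := H t; rewrite e ltnn.
Qed.

Lemma ncycles_mul i n (s : 'S_n) :
  (i * ncycles i s)%N = #|[pred c | #|porbit s c| == i]|.
Proof.
rewrite /ncycles mulnC -sum_nat_const -[RHS]sum1_card.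
rewrite [RHS](partition_big (porbit s)
  (fun C => (C \in porbits s) && (#|C| == i))) /=; last first.
  by move=> c; rewrite inE => ->; rewrite andbT imset_f.
apply: eq_big => C; rewrite inE // => /andP[/imsetP[c _ ->] /eqP ci].
rewrite sum1_card -{1}ci; apply: eq_card => c'; rewrite -[RHS]topredE /= inE.
rewrite eq_porbit_mem; case: (boolP (c' \in _)) => [h|]; last by rewrite andbF.
by move: h; rewrite -eq_porbit_mem => /eqP ->; rewrite ci eqxx.
Qed.

(** * Cycles of a standardization and rotation orbits of its itineraries *)

Lemma card_sum (T : finType) (P : pred T) : #|P| = (\sum_x P x)%N.
Proof.
by rewrite -sum1_card big_mkcond; apply: eq_bigr => x _; rewrite -topredE /=; case: (P x).
Qed.

Section Itinerary.
Variables (n m : nat) (w : 'I_n -> choice_of_place m) (X : finType)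
  (rho : {perm X}) (lett : X -> choice_of_place m) (V : 'I_n -> X).
Let s : 'S_n := std w.
Hypothesis rhoV : forall c, rho (V c) = V (s c).
Hypothesis lettV : forall c, lett (V c) = w (s c).

(** Each letter that puts a card at the bottom of a shelf reverses the order of
    the cards that carry it; after a full turn around the orbit only the parity
    of the number of such letters matters. *)
Definition flips (O : {set X}) : bool :=
  \big[addb/false]_(x in O) ~~ (lett x).2.

(** Two positions with the same itinerary hold cards with the same letter, and
    the position order of these cards is the label order or its reverse
    according to that letter. *)
Lemma std_order c c' : V c = V c' -> c != c' ->
  (s c < s c')%N = (c < c')%N (+) ~~ (lett (V c)).2.
Proof.
move=> eV; have ww : w (s c) = w (s c') by rewrite -!lettV eV.
have one d d' : w (s d) = w (s d') -> (d < d')%N ->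
    (s d < s d')%N = (w (s d)).2 /\ (s d' < s d)%N = ~~ (w (s d)).2.
  move=> ee /(std_before w); rewrite /before -/s ee ltnn eqxx /=.
  by case: (w (s d')).2 => h; rewrite h; split=> //; apply/negbTE; rewrite -leqNgt ltnW.
rewrite lettV; case: (ltngtP c c') => [cc'|cc'|/val_inj ->]; last by rewrite eqxx.
  by case: (one c c' ww cc') => ->; case: (w _).2.
by case: (one c' c (esym ww) cc') => _ ->; rewrite ww; case: (w _).2.
Qed.

Lemma V_iter t c : V ((s ^+ t)%g c) = (rho ^+ t)%g (V c).
Proof.
by rewrite !permX; elim: t => //= t <-; rewrite rhoV.
Qed.

Lemma std_iter_order t c c' : V c = V c' -> c != c' ->
  ((s ^+ t)%g c < (s ^+ t)%g c')%N =
  (c < c')%N (+) \big[addb/false]_(i < t) ~~ (lett ((rho ^+ i)%g (V c))).2.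
Proof.
move=> eV cc'; elim: t => [|t IH]; first by rewrite big_ord0 addbF !expg0 !perm1.
rewrite !expgSr !permM std_order; first last.
- by rewrite (inj_eq perm_inj).
- by rewrite !V_iter eV.
by rewrite IH big_ord_recr /= addbA V_iter.
Qed.

Let per c := #|porbit rho (V c)|.

Lemma std_return_order c c' : V c = V c' -> c != c' ->
  ((s ^+ per c)%g c < (s ^+ per c)%g c')%N =
  (c < c')%N (+) flips (porbit rho (V c)).
Proof. by move=> eV cc'; rewrite std_iter_order // /flips big_porbit. Qed.

Lemma V_return c : V ((s ^+ per c)%g c) = V c.
Proof. by rewrite V_iter permX iter_porbit. Qed.

Lemma per_dvd c : (per c %| #|porbit s c|)%N.
Proof. by rewrite -porbit_fix -V_iter permX iter_porbit. Qed.

Lemma per_gt0 c : (0 < per c)%N.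
Proof. by rewrite lt0n card_porbit_neq0. Qed.

(** With an even number of flips, the first return to a given itinerary
    preserves the order, hence fixes every card. *)
Lemma cycle_even c : flips (porbit rho (V c)) = false -> #|porbit s c| = per c.
Proof.
move=> ev; apply/eqP; rewrite eqn_dvd per_dvd andbT -porbit_fix.
apply/eqP/(@perm_increasing_id _ _ (fun d => V d == V c)) => // d.
  by move=> /eqP e; have := V_return d; rewrite /per e => ->.
move=> d' /eqP e /eqP e' dd'; have := @std_return_order d d'.
rewrite e e' /per e ev addbF => -> //.
by apply: contraTneq dd' => ->; rewrite ltnn.
Qed.

(** With an odd number of flips the first return reverses the order, and its
    square preserves it. *)
Lemma return_odd c : flips (porbit rho (V c)) -> (#|porbit s c| %| (per c).*2)%N.
Proof.
move=> od; rewrite -porbit_fix -addnn.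
apply/eqP/(@perm_increasing_id _ _ (fun d => V d == V c)) => // d.
  move=> /eqP e; rewrite expgnDr permM; set d' := (s ^+ _)%g d.
  have e' : V d' = V c by have := V_return d; rewrite /per e.
  by have := V_return d'; rewrite /per e' => ->.
move=> d' /eqP e /eqP e' dd'; rewrite expgnDr !permM.
have ne : d != d' by apply: contraTneq dd' => ->; rewrite ltnn.
have pd : per d = per c by rewrite /per e.
have r d1 : V d1 = V c -> V ((s ^+ per c)%g d1) = V c.
  by move=> e1; have := V_return d1; rewrite /per e1.
have := @std_return_order ((s ^+ per c)%g d) ((s ^+ per c)%g d').
rewrite (inj_eq perm_inj) /per r // r // -/(per c) => -> //.
have := @std_return_order d d'; rewrite pd e e' => -> //.
by rewrite od dd'.
Qed.

Lemma cycle_odd c : flips (porbit rho (V c)) ->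
  #|porbit s c| = if (s ^+ per c)%g c == c then per c else (per c).*2.
Proof.
move=> od; have := return_odd od; rewrite porbit_fix.
case/dvdnP: (per_dvd c) => j ->; rewrite -mul2n dvdn_pmul2r ?per_gt0 // => j2.
have -> : (j * per c %| per c)%N = (j %| 1)%N.
  by rewrite -[X in (_ %| X)%N]mul1n dvdn_pmul2r ?per_gt0.
by case: j j2 => [|[|[|j]]] //; rewrite mul1n.
Qed.

Definition fiber (x : X) := #|[pred c | V c == x]|.

Lemma fiber_rho x : fiber (rho x) = fiber x.
Proof.
rewrite /fiber -(card_imset [pred c | V c == x] (@perm_inj _ s)); apply: eq_card => c.
rewrite -topredE /=; apply/eqP/imsetP => [e|[d]]; last first.
  by rewrite -topredE /= => /eqP <- ->; rewrite rhoV.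
exists (s^-1%g c); last by rewrite permKV.
by rewrite -topredE /=; apply/eqP/(@perm_inj _ rho); rewrite rhoV permKV.
Qed.

Lemma fiber_porbit x y : y \in porbit rho x -> fiber y = fiber x.
Proof.
by move=> /porbitP[i ->]; rewrite permX; elim: i => //= i <-; rewrite fiber_rho.
Qed.

(** An order-reversing involution of a finite chain has at most one fixed
    point, hence exactly one when the chain has an odd number of elements and
    none otherwise. *)
Lemma return_fixed_points x : flips (porbit rho x) ->
  #|[pred c | (V c == x) && ((s ^+ #|porbit rho x|)%g c == c)]| = odd (fiber x).
Proof.
move=> od; set f := (s ^+ #|porbit rho x|)%g.
(* The return map exchanges the cards that it moves up with those that it
   moves down. *)
pose S0 := [pred c | (V c == x) && (f c == c)].
pose S1 := [pred c | (V c == x) && (c < f c)%N].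
pose S2 := [pred c | (V c == x) && (f c < c)%N].
have Sf c : V c = x -> V (f c) = x.
  by move=> e; have := V_return c; rewrite /per e.
have f2 c : V c = x -> f (f c) = c.
  move=> e; have := return_odd (c := c); rewrite e => /(_ od).
  by rewrite -porbit_fix -addnn expgnDr permM /per e => /eqP.
have c12 : #|S1| = #|S2|.
  rewrite -(card_imset S1 (@perm_inj _ f)); apply: eq_card => c.
  rewrite -[RHS]topredE /=; apply/imsetP/andP => [[d]|[/eqP e lt]].
    by rewrite -topredE /= => /andP[/eqP e lt] ->; rewrite Sf // f2.
  by exists (f c); rewrite ?f2 // -topredE /= Sf // f2 ?eqxx.
have -> : fiber x = (#|S0| + #|S1|.*2)%N.
  rewrite -addnn addnA {2}c12 /fiber.
  rewrite !card_sum -!big_split /=.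
  apply: eq_bigr => c _; case: eqP => //= _.
  by case: (ltngtP c (f c)) => [h|h|/val_inj <-]; rewrite ?eqxx //;
    case: eqP => // E; move: h; rewrite E ltnn.
have le1 : (#|S0| <= 1)%N.
  rewrite leqNgt; apply/negP => /card_gt1P[c [d [/andP[/eqP e /eqP fc]]]].
  move=> /andP[/eqP e' /eqP fd] cd.
  have := @std_return_order c d; rewrite /per e e' od => /(_ erefl cd).
  by rewrite -/f fc fd; case: (c < d)%N.
rewrite oddD odd_double addbF.
by move: le1; rewrite -/S0; case: #|S0| => [|[]].
Qed.

(** The cards of an itinerary with an odd number of flips are exchanged in pairs
    by the first return, except for one fixed card when their number is odd. *)
Lemma fiber_cycles x i :
  #|[pred c | (V c == x) && (#|porbit s c| == i)]| =
  if flips (porbit rho x)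
  then ((#|porbit rho x| == i) * odd (fiber x) +
        ((#|porbit rho x|).*2 == i) * (fiber x)./2.*2)%N
  else ((#|porbit rho x| == i) * fiber x)%N.
Proof.
set k := #|porbit rho x|.
have k0 : (0 < k)%N by rewrite lt0n card_porbit_neq0.
case: ifP => od; last first.
  case: (eqVneq k i) => [ki|ki].
    rewrite mul1n; apply: eq_card => c; rewrite -!topredE /=.
    case: eqP => //= e; rewrite cycle_even /per e ?od //.
    by rewrite -/k ki eqxx.
  rewrite mul0n; apply: eq_card0 => c; rewrite -topredE /=.
  by case: eqP => //= e; rewrite cycle_even /per e ?od // -/k (negPf ki).
have e0 := return_fixed_points od; rewrite -/k in e0.
have tot : (#|[pred c | (V c == x) && ((s ^+ k)%g c == c)]| +
    #|[pred c | (V c == x) && ((s ^+ k)%g c != c)]|)%N = fiber x.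
  rewrite /fiber -(cardID [pred c | (s ^+ k)%g c == c] [pred c | V c == x]).
  by congr (_ + _)%N; apply: eq_card => c; rewrite !inE // andbC.
have e1 : #|[pred c | (V c == x) && ((s ^+ k)%g c != c)]| = (fiber x)./2.*2.
  by apply/(@addnI (odd (fiber x))); rewrite odd_double_half -e0 tot.
rewrite -e0 -e1.
rewrite !card_sum !big_distrr /= -big_split /=.
apply: eq_bigr => c _; case: eqP => //= e; last by rewrite !muln0.
rewrite cycle_odd /per e // -/k.
by case: (_ == c); rewrite /= ?muln1 ?muln0 ?addn0 ?add0n.
Qed.

End Itinerary.

Lemma prod_pick (R : comNzRingType) (y : nat -> R) K k a : (0 < k <= K)%N ->
  \prod_(i < K) y i.+1 ^+ ((k == i.+1) * a) = y k ^+ a.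
Proof.
case: k => // k /= kK; rewrite (bigD1 (Ordinal kK)) //= eqxx mul1n big1 ?mulr1 // => i.
by rewrite -val_eqE /= eqSS eq_sym => /negPf ->; rewrite mul0n expr0.
Qed.

Definition cycle_monomial (R : comNzRingType) (y : nat -> R) n (s : 'S_n) : R :=
  \prod_(C in porbits s) y #|C|.

Lemma cycle_monomialE (R : comNzRingType) (y : nat -> R) n (s : 'S_n) K :
  (n <= K)%N -> cycle_monomial y s = \prod_(i < K) y i.+1 ^+ ncycles i.+1 s.
Proof.
move=> nK; rewrite /cycle_monomial.
transitivity (\prod_(C in porbits s) \prod_(i < K) y i.+1 ^+ (#|C| == i.+1)).
  apply: eq_bigr => C /imsetP[c _ ->].
  have := @prod_pick R y K #|porbit s c| 1; rewrite expr1 => <-.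
    by apply: eq_bigr => i _; rewrite muln1.
  rewrite lt0n card_porbit_neq0 (leq_trans _ nK) //.
  by have := max_card (mem (porbit s c)); rewrite card_ord.
rewrite exchange_big /=; apply: eq_bigr => i _.
rewrite -expr_sum; congr (_ ^+ _); rewrite /ncycles -sum1_card big_mkcond [RHS]big_mkcond /=.
by apply: eq_bigr => C _; rewrite inE; case: (C \in _) => //=; case: eqP.
Qed.

(** Generating function of the number of cards over an orbit of [k] itineraries
    whose letters have total weight [W]: an orbit with an even number of flips
    carries cycles of length [k] only, an orbit with an odd number of flips at
    most one of them besides cycles of length [2 k]. *)
Definition orbit_series (R : comNzRingType) (y : nat -> R) (k : nat) (odd_flips : bool)
    (W : R) : fps R :=
  if odd_flips then (1 + fmono (y k * W) k) * fgeo (y k.*2 * W ^+ 2) k.*2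
  else fgeo (y k * W) k.

Section OrbitDecomposition.
Variables (n m : nat) (w : 'I_n -> choice_of_place m) (X : finType)
  (rho : {perm X}) (lett : X -> choice_of_place m) (V : 'I_n -> X).
Let s : 'S_n := std w.
Hypothesis rhoV : forall c, rho (V c) = V (s c).
Hypothesis lettV : forall c, lett (V c) = w (s c).

Definition load (O : {set X}) := #|[pred c | V c \in O]|.

(** All the itineraries of an orbit are followed by equally many cards. *)
Lemma load_fiber x : load (porbit rho x) = (#|porbit rho x| * fiber V x)%N.
Proof.
rewrite -sum_nat_const /load card_sum.
under [RHS]eq_bigr => y yx do rewrite -(fiber_porbit rhoV yx) /fiber card_sum.
rewrite exchange_big /=; apply: eq_bigr => c _.
case: (boolP (V c \in _)) => h; last first.
  by rewrite big1 // => y yx; case: eqP => // e; rewrite e yx in h.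
rewrite (bigD1 (V c)) //= eqxx big1 ?addn0 // => y /andP[_].
by rewrite eq_sym => /negPf ->.
Qed.

Lemma orbit_rep (O : orbit_of rho) : exists2 x, to_orbit rho x = O & val O = porbit rho x.
Proof.
case/imsetP: (valP O) => x _ e; exists x => //; apply/eqP.
by rewrite to_orbitE e porbit_id.
Qed.

Lemma load_to_orbit x : load (val (to_orbit rho x)) = (#|porbit rho x| * fiber V x)%N.
Proof. by rewrite SubK load_fiber. Qed.

Let mult (O : orbit_of rho) := (load (val O) %/ #|val O|)%N.

Let mult_to_orbit x : mult (to_orbit rho x) = fiber V x.
Proof. by rewrite /mult load_to_orbit SubK mulKn // lt0n card_porbit_neq0. Qed.

Let cyc i (O : orbit_of rho) : nat :=
  if flips lett (val O)
  then ((#|val O| == i) * odd (mult O) + (#|val O|.*2 == i) * (mult O)./2)%N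
  else ((#|val O| == i) * mult O)%N.

Lemma ncycles_orbits i : (0 < i)%N ->
  ncycles i s = (\sum_(O : orbit_of rho) cyc i O)%N.
Proof.
move=> i0; apply/eqP; rewrite -(eqn_pmul2l i0) ncycles_mul; apply/eqP.
pose F (O : orbit_of rho) : nat := if flips lett (val O)
  then ((#|val O| == i) * odd (mult O) + (#|val O|.*2 == i) * (mult O)./2.*2)%N
  else ((#|val O| == i) * mult O)%N.
transitivity (\sum_x F (to_orbit rho x))%N.
  transitivity (\sum_x #|[pred c | (V c == x) && (#|porbit s c| == i)]|)%N.
    under [RHS]eq_bigr do rewrite card_sum; rewrite exchange_big card_sum /=.
    apply: eq_bigr => c _; rewrite (bigD1 (V c)) //= eqxx big1 ?addn0 // => y.
    by rewrite eq_sym => /negPf ->.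
  apply: eq_bigr => x _; rewrite (fiber_cycles rhoV lettV).
  by rewrite /F mult_to_orbit SubK.
rewrite (sum_orbits (V := nat) F) big_distrr /=; apply: eq_bigr => O _.
have -> : F O *+ #|val O| = (F O * #|val O|)%N.
  by elim: #|val O| => [|k IH]; rewrite ?muln0 // mulrS IH mulnS.
rewrite /F /cyc; move: (odd (mult O)) (mult O)./2 (mult O) #|val O| => b h f k.
case: (flips _ _).
  case: (k =P i) => [->|_]; case: (k.*2 =P i) => [<-|_];
  by rewrite ?mul0n ?muln0 ?mul1n // ?addn0 ?add0n //; lia.
by case: (k =P i) => [->|_]; rewrite ?mul0n ?muln0 // mulnC.
Qed.

Lemma word_weight_orbits (R : comNzRingType) (wt : choice_of_place m -> R) :
  \prod_c wt (w c) = \prod_(O : orbit_of rho)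
    (\prod_(x in val O) wt (lett x)) ^+ mult O.
Proof.
transitivity (\prod_x wt (lett x) ^+ fiber V x).
  rewrite (reindex_inj (@perm_inj _ s)) /=; under eq_bigr do rewrite -lettV.
  rewrite (partition_big V predT) //=; apply: eq_bigr => x _.
  rewrite (eq_bigr (fun=> wt (lett x))) => [|c /eqP -> //].
  by rewrite prodr_const.
rewrite (prod_orbits rho); apply: eq_bigr => O _.
have [x eO ->] := orbit_rep O.
rewrite -prodrXl; apply: eq_bigr => y yx; congr (_ ^+ _).
by rewrite -eO mult_to_orbit (fiber_porbit rhoV yx).
Qed.

Lemma word_monomial_orbits (R : comNzRingType) (wt : choice_of_place m -> R) (y : nat -> R) :
  (\prod_c wt (w c)) * cycle_monomial y s =
  \prod_(O : orbit_of rho)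
    orbit_series y #|val O| (flips lett (val O)) (\prod_(x in val O) wt (lett x))
      (load (val O)).
Proof.
rewrite (word_weight_orbits wt).
rewrite (@cycle_monomialE _ _ _ _ (n + #|X|.*2)) ?leq_addr //.
under [X in _ * X]eq_bigr do rewrite ncycles_orbits // expr_sum.
rewrite exchange_big /= -big_split /=; apply: eq_bigr => O _.
set W := \prod_(x in _) _.
have [x eO vO] := orbit_rep O.
have k0 := orbit_gt0 O.
have kX : (#|val O| <= #|X|)%N by apply: max_card.
have X2 : (#|val O|.*2 <= n + #|X|.*2)%N.
    by apply: leq_trans (leq_addl _ _); rewrite leq_double.
have X1 : (#|val O| <= n + #|X|.*2)%N.
    by apply: leq_trans X2; rewrite -addnn leq_addr.
have lE : load (val O) = (mult O * #|val O|)%N.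
  by rewrite -eO mult_to_orbit load_to_orbit SubK mulnC.
rewrite lE /orbit_series /cyc; case: ifP => _.
  rewrite fgeo_binomial // dvdn_mull // mulnK //.
  under eq_bigr do rewrite exprD; rewrite big_split /= !prod_pick; first last.
  - by rewrite k0.
  - by rewrite double_gt0 k0.
  rewrite !(exprMn _ (y _)) -exprM mul2n mulrACA -exprD odd_double_half.
  by rewrite mulrC.
rewrite prod_pick; last by rewrite k0.
by rewrite /fgeo dvdn_mull // mulnK // exprMn mulrC.
Qed.

End OrbitDecomposition.

(** * Words correspond to loads of rotation orbits *)

Section Rotation.
Variables (A : Type) (l : nat).
Notation L := l.+1.

Definition rotate_fun (x : {ffun 'I_L -> A}) : {ffun 'I_L -> A} :=
  [ffun j => x (ordS j)].

Lemma iter_ordS t (j : 'I_L) : iter t (@ordS L) j = ((j + t) %% L)%N :> nat.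
Proof.
elim: t => [|t IH]; first by rewrite addn0 modn_small.
by rewrite iterS /= IH -addn1 modnDml addn1 addnS.
Qed.

Lemma iter_rotate t (x : {ffun 'I_L -> A}) j :
  iter t rotate_fun x j = x (iter t (@ordS L) j).
Proof. by elim: t j => //= t IH j; rewrite ffunE IH -iterSr. Qed.

Lemma rotate_inj : injective rotate_fun.
Proof.
move=> x y e; apply/ffunP => j.
have := congr1 (fun z : {ffun 'I_L -> A} => z (ord_pred j)) e.
by rewrite !ffunE ord_predK.
Qed.

End Rotation.

Definition rotation (A : finType) (l : nat) : {perm {ffun 'I_l.+1 -> A}} :=
  perm (@rotate_inj A l).

Lemma rotationX (A : finType) (l : nat) (x : {ffun 'I_l.+1 -> A}) t :
  (rotation A l ^+ t)%g x ord0 = x (inord (t %% l.+1)).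
Proof.
rewrite permX; transitivity (iter t (@rotate_fun A l) x ord0).
  by congr (fun_of_fin _ _); apply: eq_iter => z; rewrite permE.
rewrite iter_rotate; congr (x _); apply/val_inj => /=.
by rewrite iter_ordS add0n inordK // ltn_mod.
Qed.

(** Positions are ordered as their itineraries, for the lexicographic order
    reversed after each letter that puts a card at the bottom; [key] is an
    integer encoding of the first [T] letters, in base [m.*2], that is monotone
    for this order. *)
Section Key.
Variables (m : nat) (X : Type) (rho : X -> X) (lett : X -> choice_of_place m).

Fixpoint key (T : nat) (x : X) : nat :=
  if T is T'.+1 then
    (code (lett x) * m.*2 ^ T' +
     (if (lett x).2 then key T' (rho x) else (m.*2 ^ T').-1 - key T' (rho x)))%N
  else 0%N.

Let base_gt0 (x : X) T : (0 < m.*2 ^ T)%N.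
Proof.
by rewrite expn_gt0; apply/orP; left; apply: leq_ltn_trans (code_lt (lett x)).
Qed.

Lemma key_lt T x : (key T x < m.*2 ^ T)%N.
Proof.
elim: T x => [|T IH] x //=; rewrite expnS.
have := code_lt (lett x); have b0 := base_gt0 x T.
have u : ((if (lett x).2 then key T (rho x) else (m.*2 ^ T).-1 - key T (rho x))
  < m.*2 ^ T)%N.
  by case: ifP => // _; apply: leq_ltn_trans (leq_subr _ _) _; rewrite prednK.
move=> cl; apply: leq_trans (leq_mul cl (leqnn _)).
by rewrite mulSn addnC ltn_add2r.
Qed.

Let tail_lt T x :
  ((if (lett x).2 then key T (rho x) else (m.*2 ^ T).-1 - key T (rho x))
    < m.*2 ^ T)%N.
Proof.
case: ifP => _; first exact: key_lt.
by apply: leq_ltn_trans (leq_subr _ _) _; rewrite prednK ?base_gt0.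
Qed.

Lemma key_inj T x y : key T x = key T y ->
  forall t, (t < T)%N -> lett (iter t rho x) = lett (iter t rho y).
Proof.
elim: T x y => //= T IH x y e.
have ec : code (lett x) = code (lett y).
  have := congr1 (fun k => k %/ m.*2 ^ T)%N e.
  by rewrite !divnMDl ?(base_gt0 x) // !divn_small ?tail_lt // !addn0.
have el := code_inj ec.
move: e; rewrite el => /addnI e [|t] //; rewrite ltnS !iterSr.
apply: IH; move: e; case: ifP => // _.
move: (key_lt T (rho x)) (key_lt T (rho y)); lia.
Qed.

(** If [c < c'], the first letters of their itineraries are in order; when these
    letters are equal, the order of the next positions is the order of [c] and
    [c'] or its reverse, according to the letter, as in the definition of
    [key]. *)
Lemma key_mono n (w : 'I_n -> choice_of_place m) (V : 'I_n -> X) :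
  (forall c, rho (V c) = V (std w c)) -> (forall c, lett (V c) = w (std w c)) ->
  forall T (c c' : 'I_n), (c < c')%N -> (key T (V c) <= key T (V c'))%N.
Proof.
move=> rhoV lettV; elim=> //= T IH c c' /(std_before w) /orP[lt|].
  rewrite !lettV; apply: leq_trans (leq_addr _ _).
  have := tail_lt T (V c); rewrite !lettV => /ltnW tl.
  apply: leq_trans (leq_mul lt (leqnn _)).
  by rewrite mulSn addnC leq_add2r.
move=> /andP[/eqP e]; rewrite !lettV !rhoV e leq_add2l.
case: ifP => _ cc; first exact: IH.
exact/leq_sub2l/IH.
Qed.

End Key.

Section LoadInjective.
Variables (m n l : nat).
Hypothesis divL : forall k, (0 < k <= n)%N -> (k %| l.+1)%N.
Notation A := (choice_of_place m).
Notation X := {ffun 'I_l.+1 -> A}.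
Implicit Type w : {ffun 'I_n -> A}.

Let rho := rotation A l.
Definition first_letter (x : X) : A := x ord0.

(** The letters met along the cycle of the position [c], written on a circle of
    [l.+1] places, a multiple of the length of every cycle. *)
Definition itinerary w (c : 'I_n) : X :=
  [ffun j : 'I_l.+1 => w ((std w ^+ j.+1)%g c)].

Lemma std_expL w : (std w ^+ l.+1)%g = 1%g.
Proof.
apply/permP => c; rewrite perm1; apply/eqP; rewrite porbit_fix divL //.
rewrite lt0n card_porbit_neq0 /=.
by have := max_card (mem (porbit (std w) c)); rewrite card_ord.
Qed.

Lemma itinerary_rho w c : rho (itinerary w c) = itinerary w (std w c).
Proof.
apply/ffunP => j; rewrite permE !ffunE -permM -expgS.
have -> : ordS j = (j.+1 %% l.+1)%N :> nat by [].
by rewrite [in LHS]expgS expg_mod ?std_expL // -expgS.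
Qed.

Lemma itinerary_lett w c : first_letter (itinerary w c) = w (std w c).
Proof. by rewrite /first_letter ffunE expg1. Qed.

Lemma itinerary_last w c : itinerary w c ord_max = w c.
Proof. by rewrite ffunE std_expL perm1. Qed.

(** The keys of the successive positions form a sorted sequence, so the multiset
    of the itineraries determines the itinerary of each position, and with it
    the letter of each card, which is the last letter of its itinerary. *)
Lemma itinerary_fiber_inj w w' :
  (forall x, fiber (itinerary w) x = fiber (itinerary w') x) -> w = w'.
Proof.
move=> ef.
pose ks w := [seq key rho first_letter l.+1 (itinerary w c) | c <- enum 'I_n].
have srt u : sorted leq (ks u).
  rewrite sorted_pairwise; last exact: leq_trans.
  rewrite pairwise_map; apply: sub_pairwise (enum_ord_pairwise n) => c c'.
  by apply: key_mono; [apply: itinerary_rho | apply: itinerary_lett].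
have pe : perm_eq (ks w) (ks w').
  have kE u : ks u = map (key rho first_letter l.+1) (map (itinerary u) (enum 'I_n)).
    by rewrite -map_comp.
  rewrite !kE; apply: perm_map; apply/allP => x _ /=.
  have cnt u : count_mem x (map (itinerary u) (enum 'I_n)) = fiber (itinerary u) x.
    rewrite count_map -sum1_count /fiber -sum1_card big_enum_cond /=.
    by apply: eq_bigl => c.
  by rewrite !cnt ef.
have := sorted_eq leq_trans anti_leq (srt w) (srt w') pe.
move/eq_in_map => ek; apply/ffunP => c.
have {}ek := key_inj (ek c (mem_enum _ _)).
have := ek l (leqnn _).
have ord_maxE u : itinerary u c ord_max = first_letter (iter l rho (itinerary u c)).
  rewrite -permX /first_letter rotationX modn_small //.
  by congr (fun_of_fin _ _); apply/val_inj; rewrite /= inordK.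
by rewrite -!ord_maxE !itinerary_last.
Qed.

Definition loads w : {ffun orbit_of rho -> 'I_n.+1} :=
  [ffun O => inord (load (itinerary w) (val O))].

Lemma loadsE w O : loads w O = load (itinerary w) (val O) :> nat.
Proof.
rewrite ffunE inordK // ltnS.
by have := max_card [pred c | itinerary w c \in val O]; rewrite card_ord.
Qed.

Lemma loads_sum w : (\sum_O loads w O)%N = n.
Proof.
under eq_bigr do rewrite loadsE /load card_sum.
rewrite exchange_big /= -[RHS]card_ord -sum1_card; apply: eq_bigr => c _.
under eq_bigr do rewrite -to_orbitE.
rewrite (bigD1 (to_orbit rho (itinerary w c))) // eqxx big1 // => O.
by rewrite eq_sym => /negPf ->.
Qed.

Lemma loads_inj : injective loads.
Proof.
move=> w w' e; apply: itinerary_fiber_inj => x.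
have := congr1 (fun phi : {ffun orbit_of rho -> 'I_n.+1} => val (phi (to_orbit rho x))) e.
rewrite /= !loadsE (load_to_orbit (itinerary_rho w)) (load_to_orbit (itinerary_rho w')).
by move/eqP; rewrite eqn_pmul2l ?lt0n ?card_porbit_neq0 // => /eqP.
Qed.

End LoadInjective.

(** * Moebius inversion *)

Lemma primes_mul_prime l a : prime l -> ~~ (l %| a)%N -> (0 < a)%N ->
  perm_eq (primes (l * a)) (l :: primes a).
Proof.
move=> pl la a0; apply: uniq_perm; rewrite ?primes_uniq //=.
  by rewrite primes_uniq andbT mem_primes (negPf la) !andbF.
by move=> q; rewrite (primesM _ (prime_gt0 pl) a0) primes_prime // !inE.
Qed.

Lemma moebius_mul_prime l a : prime l -> ~~ (l %| a)%N -> (0 < a)%N ->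
  moebius (l * a) = - moebius a.
Proof.
move=> pl la a0; have pe := primes_mul_prime pl la a0.
rewrite /moebius (perm_all _ pe) (perm_size pe) /= (lognM _ (prime_gt0 pl) a0).
rewrite logn_prime // eqxx lognE (negPf la) !andbF addn0 eqxx /=.
rewrite (@eq_in_all _ (fun q => logn q (l * a) == 1)%N (fun q => logn q a == 1)%N).
  by case: ifP; rewrite ?oppr0 // exprS mulN1r.
move=> q qa /=; rewrite (lognM _ (prime_gt0 pl) a0) logn_prime //.
case: (q =P l) => [e|] //; move: qa; rewrite e mem_primes (negPf la).
by rewrite !andbF.
Qed.

Lemma moebius_square_eq0 l d : prime l -> (0 < d)%N -> (l * l %| d)%N -> moebius d = 0.
Proof.
move=> pl d0 ld; rewrite /moebius; case: allP => // H.
have := H l; rewrite mem_primes pl d0 (dvdn_trans (dvdn_mulr l (dvdnn l)) ld).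
move=> /(_ isT) /eqP e; move: ld.
by rewrite -[(l * l)%N]/(l ^ 2)%N pfactor_dvdn // e.
Qed.

(** For the least prime divisor [l] of [k], multiplication by [l] pairs the
    divisors prime to [l] with those divisible by [l] once, which carry
    opposite values; the divisors divisible by [l * l] carry zero. *)
Lemma moebius_sum k : (0 < k)%N -> \sum_(d <- divisors k) moebius d = (k == 1%N)%:R.
Proof.
move=> k0; case: (ltngtP k 1%N) => [|k1|->]; first by rewrite ltnNge k0.
  set l := pdiv k; have pl : prime l := pdiv_prime k1.
  have lk : (l %| k)%N := pdiv_dvd k.
  pose r := [seq d <- divisors k | ~~ (l %| d)%N].
  have dk d : d \in divisors k -> (0 < d)%N by rewrite -dvdn_divisors //; apply: dvdn_gt0.
  rewrite (bigID (fun d => l %| d)%N) /=.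
  rewrite (bigID (fun d => l * l %| d)%N) /= big_seq_cond big1 ?add0r; last first.
    by move=> d /and3P[/dk d0 _ ll]; apply: moebius_square_eq0 ll.
  rewrite -[X in X + _]big_filter -[X in _ + X]big_filter -/r.
  have pe : perm_eq [seq d <- divisors k | (l %| d)%N && ~~ (l * l %| d)%N]
                    [seq (l * d)%N | d <- r].
    apply: uniq_perm; first by rewrite filter_uniq ?divisors_uniq.
      rewrite map_inj_uniq ?filter_uniq ?divisors_uniq // => a b /eqP.
      by rewrite eqn_pmul2l ?prime_gt0 // => /eqP.
    move=> d; rewrite mem_filter; apply/idP/mapP => [/andP[/andP[ld lld] dd]|[a]].
      move/dvdnP: ld lld dd => [a ->]; rewrite dvdn_pmul2r ?prime_gt0 // => la.
      rewrite -!dvdn_divisors // => ak; exists a; last by rewrite mulnC.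
      by rewrite mem_filter la -dvdn_divisors // (dvdn_trans _ ak) // dvdn_mulr.
    rewrite mem_filter -!dvdn_divisors // => /andP[la ak] ->.
    rewrite dvdn_mulr // dvdn_pmul2l ?prime_gt0 // la /=.
    by rewrite Gauss_dvd ?prime_coprime // lk.
  rewrite (perm_big _ pe) big_map -big_split big_seq big1 //= => a.
  rewrite mem_filter => /andP[la ak].
  by rewrite moebius_mul_prime ?(dk a ak) // addNr.
by rewrite big_seq1.
Qed.

Lemma divisors_double_sum (V : nmodType) i (F : nat -> nat -> V) : (0 < i)%N ->
  \sum_(d <- divisors i) \sum_(e <- divisors (i %/ d)) F d e =
  \sum_(k <- divisors i) \sum_(d <- divisors k) F d (k %/ d)%N.
Proof.
move=> i0.
have rng j (G : nat -> V) : (0 < j <= i)%N ->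
    \sum_(d <- divisors j) G d = \sum_(d < i.+1 | (d %| j)%N) G d.
  move=> /andP[j0 ji].
  rewrite -(big_mkord (fun d => d %| j)%N G) -big_filter; apply: perm_big.
  apply: uniq_perm; rewrite ?divisors_uniq ?filter_uniq ?iota_uniq // => d.
  rewrite mem_filter mem_iota -dvdn_divisors // andTb.
  by case: (boolP (d %| j)%N) => //= dj; rewrite ltnS (leq_trans (dvdn_leq _ dj)).
have le d : (d %| i)%N -> (0 < i %/ d <= i)%N.
  by move=> di; rewrite leq_div andbT divn_gt0 ?(dvdn_leq i0) // (dvdn_gt0 i0).
have eqv (d e : nat) : (d %| i)%N -> (e * d %| i)%N = (e %| i %/ d)%N.
  by move=> di; rewrite -{1}(divnK di) dvdn_pmul2r // (dvdn_gt0 i0).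
rewrite !rng ?i0 ?leqnn //.
transitivity (\sum_(d < i.+1 | (d %| i)%N) \sum_(k < i.+1 | (d %| k)%N && (k %| i)%N)
    F d (k %/ d)%N).
  apply: eq_bigr => d di; have d0 := dvdn_gt0 i0 di.
  rewrite (rng _ _ (le _ di)).
  rewrite [RHS](reindex_onto (fun e : 'I_i.+1 => inord (e * d) : 'I_i.+1)
      (fun k : 'I_i.+1 => inord (k %/ d) : 'I_i.+1)) /=.
    apply: eq_big => [e|e].
      case: (boolP (e %| i %/ d)%N) => [ed|ed].
        have le' : (e * d < i.+1)%N.
          by rewrite ltnS dvdn_leq // (eqv d e di).
        rewrite inordK // dvdn_mull // (eqv d e di) ed /=.
        by rewrite mulnK // inord_val eqxx.
      apply/esym/negP => /andP[/andP[h1 h2] /eqP h3].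
      move: ed; rewrite -(eqv d e di).
      move: (congr1 val h3) => /=; rewrite inordK; last first.
        by rewrite ltnS (leq_trans (leq_div _ _)) // -ltnS ltn_ord.
      by move=> <-; rewrite divnK // h2.
    move=> ed; rewrite inordK ?mulnK //.
    by rewrite ltnS dvdn_leq // (eqv d e di).
  move=> k /andP[dk ki]; apply/val_inj; rewrite /= inordK; last first.
    by rewrite inordK ?divnK // ltnS (leq_trans (leq_div _ _)) // -ltnS ltn_ord.
  by rewrite inordK ?divnK // ltnS (leq_trans (leq_div _ _)) // -ltnS ltn_ord.
rewrite (exchange_big_dep (fun k : 'I_i.+1 => (k %| i)%N)) /=; last by move=> d k _ /andP[].
apply: eq_bigr => k ki; rewrite rng ?(dvdn_gt0 i0 ki) ?(dvdn_leq i0 ki) //.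
apply: eq_bigl => d; rewrite ki andbT; case: (boolP (d %| k)%N) => dk.
  by rewrite andbT (dvdn_trans dk ki).
by rewrite andbF.
Qed.

Lemma moebius_inversion (R : comNzRingType) (N : nat) (T G : nat -> nat -> R) :
  (forall i r, (0 < i <= N)%N ->
     \sum_(d <- divisors i) T (i %/ d)%N (d * r)%N = G i r) ->
  forall i r, (0 < i <= N)%N ->
    \sum_(d <- divisors i) (moebius d)%:~R * G (i %/ d)%N (d * r)%N = T i r.
Proof.
move=> TG i r /andP[i0 iN].
transitivity (\sum_(d <- divisors i) \sum_(e <- divisors (i %/ d))
    (moebius d)%:~R * T (i %/ d %/ e)%N (e * (d * r))%N).
  rewrite big_seq [RHS]big_seq; apply: eq_bigr => d; rewrite -dvdn_divisors // => di.
  rewrite -big_distrr /= TG // (leq_trans (leq_div _ _) iN) andbT.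
  by rewrite divn_gt0 ?(dvdn_leq i0) // (dvdn_gt0 i0).
rewrite divisors_double_sum //.
transitivity (\sum_(k <- divisors i) (\sum_(d <- divisors k) moebius d)%:~R *
    T (i %/ k)%N (k * r)%N).
  rewrite big_seq [RHS]big_seq; apply: eq_bigr => k; rewrite -dvdn_divisors // => ki.
  have k0 := dvdn_gt0 i0 ki.
  rewrite rmorph_sum /= mulr_suml big_seq [RHS]big_seq.
  apply: eq_bigr => d; rewrite -dvdn_divisors // => dk.
  by rewrite -divnMA mulnA [(d * _)%N]mulnC divnK.
rewrite big_seq (eq_bigr (fun k => if k == 1%N then T i r else 0)); last first.
  move=> k; rewrite -dvdn_divisors // => ki; rewrite moebius_sum ?(dvdn_gt0 i0) //.
  by case: (k =P 1%N) => [->|_]; rewrite ?mul0r // divn1 mul1n mul1r.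
rewrite -big_seq (bigD1_seq 1%N) ?divisors_uniq -?dvdn_divisors //=.
by rewrite big1 ?addr0 // => k /negPf ->.
Qed.

(** * The cycle index of the shelf shuffle *)

Section OrbitTerms.
Variable R : comNzRingType.
Implicit Types (y : nat -> R) (W : R).

Definition dlog_orbit y (k : nat) (b : bool) W : fps R :=
  if b then - dlog_fgeo (- (y k * W)) k + dlog_fgeo (y k.*2 * W ^+ 2) k.*2
  else dlog_fgeo (y k * W) k.

Lemma fder_orbit_series y k b W : (0 < k)%N ->
  fder (orbit_series y k b W) = dlog_orbit y k b W * orbit_series y k b W.
Proof.
move=> k0; rewrite /orbit_series /dlog_orbit; case: b; last exact: fder_fgeo.
rewrite fderM fder_binomial // fder_fgeo ?double_gt0 // [RHS]mulrDl !mulrA.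
by congr (_ + _ * _); rewrite mulrC.
Qed.

Lemma orbit_series_0 y k b W : (0 < k)%N -> orbit_series y k b W 0%N = 1.
Proof.
move=> k0; rewrite /orbit_series; case: b; last by rewrite /fgeo dvdn0 div0n.
by rewrite fgeo_binomial // dvdn0 div0n !expr0 mulr1.
Qed.

(** Sign of the [r]-th power of a letter, or of a word, in the signed power
    sums: [(-1)^(r-1)] when the number of flips is odd. *)
Definition flip_sign (b : bool) (r : nat) : R := if b then - (-1) ^+ r else 1.

(** Contribution of a periodic itinerary to the coefficient of [y_i^r] in the
    logarithmic derivative. *)
Definition orbit_term (k : nat) (b : bool) W (i r : nat) : R :=
  flip_sign b r * W ^+ r *+ (k == i) + W ^+ (2 * r) *+ 2 *+ (b && (k.*2 == i)).

Lemma sum_divisors_pick k j (F : nat -> R) : (0 < j)%N ->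
  \sum_(i <- divisors j) F i *+ (k == i) = F k *+ (k %| j)%N.
Proof.
move=> j0; rewrite dvdn_divisors //; case: (boolP (k \in divisors j)) => kj.
  rewrite (bigD1_seq k) ?divisors_uniq //= eqxx big1 ?addr0 // => i.
  by rewrite eq_sym => /negPf ->.
rewrite big_seq big1 // => i ij; case: (k =P i) => // e.
by rewrite e ij in kj.
Qed.

Lemma sum_codivisors_pick k i (F : nat -> R) : (0 < i)%N ->
  \sum_(d <- divisors i) F d *+ (k == i %/ d)%N = F (i %/ k)%N *+ (k %| i)%N.
Proof.
move=> i0; rewrite big_seq.
case: (boolP (k %| i)%N) => ki; last first.
  rewrite big1 // => d; rewrite -dvdn_divisors // => di.
  by case: eqP => // e; rewrite e dvdn_div in ki.
have k0 := dvdn_gt0 i0 ki.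
have := sum_divisors_pick (i %/ k)%N F i0; rewrite dvdn_div // => <-.
rewrite [RHS]big_seq; apply: eq_bigr => d; rewrite -dvdn_divisors // => di.
congr (_ *+ nat_of_bool _); have d0 := dvdn_gt0 i0 di.
by rewrite -(eqn_pmul2r d0) divnK // -[RHS](eqn_pmul2l k0) [(k * (_ %/ _))%N]mulnC divnK // eq_sym.
Qed.

Lemma dlog_orbitE y k b W j : (0 < k)%N -> (0 < j)%N ->
  dlog_orbit y k b W j =
  (\sum_(i <- divisors j) y i ^+ (j %/ i) * orbit_term k b W i (j %/ i)) *+ k.
Proof.
move=> k0 j0; rewrite /dlog_orbit /orbit_term.
rewrite (eq_bigr (fun i =>
    (y i ^+ (j %/ i) * (flip_sign b (j %/ i) * W ^+ (j %/ i))) *+ (k == i) +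
    (y i ^+ (j %/ i) * (W ^+ (2 * (j %/ i)) *+ 2)) *+ (b && (k.*2 == i)))).
  2: by move=> i _; rewrite mulrDr; congr (_ + _); apply: mulrnAr.
rewrite big_split /=.
rewrite (sum_divisors_pick k (fun i => y i ^+ (j %/ i) *
  (flip_sign b (j %/ i) * W ^+ (j %/ i)))) //.
case: b => /=; last first.
  under [X in _ + X]eq_bigr do rewrite mulr0n.
  rewrite big1 // addr0 /dlog_fgeo j0 andbT mul1r exprMn.
  by case: (k %| j)%N; rewrite ?mul0rn.
rewrite (sum_divisors_pick k.*2 (fun i => y i ^+ (j %/ i) *
  (W ^+ (2 * (j %/ i)) *+ 2))) //.
rewrite fpsDE fpsNE /dlog_fgeo j0 !andbT mulrnDl; congr (_ + _).
  case: (k %| j)%N; rewrite ?oppr0 ?mul0rn // mulr1n -mulNrn; congr (_ *+ _).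
  by rewrite -mulN1r -[- (y k * W)]mulN1r !exprMn; ring.
case: (k.*2 %| j)%N; rewrite ?mul0rn // mulr1n -mul2n mulrnA exprMn -exprM.
by rewrite !mulrnAr.
Qed.

(** Raising a word with an odd number of flips to an even power gives a word with
    an even number of flips. The second part of [orbit_term] corrects the sign
    of these words, so that the sum over the divisors is the signed weight of
    the [i / k]-th power of the word. *)
Lemma sum_orbit_term k b W i r : (0 < i)%N ->
  \sum_(d <- divisors i) orbit_term k b W (i %/ d) (d * r) =
  (flip_sign b r * W ^+ r) ^+ (i %/ k) *+ (k %| i)%N.
Proof.
move=> i0; rewrite big_split /=.
rewrite (sum_codivisors_pick k (fun d => flip_sign b (d * r) * W ^+ (d * r))) //.
case: b => /=; last first.
  under [X in _ + X]eq_bigr do rewrite mulr0n.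
  by rewrite big1 // addr0 !mul1r mulnC exprM.
rewrite (sum_codivisors_pick k.*2 (fun d => W ^+ (2 * (d * r)) *+ 2)) //.
case: (boolP (k %| i)%N) => ki; last first.
  rewrite (_ : (k.*2 %| i)%N = false) ?addr0 //.
  by apply: contraNF ki; apply: dvdn_trans; rewrite -mul2n dvdn_mull.
have k0 := dvdn_gt0 i0 ki.
case/dvdnP: ki i0 => e -> i0; rewrite mulnK // -mul2n.
rewrite [(2 * k)%N]mulnC [(e * k)%N]mulnC dvdn_pmul2l // divnMl // dvdn2.
rewrite !mulr1n exprMn -exprM [(e * r)%N]mulnC (exprNn ((-1) ^+ r)) -exprM.
rewrite -[(-1) ^+ e]signr_odd; case oe: (odd e) => /=.
  by rewrite addr0 expr1 mulN1r.
rewrite [in (-1) ^+ (r * e)]mulnC exprM -signr_odd oe expr0 expr1n mul1r mulr1n.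
rewrite mulN1r mul1r divn2.
have -> : (2 * (e./2 * r) = r * e)%N.
  by rewrite mulnA mul2n -[e in RHS]odd_double_half oe add0n mulnC.
by rewrite mulr2n addKr.
Qed.
End OrbitTerms.

Lemma sum_divisors_inv (V : nmodType) j (F : nat -> V) : (0 < j)%N ->
  \sum_(d <- divisors j) F (j %/ d)%N = \sum_(d <- divisors j) F d.
Proof.
move=> j0.
have inv d : (d %| j)%N -> (j %/ (j %/ d) = d)%N.
  move=> dj; rewrite -{1}(divnK dj) mulKn // divn_gt0 ?(dvdn_gt0 j0) //.
  exact: dvdn_leq.
rewrite -(big_map (divn j) xpredT); apply: perm_big; apply: uniq_perm.
- rewrite map_inj_in_uniq ?divisors_uniq // => a b.
  by rewrite -!dvdn_divisors // => /inv {2}<- /inv {2}<- ->.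
- exact: divisors_uniq.
move=> d; rewrite -dvdn_divisors //; apply/mapP/idP => [[a]|dj].
  by rewrite -dvdn_divisors // => aj ->; apply: dvdn_div.
by exists (j %/ d)%N; rewrite -?dvdn_divisors ?inv // dvdn_div.
Qed.

Section PeriodicWords.
Variables (R : comNzRingType) (A : finType) (l : nat) (g : A -> R).
Notation X := {ffun 'I_l.+1 -> A}.
Let rho := rotation A l.

Lemma prod_periodic (x : X) i : (#|porbit rho x| %| i)%N ->
  \prod_(t < i) g ((rho ^+ t)%g x ord0) =
  (\prod_(z in porbit rho x) g (z ord0)) ^+ (i %/ #|porbit rho x|).
Proof.
rewrite big_porbit; set k := #|porbit rho x|.
have k0 : (0 < k)%N by rewrite lt0n card_porbit_neq0.
case/dvdnP=> e ->; rewrite mulnK //; elim: e => [|e IH]; first by rewrite mul0n big_ord0.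
rewrite mulSn big_split_ord /= exprS; congr (_ * _); rewrite -IH.
apply: eq_bigr => t _.
by rewrite expgD permM [(rho ^+ k)%g x]permX iter_porbit.
Qed.

(** The words fixed by the [i]-th power of the rotation are the periodic
    continuations of the words of length [i]. *)
Lemma sum_periodic i : (0 < i)%N -> (i %| l.+1)%N ->
  \sum_(x : X | (#|porbit rho x| %| i)%N) \prod_(t < i) g ((rho ^+ t)%g x ord0) =
  (\sum_a g a) ^+ i.
Proof.
move=> i0 il.
have -> : (\sum_a g a) ^+ i = \prod_(t < i) \sum_a g a.
  by rewrite prodr_const card_ord.
rewrite bigA_distr_bigA /=.
pose ext (v : {ffun 'I_i -> A}) : X := [ffun j : 'I_l.+1 => v (Ordinal (ltn_pmod j i0))].
have lettE x t : (rho ^+ t)%g x ord0 = x (inord (t %% l.+1)) by apply: rotationX.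
have il1 : (i <= l.+1)%N by apply: dvdn_leq.
pose res (x : X) : {ffun 'I_i -> A} := [ffun t : 'I_i => x (inord t)].
rewrite (reindex_onto ext res) /=; last first.
  move=> x; rewrite -porbit_fix => /eqP px; apply/ffunP => j; rewrite !ffunE /=.
  have per e t : (rho ^+ (e * i + t))%g x ord0 = (rho ^+ t)%g x ord0.
    rewrite expgD permM; congr (fun_of_fin ((rho ^+ t)%g _) _).
    elim: e => [|e IH]; first by rewrite mul0n expg0 perm1.
    by rewrite mulSn expgD permM px IH.
  have := per (j %/ i)%N (j %% i)%N; rewrite -divn_eq !lettE.
  have ji : (j %% i < l.+1)%N by apply: leq_trans il1; rewrite ltn_mod.
  by rewrite (modn_small (ltn_ord j)) inord_val (modn_small ji).
have rK v : res (ext v) = v.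
  apply/ffunP => t; rewrite !ffunE; congr (v _); apply/val_inj => /=.
  by rewrite inordK ?modn_small // (leq_trans (ltn_ord t)).
apply: eq_big => [v|v _].
  rewrite rK eqxx andbT -porbit_fix; apply/eqP/ffunP => j.
  rewrite permX.
  transitivity (iter i (@rotate_fun A l) (ext v) j).
    by congr (fun_of_fin _ _); apply: eq_iter => z; rewrite permE.
  rewrite iter_rotate !ffunE; congr (v _); apply/val_inj => /=.
  by rewrite iter_ordS modn_dvdm // modnDr.
apply: eq_bigr => t _; rewrite lettE ffunE; congr (g (v _)).
apply/val_inj => /=; rewrite inordK ?ltn_mod // modn_dvdm // modn_small //.
Qed.

End PeriodicWords.

Section CycleIndex.
Variables (R : realType) (m : nat) (wt : choice_of_place m -> R).
Hypothesis wt_sum : \sum_a wt a = 1.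
Notation A := (choice_of_place m).

(** Power sum of the weights in a signed alphabet. *)
Definition powsum (r : nat) : R := \sum_a flip_sign R (~~ a.2) r * wt a ^+ r.

Section FixedLength.
Variables (N l : nat).
Hypothesis divL : forall k, (0 < k <= N)%N -> (k %| l.+1)%N.
Notation X := {ffun 'I_l.+1 -> A}.
Let rho := rotation A l.
Let lett : X -> A := @first_letter m l.
Let W (O : {set X}) := \prod_(x in O) wt (lett x).

Lemma flip_sign_orbit (O : {set X}) r :
  \prod_(x in O) flip_sign R (~~ (lett x).2) r = flip_sign R (flips lett O) r.
Proof.
rewrite /flips; elim/big_rec2: _ => // x b c _ ->.
rewrite /flip_sign; case: (lett x).2 => /=; case: b => /=; rewrite ?mul1r ?mulr1 //.
by rewrite mulrNN -expr2 -exprM mulnC exprM sqrrN expr1n expr1n.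
Qed.

(** Signed sum of the [r]-th powers of the weights of the itineraries that produce
    cycles of length [i]: those of period [i] and, among those of period
    [i / 2], the ones with an odd number of flips. *)
Definition itinerary_sum (i r : nat) : R :=
  \sum_(x : X) orbit_term #|porbit rho x| (flips lett (porbit rho x))
    (W (porbit rho x)) i r.

(** Both sides enumerate the words of length [i] with the signed [r]-th power of
    their weight, the left one according to their primitive root. *)
Lemma itinerary_sum_powsum i r : (0 < i <= N)%N ->
  \sum_(d <- divisors i) itinerary_sum (i %/ d) (d * r) = powsum r ^+ i.
Proof.
move=> iN; have i0 : (0 < i)%N by case/andP: iN.
rewrite exchange_big /=.
under eq_bigr do rewrite sum_orbit_term //.
rewrite -(@sum_periodic R A l (fun a => flip_sign R (~~ a.2) r * wt a ^+ r)) ?divL //.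
rewrite [RHS]big_mkcond /=; apply: eq_bigr => x _.
case: ifP => px; last by rewrite mulr0n.
rewrite (@prod_periodic R A l (fun a => flip_sign R (~~ a.2) r * wt a ^+ r)) //.
rewrite mulr1n; congr (_ ^+ _).
by rewrite big_split /= prodrXl flip_sign_orbit.
Qed.

(** Generating function of the rotation-invariant multisets of words: the
    multiplicities of the orbits are chosen independently. *)
Definition cycle_series (y : nat -> R) : fps R :=
  \prod_(O : orbit_of rho) orbit_series y #|val O| (flips lett (val O)) (W (val O)).

Definition dlog_cycle_series (y : nat -> R) : fps R :=
  \sum_(O : orbit_of rho) dlog_orbit y #|val O| (flips lett (val O)) (W (val O)).

Lemma fder_cycle_series y :
  fder (cycle_series y) = dlog_cycle_series y * cycle_series y.
Proof. by apply: fder_prod => O _; rewrite fder_orbit_series ?orbit_gt0. Qed.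

Lemma cycle_series_0 y : cycle_series y 0%N = 1.
Proof.
by rewrite /cycle_series fps_prod_0 big1 // => O _; rewrite orbit_series_0 ?orbit_gt0.
Qed.

Lemma dlog_cycle_series_0 y : dlog_cycle_series y 0%N = 0.
Proof.
rewrite /dlog_cycle_series fps_sumE big1 // => O _; rewrite /dlog_orbit /dlog_fgeo.
by case: (flips _ _); rewrite ?fpsDE ?fpsNE !andbF ?oppr0 ?addr0.
Qed.

Lemma dlog_cycle_seriesE y j : (0 < j)%N -> dlog_cycle_series y j =
  \sum_(i <- divisors j) y i ^+ (j %/ i) * itinerary_sum i (j %/ i).
Proof.
move=> j0; rewrite /dlog_cycle_series fps_sumE.
under eq_bigr do rewrite dlog_orbitE ?orbit_gt0 //.
rewrite -(sum_orbits (fun O : orbit_of rho => \sum_(i <- divisors j) y i ^+ (j %/ i) *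
   orbit_term #|val O| (flips lett (val O)) (W (val O)) i (j %/ i))).
rewrite exchange_big /=; apply: eq_bigr => i _.
by rewrite /itinerary_sum mulr_sumr.
Qed.

Lemma itinerary_sum_total j : (0 < j <= N)%N ->
  \sum_(i <- divisors j) itinerary_sum i (j %/ i) = 1.
Proof.
move=> jN; have j0 : (0 < j)%N by case/andP: jN.
transitivity (powsum 1 ^+ j).
  rewrite -itinerary_sum_powsum // -[LHS]sum_divisors_inv //.
  rewrite big_seq [RHS]big_seq; apply: eq_bigr => d; rewrite -dvdn_divisors // => dj.
  congr (itinerary_sum _ _); rewrite muln1 -{1}(divnK dj) mulnC mulnK //.
  by rewrite divn_gt0 ?(dvdn_gt0 _ dj) // dvdn_leq.
rewrite /powsum (eq_bigr wt) ?wt_sum ?expr1n // => a _.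
by rewrite expr1 /flip_sign; case: a.2; rewrite /= ?expr1 ?opprK mul1r.
Qed.

(** Without cycle markers the logarithmic derivative is that of [1 / (1 - X)]. *)
Lemma cycle_series_1 j : (j <= N)%N -> cycle_series (fun=> 1) j = 1.
Proof.
move=> jN; have g1 i : fgeo (1 : R) 1 i = 1 by rewrite /fgeo dvd1n expr1n.
rewrite -[RHS](g1 j); move: j jN; apply: (dlog_unique _ _ _ _ (fder_cycle_series _)
  (fder_fgeo 1 (ltn0Sn 0))).
- by rewrite cycle_series_0 g1.
- exact: dlog_cycle_series_0.
- by rewrite /dlog_fgeo andbF.
move=> [|j] jN; first by rewrite dlog_cycle_series_0 /dlog_fgeo andbF.
rewrite dlog_cycle_seriesE // /dlog_fgeo dvd1n expr1n mulr1n /=.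
by under eq_bigr do rewrite expr1n mul1r; apply: itinerary_sum_total.
Qed.

End FixedLength.
End CycleIndex.

(** When an injection preserves weights and the total weights agree, what it
    misses has weight zero. *)
Lemma sum_weighted_injection (R : realDomainType) (I J : finType) (Q : pred J)
    (f : I -> J) (b G : J -> R) :
  injective f -> (forall i, Q (f i)) -> (forall j, 0 <= b j) ->
  (forall j, b j = 0 -> G j = 0) ->
  \sum_i b (f i) = \sum_(j | Q j) b j ->
  \sum_i G (f i) = \sum_(j | Q j) G j.
Proof.
move=> finj Qf b0 bG tot.
have img (H : J -> R) : \sum_i H (f i) = \sum_(j | Q j && (j \in codom f)) H j.
  rewrite (eq_bigl [in codom f]); last first.
    move=> j /=; case: (boolP (j \in codom f)); rewrite ?andbF //.
    by move=> /codomP[i ->]; rewrite Qf.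
  transitivity (\sum_(j <- codom f) H j).
    by rewrite big_map big_enum.
  by rewrite big_uniq //; apply/injectiveP.
rewrite img [RHS](bigID [in codom f]) /= [X in _ = _ + X]big1 ?addr0 //.
move: tot; rewrite img [RHS](bigID [in codom f]) /= -[LHS]addr0 => /addrI/esym/eqP.
rewrite psumr_eq0; last by move=> j _; apply: b0.
by move=> /allP H j Qj; apply/bG/eqP; have := H j (mem_index_enum _); rewrite Qj.
Qed.

Section WordSum.
Variables (R : realType) (m : nat) (wt : choice_of_place m -> R).
Hypothesis wt_gt0 : forall a, 0 < wt a.
Hypothesis wt_sum : \sum_a wt a = 1.
Notation A := (choice_of_place m).

Lemma orbit_series1_ge0 k b (W : R) n : (0 < k)%N -> 0 < W ->
  0 <= orbit_series (fun=> 1) k b W n.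
Proof.
move=> k0 W0; have W1 := ltW W0; rewrite /orbit_series !mul1r; case: b; last first.
  by rewrite /fgeo; case: ifP => // _; apply: exprn_ge0.
rewrite fgeo_binomial //; case: ifP => // _.
by rewrite mulr_ge0 // !exprn_ge0.
Qed.

Lemma orbit_series1_eq0 y k b (W : R) n : (0 < k)%N -> 0 < W ->
  orbit_series (fun=> 1) k b W n = 0 -> orbit_series y k b W n = 0.
Proof.
move=> k0 W0; rewrite /orbit_series !mul1r; case: b; last first.
  rewrite /fgeo; case: ifP => // _ /eqP; rewrite expf_eq0.
  by rewrite (gt_eqF W0) andbF.
rewrite !fgeo_binomial //; case: ifP => // _ /eqP.
by rewrite mulf_eq0 !expf_eq0 (gt_eqF W0) !andbF.
Qed.

(** Words inject into loads of orbits, preserving weights and cycle counts. By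
    [cycle_series_1] the loads of total [n] have total weight 1, like the words
    of length [n], so that no load of positive weight is missed. *)
Lemma word_sum_cycle_series (y : nat -> R) n l :
  (forall k, (0 < k <= n)%N -> (k %| l.+1)%N) ->
  \sum_(w : {ffun 'I_n -> A}) (\prod_c wt (w c)) * cycle_monomial y (std w) =
  cycle_series wt l y n.
Proof.
move=> divL; set rho := rotation A l.
pose os (y : nat -> R) (O : orbit_of rho) := orbit_series y #|val O|
  (flips (@first_letter m l) (val O)) (\prod_(x in val O) wt (first_letter x)).
pose G (y : nat -> R) (phi : {ffun orbit_of rho -> 'I_n.+1}) : R :=
  \prod_(O : orbit_of rho) os y O (phi O).
have W0 (O : orbit_of rho) : 0 < \prod_(x in val O) wt (first_letter x).
  by apply: prodr_gt0 => x _; apply: wt_gt0.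
have Gw (z : nat -> R) (w : {ffun 'I_n -> A}) :
    (\prod_c wt (w c)) * cycle_monomial z (std w) = G z (loads l w).
  rewrite (word_monomial_orbits (itinerary_rho divL w) (itinerary_lett l w)).
  by apply: eq_bigr => O _; rewrite loadsE.
rewrite (eq_bigr _ (fun w _ => Gw y w)) /cycle_series fps_prodE.
apply: (@sum_weighted_injection _ _ _ _ _ (G (fun=> 1))).
- exact: loads_inj.
- by move=> w; apply/eqP/loads_sum.
- by move=> phi; apply: prodr_ge0 => O _; apply: orbit_series1_ge0; rewrite ?orbit_gt0.
- move=> phi /eqP; rewrite prodf_seq_eq0 => /hasP[B _ /= /eqP e].
  apply/eqP; rewrite prodf_seq_eq0; apply/hasP; exists B; first exact: mem_index_enum.
  by apply/eqP/orbit_series1_eq0; rewrite ?orbit_gt0 //; apply: e.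
rewrite -(eq_bigr _ (fun w _ => Gw (fun=> 1) w)).
transitivity (1 : R); last first.
  have := cycle_series_1 wt_sum divL (leqnn n).
  by rewrite /cycle_series fps_prodE => {1}<-.
rewrite (eq_bigr (fun w : {ffun 'I_n -> A} => \prod_c wt (w c))); last first.
  by move=> w _; rewrite [cycle_monomial _ _]big1 ?mulr1.
by rewrite -(bigA_distr_bigA (fun=> wt)) /= prodr_const wt_sum expr1n.
Qed.

End WordSum.

Section ShelfCycleIndex.
Variables (R : realType) (m : nat) (p : R).
Hypotheses (m_ge1 : (1 <= m)%N) (p_gt0 : 0 < p) (p_lt1 : p < 1).

Definition shelf_weight (a : choice_of_place m) : R :=
  m%:R^-1 * (if a.2 then p else 1 - p).

Lemma shelf_weight_gt0 a : 0 < shelf_weight a.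
Proof.
rewrite /shelf_weight mulr_gt0 ?invr_gt0 ?ltr0n //.
by case: a.2; rewrite ?subr_gt0.
Qed.

Lemma sum_places (f : choice_of_place m -> R) :
  \sum_a f a = \sum_(j < m) (f (j, true) + f (j, false)).
Proof.
rewrite -(eq_bigr _ (fun j _ => big_bool _ (fun b => f (j, b)))) pair_big /=.
by apply: eq_bigr => -[].
Qed.

Lemma m_neq0 : m%:R != 0 :> R. Proof. by rewrite pnatr_eq0 -lt0n. Qed.

Lemma shelf_weight_sum : \sum_a shelf_weight a = 1.
Proof.
rewrite sum_places /shelf_weight /= sumr_const card_ord -[LHS]mulr_natl.
by field; rewrite m_neq0.
Qed.

Lemma powsum_shelf r :
  powsum shelf_weight r = m%:R * m%:R ^- r * (p ^+ r - (- (1 - p)) ^+ r).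
Proof.
rewrite /powsum sum_places /shelf_weight /flip_sign /= sumr_const card_ord -[LHS]mulr_natl.
rewrite -[RHS]mulrA; congr (_ * _); rewrite mul1r !exprMn exprVn.
by rewrite [(- (1 - p)) ^+ r]exprNn; ring.
Qed.

Lemma shelf_B_powsum i r : (0 < i)%N -> shelf_B m p i r =
  \sum_(d <- divisors i) (moebius d)%:~R * powsum shelf_weight (d * r) ^+ (i %/ d).
Proof.
move=> i0; rewrite /shelf_B big_seq [RHS]big_seq; apply: eq_bigr => d.
rewrite -dvdn_divisors // => di; rewrite -mulrA; congr (_ * _).
rewrite powsum_shelf exprMn; congr (_ * _).
rewrite exprMn -exprVn -exprM exprVn expfzDr ?m_neq0 // exprnP; congr (_ * _).
by rewrite -exprnN; congr (_ ^- _); rewrite mulnAC [(d * _)%N]mulnC divnK.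
Qed.

Lemma dvdn_fact_pred n k : (0 < k <= n)%N -> (k %| (n`!).-1.+1)%N.
Proof. by rewrite prednK ?fact_gt0 //; apply: dvdn_fact. Qed.

Lemma shelf_B_itinerary n i r : (0 < i <= n)%N ->
  itinerary_sum shelf_weight (n`!).-1 i r = shelf_B m p i r.
Proof.
move=> i1; rewrite shelf_B_powsum; last by case/andP: i1.
by rewrite -(moebius_inversion
  (@itinerary_sum_powsum _ _ shelf_weight _ _ (@dvdn_fact_pred n)) _ i1).
Qed.

Lemma sum_shelf_B j : (0 < j)%N -> \sum_(i <- divisors j) shelf_B m p i (j %/ i) = 1.
Proof.
move=> j0; rewrite -(itinerary_sum_total shelf_weight_sum (@dvdn_fact_pred j) (j := j)).
  rewrite big_seq [RHS]big_seq; apply: eq_bigr => i; rewrite -dvdn_divisors // => ij.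
  by rewrite shelf_B_itinerary // (dvdn_gt0 _ ij) // dvdn_leq.
by rewrite j0 leqnn.
Qed.

(** All lengths up to [n] divide [n`!], so the words written on a circle of that
    length account for all the cycles of permutations of [n] cards. *)
Lemma shelf_cycle_index (y : nat -> R) (F b : fps R) :
  F 0%N = 1 -> b 0%N = 0 -> fder F = b * F ->
  (forall j, (0 < j)%N ->
     b j = \sum_(i <- divisors j) y i ^+ (j %/ i) * shelf_B m p i (j %/ i)) ->
  forall n, \sum_(s : 'S_n) shelf_law m p s * cycle_monomial y s = F n.
Proof.
move=> F0 b0 dF bE n; rewrite shelf_law_sum.
rewrite -/(shelf_weight _).
rewrite (word_sum_cycle_series shelf_weight_gt0 shelf_weight_sum y (@dvdn_fact_pred n)).
apply: (dlog_unique (N := n) _ _ _ _ (fder_cycle_series _ _ _) dF) => //.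
- by rewrite cycle_series_0.
- exact: dlog_cycle_series_0.
move=> [|j] jn; first by rewrite dlog_cycle_series_0.
rewrite dlog_cycle_seriesE // bE // big_seq [RHS]big_seq; apply: eq_bigr => i.
rewrite -dvdn_divisors // => ij; rewrite shelf_B_itinerary //.
by rewrite (dvdn_gt0 _ ij) // (leq_trans (dvdn_leq _ ij)).
Qed.

End ShelfCycleIndex.

(** * Sums of power series *)

Section Sums.
Variable R : realType.
Implicit Types (f g c : fps R) (a e : nat -> nat -> R) (d : nat -> R).

Definition bounded_sums d := exists C, forall N : nat, \sum_(j < N) d j <= C.

Lemma sum_ord_cat (F : nat -> R) K N : (K <= N)%N ->
  \sum_(j < N) F j = \sum_(j < K) F j + \sum_(K <= j < N) F j.
Proof. by move=> KN; rewrite -!(big_mkord xpredT) -big_cat_nat. Qed.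

Lemma bounded_sums_tail d : (forall j, 0 <= d j) -> bounded_sums d ->
  forall eps, 0 < eps -> exists K, forall N, (K <= N)%N -> \sum_(K <= j < N) d j <= eps.
Proof.
move=> d0 [C dC] eps eps0; pose D N := \sum_(j < N) d j.
have ndD : nondecreasing_seq D.
  by move=> K N KN; rewrite /D (sum_ord_cat _ KN) lerDl sumr_ge0.
have cD : cvgn D.
  by apply: nondecreasing_is_cvgn => //; exists C => _ [N _ <-]; apply: dC.
have /cvgrPdist_le/(_ eps eps0)[K _ HK] := cD.
exists K => N KN; have := HK K (leqnn K).
have := nondecreasing_cvgn_le ndD cD N; rewrite {1}/D (sum_ord_cat _ KN) -/(D K).
have := nondecreasing_cvgn_le ndD cD K => h1 h2 h3.
rewrite ger0_norm ?subr_ge0 // in h3; lra.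
Qed.

Lemma cvg_bigsum (I : Type) (r : seq I) (P : pred I) (v : I -> nat -> R) (l : I -> R) :
  (forall i, v i @ \oo --> l i) ->
  (fun N => \sum_(i <- r | P i) v i N) @ \oo --> \sum_(i <- r | P i) l i.
Proof.
move=> vl; elim: r => [|i r IH].
  by rewrite big_nil; under eq_fun do rewrite big_nil; apply: cvg_cst.
rewrite big_cons; under eq_fun do rewrite big_cons.
by case: (P i) => //; apply: cvgD.
Qed.

(** Tannery's theorem for triangular arrays: the terms of large index are
    uniformly small, and there are finitely many others. *)
Lemma dominated_sums0 e d :
  (forall N j, `|e N j| <= d j) -> bounded_sums d ->
  (forall j, (fun N => e N j) @ \oo --> (0 : R)) ->
  (fun N => \sum_(j < N) e N j) @ \oo --> (0 : R).
Proof.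
move=> ed dC e0; have d0 j : 0 <= d j by apply: le_trans (ed 0%N j).
apply/cvgrPdist_le => eps eps0; have eps2 : 0 < eps / 2 by rewrite divr_gt0.
have [K HK] := bounded_sums_tail d0 dC eps2.
have : (fun N => \sum_(j < K) `|e N j|) @ \oo --> \sum_(j < K) (0 : R).
  by apply: cvg_bigsum => j; rewrite -(@normr0 _ R); apply: cvg_norm; apply: e0.
rewrite big1 // => /cvgrPdist_le/(_ _ eps2) near1.
near=> N; rewrite sub0r normrN.
have KN : (K <= N)%N by near: N; exists K.
rewrite (sum_ord_cat _ KN) (le_trans (ler_normD _ _)) // (splitr eps) lerD //.
  apply: le_trans (ler_norm_sum _ _ _) _.
  have : `|0 - \sum_(j < K) `|e N j| | <= eps / 2 by near: N.
  by rewrite sub0r normrN ger0_norm // sumr_ge0.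
apply: le_trans (ler_norm_sum _ _ _) _; apply: le_trans (HK N KN).
by apply: ler_sum => j _.
Unshelve. all: by end_near.
Qed.

Lemma dominated_sums a (alpha : nat -> R) d (l : R) :
  (forall N j, `|a N j| <= d j) -> bounded_sums d ->
  (forall j, (fun N => a N j) @ \oo --> alpha j) ->
  (fun N => \sum_(j < N) alpha j) @ \oo --> l ->
  (fun N => \sum_(j < N) a N j) @ \oo --> l.
Proof.
move=> ad [C dC] aalpha al.
have alphad j : `|alpha j| <= d j.
  have : (fun N => `|a N j|) @ \oo --> `|alpha j| by apply: cvg_norm; apply: aalpha.
  by move=> /cvgr_to_le; apply; apply: nearW => N.
have -> : (fun N => \sum_(j < N) a N j) =
    (fun N => \sum_(j < N) (a N j - alpha j) + \sum_(j < N) alpha j).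
  by apply/funext => N; rewrite sumrB subrK.
rewrite -[l]add0r; apply: cvgD => //.
apply: (@dominated_sums0 (fun N j => a N j - alpha j) (fun j => d j *+ 2)) => [N j||j].
- by rewrite mulr2n (le_trans (ler_normB _ _)) // lerD.
- by exists (C *+ 2) => N; rewrite sumrMnl lerMn2r dC orbT.
- by rewrite -(subrr (alpha j)); apply: cvgB => //; apply: cvg_cst.
Qed.

Definition fps_sum f (l : R) :=
  bounded_sums (fun j => `|f j|) /\ (fun N => \sum_(j < N) f j) @ \oo --> l.

Lemma abs_sum_exists f : bounded_sums (fun j => `|f j|) -> exists l, fps_sum f l.
Proof.
move=> fC; suff cf : cvgn (series f).
  exists (limn (series f)); split=> //.
  rewrite (_ : (fun N => _) = series f) //.
  by apply/funext => N; rewrite /series /= big_mkord.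
apply: normed_cvg; case: fC => C fC; apply: nondecreasing_is_cvgn.
  by apply: nondecreasing_series => j _ _; rewrite normr_ge0.
exists C => _ [N _ <-]; apply: le_trans (fC N).
by rewrite -(big_mkord xpredT (fun j => `|f j|)).
Qed.

Lemma bounded_sums_le d d' : (forall j, d j <= d' j) -> bounded_sums d' -> bounded_sums d.
Proof. by move=> dd' [C H]; exists C => N; apply: le_trans (H N); apply: ler_sum. Qed.

Lemma sum_fpsM f g N : \sum_(n < N) (f * g) n = \sum_(i < N) f i * \sum_(j < N - i) g j.
Proof.
transitivity (\sum_(n < N) \sum_(i < N | (i <= n)%N) f i * g (n - i)%N).
  apply: eq_bigr => n _; rewrite fpsME.
  rewrite (big_ord_widen_cond _ predT (fun i => f i * g (n - i)%N) (ltn_ord n)).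
  by apply: eq_bigl => i; rewrite ltnS.
rewrite (exchange_big_dep predT) //=; apply: eq_bigr => i _; rewrite -mulr_sumr.
congr (_ * _); rewrite -(big_mkord (fun n => i <= n)%N (fun n => g (n - i)%N)).
rewrite -(big_mkord xpredT g) -{1}[i : nat]add0n big_mkcond.
rewrite (@big_cat_nat _ _ _ i) ?(ltnW (ltn_ord i)) //= big_nat_cond big1 ?add0r.
  rewrite -{1}[i : nat]add0n big_addn; rewrite big_nat_cond [RHS]big_nat_cond.
  by apply: eq_bigr => j; rewrite andbT addnK leq_addl.
by move=> j /andP[/andP[_ ji] _]; rewrite leqNgt ji.
Qed.

Lemma abs_sum_fpsM f g (C D : R) :
  (forall N, \sum_(j < N) `|f j| <= C) -> (forall N, \sum_(j < N) `|g j| <= D) ->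
  forall N, \sum_(j < N) `|(f * g) j| <= C * D.
Proof.
move=> fC gD N.
apply: (@le_trans _ _ (\sum_(n < N) (((fun j => `|f j|) : fps R) * (fun j => `|g j|)) n)).
  apply: ler_sum => n _; rewrite !fpsME (le_trans (ler_norm_sum _ _ _)) //.
  by apply: ler_sum => i _; rewrite normrM.
rewrite sum_fpsM; apply: (@le_trans _ _ (\sum_(i < N) `|f i| * D)).
  by apply: ler_sum => i _; apply: ler_wpM2l.
rewrite -mulr_suml; apply: ler_wpM2r => //.
by apply: le_trans (gD 0%N); rewrite big_ord0.
Qed.

(** The partial sums of a Cauchy product are [\sum_i f_i G_(N - i)], where the
    partial sums [G] of [g] are bounded and converge. *)
Lemma fps_sumM f g (k l : R) : fps_sum f k -> fps_sum g l -> fps_sum (f * g) (k * l).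
Proof.
move=> [[C fC] fk] [[D gD] gl]; split.
  by exists (C * D); apply: abs_sum_fpsM.
have -> : (fun N => \sum_(j < N) (f * g) j) =
    (fun N => \sum_(i < N) f i * \sum_(j < N - i) g j).
  by apply/funext => N; rewrite sum_fpsM.
apply: (@dominated_sums (fun N i => f i * \sum_(j < N - i) g j)
  (fun i => f i * l) (fun i => `|f i| * D)).
- move=> N j; rewrite normrM; apply: ler_wpM2l => //.
  exact: le_trans (ler_norm_sum _ _ _) (gD _).
- exists (C * D) => N; rewrite -mulr_suml; apply: ler_wpM2r => //.
  by apply: le_trans (gD 0%N); rewrite big_ord0.
- move=> j; apply: cvgM; first exact: cvg_cst.
  rewrite -(cvg_shiftn j) /=.
  by under eq_fun do rewrite addnK.
have -> : (fun N => \sum_(j < N) f j * l) = (fun N => (\sum_(j < N) f j) * l).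
  by apply/funext => N; rewrite mulr_suml.
by apply: cvgM => //; apply: cvg_cst.
Qed.

Lemma fps_sum1 : fps_sum 1 1.
Proof.
have s1 N : \sum_(j < N.+1) (1 : fps R) j = 1.
  by rewrite big_ord_recl big1 ?addr0.
split.
  exists 1 => -[|N]; first by rewrite big_ord0.
  rewrite big_ord_recl big1 ?addr0 ?normr1 // => i _.
  by rewrite fps1E normr0.
rewrite -(cvg_shiftn 1) /=; under eq_fun do rewrite addn1 s1.
exact: cvg_cst.
Qed.

Lemma fps_sum_prod (I : Type) (r : seq I) (F : I -> fps R) (l : I -> R) :
  (forall i, fps_sum (F i) (l i)) -> fps_sum (\prod_(i <- r) F i) (\prod_(i <- r) l i).
Proof.
move=> Fl; elim: r => [|i r IH]; first by rewrite !big_nil; apply: fps_sum1.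
by rewrite !big_cons; apply: fps_sumM.
Qed.

Lemma fps_sumX f (l : R) n : fps_sum f l -> fps_sum (f ^+ n) (l ^+ n).
Proof.
move=> fl; elim: n => [|n IH]; first exact: fps_sum1.
by rewrite !exprS; apply: fps_sumM.
Qed.

(** The exponential of a series [c] without constant term: the powers of [c] of
    exponent larger than [n] do not reach the degree [n]. *)
Definition fexp c : fps R := fun n => \sum_(j < n.+1) (j`!%:R)^-1 * (c ^+ j) n.

Lemma fpsX_small (S : comNzRingType) (c : fps S) j n :
  c 0%N = 0 -> (n < j)%N -> (c ^+ j) n = 0.
Proof.
move=> c0; elim: j n => // j IH n; rewrite ltnS => nj.
rewrite exprS fpsME big1 // => -[[|i] /= ni] _; first by rewrite c0 mul0r.
rewrite IH ?mulr0 //; case: n ni nj => // n ni nj.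
by rewrite subSS (leq_ltn_trans (leq_subr _ _)).
Qed.

Lemma fexpE c n N : c 0%N = 0 -> (n < N)%N ->
  fexp c n = \sum_(j < N) (j`!%:R)^-1 * (c ^+ j) n.
Proof.
move=> c0 nN; rewrite (sum_ord_cat (fun j => (j`!%:R)^-1 * (c ^+ j) n) nN).
rewrite [X in _ + X]big_nat_cond [X in _ + X]big1 ?addr0 // => j /andP[/andP[nj _] _].
by rewrite fpsX_small ?mulr0.
Qed.

Lemma fexp_0 c : fexp c 0%N = 1.
Proof. by rewrite /fexp big_ord1 fact0 invr1 mul1r expr0. Qed.

Lemma fder_fexp c : c 0%N = 0 -> fder (fexp c) = fder c * fexp c.
Proof.
move=> c0; apply/funext => n.
have dcX j : (fder c * c ^+ j) n = (c ^+ j.+1) n *+ n / j.+1%:R.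
  have /(congr1 (fun f => f n)) := fder_exp j.+1 (erefl (fder c)).
  rewrite /= {1}/fder => ->.
  have -> : ((fder c * c ^+ j) *+ j.+1) n = (fder c * c ^+ j) n * j.+1%:R.
    by rewrite mulr_natr; elim: j.+1 => // k IH; rewrite !mulrS fpsDE IH.
  by rewrite mulfK // pnatr_eq0.
transitivity (\sum_(j < n.+1) (j`!%:R)^-1 * (fder c * c ^+ j) n); last first.
  rewrite fpsME; under eq_bigr do rewrite fpsME mulr_sumr.
  rewrite exchange_big /=; apply: eq_bigr => i _.
  rewrite (@fexpE c _ n.+1) ?ltnS ?leq_subr // mulr_sumr.
  by apply: eq_bigr => j _; rewrite mulrCA.
rewrite /fder (@fexpE c n n.+2) // -sumrMnl big_ord_recl.
rewrite [X in X + _](_ : _ = 0) ?add0r.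
  apply: eq_bigr => j _; rewrite lift0 dcX factS natrM invfM -[LHS]mulrnAr.
  by move: (_ *+ n) => z; ring.
by case: n {dcX} => [|n]; rewrite ?mulr0n // expr0 fps1E mulr0 mul0rn.
Qed.

(** The first [N] coefficients of [fexp c] only involve the first [N] powers of
    [c], whose sums are dominated by the terms of an exponential series. *)
Lemma fexp_sum c (l : R) : c 0%N = 0 -> fps_sum c l -> fps_sum (fexp c) (expR l).
Proof.
move=> c0 cl; have [[C cC] _] := cl.
have C0 : 0 <= C by apply: le_trans (cC 0%N); rewrite big_ord0.
have cX j N : \sum_(n < N) `|(c ^+ j) n| <= C ^+ j.
  elim: j N => [|j IH] N.
    case: N => [|N]; first by rewrite big_ord0.
    rewrite big_ord_recl big1 ?addr0 ?normr1 // => i _.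
    by rewrite expr0 fps1E normr0.
  by rewrite !exprS; apply: abs_sum_fpsM.
have fact_ge0 j : 0 <= (j`!%:R : R)^-1 by rewrite invr_ge0.
have expC N : \sum_(j < N) (j`!%:R)^-1 * C ^+ j <= expR C.
  have := nondecreasing_cvgn_le (u_ := series (exp_coeff C)) _ (is_cvg_series_exp_coeff C) N.
  rewrite /series /= big_mkord => H; under eq_bigr do rewrite mulrC; apply: H.
  by apply: nondecreasing_series => j _ _; apply: exp_coeff_ge0.
split.
  exists (expR C) => N; apply: le_trans (expC N).
  apply: (@le_trans _ _ (\sum_(n < N) \sum_(j < N) (j`!%:R)^-1 * `|(c ^+ j) n|)).
    apply: ler_sum => n _; rewrite (fexpE c0 (ltn_ord n)).
    apply: le_trans (ler_norm_sum _ _ _) _; apply: ler_sum => j _.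
    by rewrite normrM ger0_norm.
  rewrite exchange_big /=; apply: ler_sum => j _; rewrite -mulr_sumr.
  by apply: ler_wpM2l; [apply: fact_ge0 | apply: cX].
have -> : (fun N => \sum_(n < N) fexp c n) =
    (fun N => \sum_(j < N) (j`!%:R)^-1 * \sum_(n < N) (c ^+ j) n).
  apply/funext => N; under eq_bigr => n _ do rewrite (fexpE c0 (ltn_ord n)).
  by rewrite exchange_big /=; apply: eq_bigr => j _; rewrite mulr_sumr.
apply: (@dominated_sums (fun N j => (j`!%:R)^-1 * \sum_(n < N) (c ^+ j) n)
  (fun j => (j`!%:R)^-1 * l ^+ j) (fun j => (j`!%:R)^-1 * C ^+ j)).
- move=> N j; rewrite normrM ger0_norm //; apply: ler_wpM2l => //.
  exact: le_trans (ler_norm_sum _ _ _) (cX _ _).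
- by exists (expR C).
- move=> j; apply: cvgM; first exact: cvg_cst.
  by case: (fps_sumX j cl).
rewrite (_ : (fun N => _) = series (exp_coeff l)).
  exact: is_cvg_series_exp_coeff.
by apply/funext => N; rewrite /series /= big_mkord; apply: eq_bigr => j _; rewrite mulrC.
Qed.

(** Substitution of [u X] for [X]. *)
Definition fscale (u : R) f : fps R := fun n => f n * u ^+ n.

Lemma fscaleM u f g : fscale u (f * g) = fscale u f * fscale u g.
Proof.
apply/funext => n; rewrite /fscale !fpsME mulr_suml; apply: eq_bigr => i _.
by rewrite mulrACA -exprD subnKC // -ltnS.
Qed.

Lemma fscale1 u : fscale u 1 = 1.
Proof.
by apply/funext => -[|n]; rewrite /fscale fps1E ?mul1r // mul0r.
Qed.

Lemma fscale_prod u (I : Type) (r : seq I) (F : I -> fps R) :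
  fscale u (\prod_(i <- r) F i) = \prod_(i <- r) fscale u (F i).
Proof. by apply: (big_morph (fscale u) (fscaleM u) (fscale1 u)). Qed.

Lemma fscale_exp u c : fscale u (fexp c) = fexp (fscale u c).
Proof.
have X j : fscale u (c ^+ j) = fscale u c ^+ j.
  by elim: j => [|j IH]; rewrite ?fscale1 // !exprS fscaleM IH.
apply/funext => n; rewrite /fexp {1}/fscale mulr_suml; apply: eq_bigr => j _.
by rewrite -X /fscale mulrA.
Qed.

Lemma bounded_sums_scale u f : `|u| <= 1 -> bounded_sums (fun j => `|f j|) ->
  bounded_sums (fun j => `|fscale u f j|).
Proof.
move=> u1; apply: bounded_sums_le => j; rewrite /fscale normrM normrX.
by rewrite ler_piMr // exprn_ile1.
Qed.

Lemma fgeo_sum (u : R) : 0 <= u -> u < 1 -> fps_sum (fgeo u 1) (1 - u)^-1.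
Proof.
move=> u0 u1; have g n : fgeo u 1 n = u ^+ n by rewrite /fgeo dvd1n divn1.
have u1' : 0 < 1 - u by rewrite subr_gt0.
have gs N : \sum_(j < N) fgeo u 1 j = (1 - u ^+ N) / (1 - u).
  apply: (mulIf (lt0r_neq0 u1')); rewrite divfK ?lt0r_neq0 //.
  under eq_bigr do rewrite g.
  by rewrite mulrC -opprB mulNr -subrX1 opprB.
split.
  exists (1 - u)^-1 => N; under eq_bigr do rewrite g ger0_norm ?exprn_ge0 // -g.
  by rewrite gs ler_piMl ?invr_ge0 ?(ltW u1') // lerBlDr lerDl exprn_ge0.
under eq_fun do rewrite gs.
have h : (fun N => 1 - u ^+ N) @ \oo --> (1 - 0 : R).
  by apply: cvgB; [apply: cvg_cst | apply: cvg_expr; rewrite ger0_norm].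
have hc : (fun _ : nat => (1 - u)^-1) @ \oo --> (1 - u)^-1 by apply: cvg_cst.
have := cvgM h hc.
by rewrite subr0 mul1r => H; apply: H.
Qed.

End Sums.

(** * From monomials to arbitrary functions of the cycle counts *)

Section Pairing.
Variable R : realType.
Implicit Types (q r : {poly R}) (h : nat -> R).

(** The linear functional that replaces the monomial [X^k] by [h k]. *)
Definition umbral q h : R := \sum_(k < size q) q`_k * h k.

Lemma umbralE N q h : (size q <= N)%N -> umbral q h = \sum_(k < N) q`_k * h k.
Proof.
move=> qN; rewrite (sum_ord_cat (fun k => q`_k * h k) qN).
rewrite [X in _ + X]big_nat_cond [X in _ + X]big1 ?addr0 // => k /andP[/andP[qk _] _].
by rewrite nth_default ?mul0r.
Qed.

Lemma umbral_exp q x : umbral q (fun k => x ^+ k) = q.[x].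
Proof. by rewrite horner_coef. Qed.

Lemma umbralD q r h : umbral (q + r) h = umbral q h + umbral r h.
Proof.
rewrite (umbralE h (size_polyD q r)) (umbralE h (leq_maxl (size q) (size r))).
rewrite (umbralE h (leq_maxr (size q) (size r))) -big_split /=.
by apply: eq_bigr => k _; rewrite coefD mulrDl.
Qed.

Lemma umbralZ (a : R) q h : umbral (a *: q) h = a * umbral q h.
Proof.
rewrite (umbralE h (size_scale_leq a q)) /umbral mulr_sumr.
by apply: eq_bigr => k _; rewrite coefZ mulrA.
Qed.

Lemma umbral0 h : umbral 0 h = 0.
Proof. by rewrite /umbral size_poly0 big_ord0. Qed.

Lemma umbral_sum (I : Type) (r : seq I) (F : I -> {poly R}) h :
  umbral (\sum_(i <- r) F i) h = \sum_(i <- r) umbral (F i) h.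
Proof.
by apply: (big_morph (fun q => umbral q h)) => [q q'|]; rewrite ?umbralD ?umbral0.
Qed.

Lemma umbralXn k h : umbral 'X^k h = h k.
Proof.
rewrite /umbral size_polyXn big_ord_recr /= coefXn eqxx mul1r big1 ?add0r // => i _.
by rewrite coefXn ltn_eqF ?mul0r.
Qed.

Lemma horner_eq0 q : (forall x, q.[x] = 0) -> q = 0.
Proof.
move=> q0; apply/eqP; apply: contraT => qn0.
have := max_poly_roots (rs := [seq k%:R | k <- iota 0 (size q)]) qn0.
rewrite size_map size_iota ltnn => -> //; first by apply/allP => x _; apply/eqP.
by rewrite map_inj_uniq ?iota_uniq // => a b /eqP; rewrite eqr_nat => /eqP.
Qed.

Definition l1norm q : R := \sum_(k < size q) `|q`_k|.

Let absp q : {poly R} := \poly_(k < size q) `|q`_k|.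

Let coef_absp q k : (absp q)`_k = `|q`_k|.
Proof.
by rewrite coef_poly; case: ltnP => // qk; rewrite nth_default ?normr0.
Qed.

Let l1normE q : l1norm q = (absp q).[1].
Proof.
rewrite (@horner_coef_wide _ (size q)) ?size_poly //.
by apply: eq_bigr => k _; rewrite coef_absp expr1n mulr1.
Qed.

Let absp_le q r : (forall k, `|q`_k| <= r`_k) -> l1norm q <= r.[1].
Proof.
move=> qr; rewrite (@horner_coef_wide _ (maxn (size q) (size r))) ?leq_maxr //.
rewrite l1normE (@horner_coef_wide _ (maxn (size q) (size r))); last first.
  by rewrite (leq_trans (size_poly _ _)) // leq_maxl.
by apply: ler_sum => k _; rewrite coef_absp !expr1n !mulr1.
Qed.

Lemma l1normD q r : l1norm (q + r) <= l1norm q + l1norm r.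
Proof.
rewrite !l1normE -hornerD -l1normE; apply: absp_le => k.
by rewrite !coefD !coef_absp ler_normD.
Qed.

Lemma l1norm0 : l1norm 0 = 0.
Proof. by rewrite /l1norm size_poly0 big_ord0. Qed.

Lemma l1norm_ge0 q : 0 <= l1norm q.
Proof. by apply: sumr_ge0. Qed.

Lemma l1norm_sum (I : Type) (r : seq I) (F : I -> {poly R}) :
  l1norm (\sum_(i <- r) F i) <= \sum_(i <- r) l1norm (F i).
Proof.
elim/big_rec2: _ => [|i y1 y2 _ IH]; first by rewrite l1norm0.
by rewrite (le_trans (l1normD _ _)) // lerD2l.
Qed.

Lemma l1normZ (a : R) q : l1norm (a *: q) <= `|a| * l1norm q.
Proof.
rewrite [in leRHS]l1normE -hornerZ; apply: absp_le => k.
by rewrite !coefZ coef_absp normrM.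
Qed.

Lemma l1normM q r : l1norm (q * r) <= l1norm q * l1norm r.
Proof.
rewrite ![in leRHS]l1normE -hornerM; apply: absp_le => k.
rewrite !coefM (le_trans (ler_norm_sum _ _ _)) //; apply: ler_sum => j _.
by rewrite !coef_absp normrM.
Qed.

Lemma l1normXn k : l1norm 'X^k = 1.
Proof.
rewrite /l1norm size_polyXn big_ord_recr /= coefXn eqxx normr1 big1 ?add0r // => i _.
by rewrite coefXn ltn_eqF ?normr0.
Qed.

Lemma l1norm1 : l1norm 1 = 1. Proof. by rewrite -(expr0 'X) l1normXn. Qed.

Lemma umbral_le q h : (forall k, `|h k| <= 1) -> `|umbral q h| <= l1norm q.
Proof.
move=> h1; apply: le_trans (ler_norm_sum _ _ _) _; apply: ler_sum => k _.
by rewrite normrM ler_piMr.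
Qed.

Definition fexp_poly (c : fps {poly R}) : fps {poly R} :=
  fun n => \sum_(j < n.+1) (j`!%:R)^-1 *: (c ^+ j) n.

Lemma horner_fexp (c : fps {poly R}) x n :
  (fexp_poly c n).[x] = fexp (fun k => (c k).[x]) n.
Proof.
pose e (f : fps {poly R}) : fps R := fun k => (f k).[x].
have eX j : e (c ^+ j) = (e c) ^+ j.
  elim: j => [|j IH].
    apply/funext => -[|k]; first by rewrite /e !expr0 fps1E hornerC.
    by rewrite /e !expr0 !fps1E horner0.
  rewrite !exprS -IH; apply/funext => k; rewrite /e !fpsME horner_sum.
  by apply: eq_bigr => i _; rewrite hornerM.
rewrite horner_sum; apply: eq_bigr => j _.
by rewrite hornerZ -/(e _) -eX.
Qed.

Lemma l1norm_fexp (c : fps {poly R}) n :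
  l1norm (fexp_poly c n) <= fexp (fun k => l1norm (c k)) n.
Proof.
have eX j k : l1norm ((c ^+ j) k) <= (((fun k => l1norm (c k)) : fps R) ^+ j) k.
  elim: j k => [|j IH] k.
    by rewrite !expr0 !fps1E; case: k => [|k]; rewrite ?l1norm1 ?l1norm0.
  rewrite !exprS !fpsME (le_trans (l1norm_sum _ _)) //; apply: ler_sum => i _.
  by rewrite (le_trans (l1normM _ _)) // ler_wpM2l ?l1norm_ge0.
rewrite (le_trans (l1norm_sum _ _)) //; apply: ler_sum => j _.
rewrite (le_trans (l1normZ _ _)) // ger0_norm ?invr_ge0 //.
by rewrite ler_wpM2l // invr_ge0.
Qed.

Lemma size_fexp (c : fps {poly R}) n :
  (forall k, (size (c k) <= k.+1)%N) -> (size (fexp_poly c n) <= n.+1)%N.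
Proof.
move=> sc; have sX j k : (size ((c ^+ j) k) <= k.+1)%N.
  elim: j k => [|j IH] k.
    by rewrite expr0 fps1E; case: k => [|k]; rewrite ?size_poly1 ?size_poly0.
  rewrite exprS fpsME (leq_trans (size_sum _ _ _)) //; apply/bigmax_leqP => i _.
  rewrite (leq_trans (size_polyMleq _ _)) //.
  have ik : (i <= k)%N by rewrite -ltnS.
  have := leq_add (sc i) (IH (k - i)%N); rewrite -subn1; lia.
rewrite (leq_trans (size_sum _ _ _)) //; apply/bigmax_leqP => j _.
by rewrite (leq_trans (size_scale_leq _ _)).
Qed.

End Pairing.

(** One coordinate at a time: the polynomial that represents the functional in
    that coordinate vanishes at every point, hence is zero, so that the
    monomial in this coordinate can be replaced by any function. *)
Lemma umbral_multilinear (R : realType) (I : finType) (Phi : (I -> nat -> R) -> R) :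
  (forall i h, exists q, forall g,
     Phi (fun j => if j == i then g else h j) = umbral q g) ->
  (forall x : I -> R, Phi (fun i k => x i ^+ k) = 0) ->
  forall h, Phi h = 0.
Proof.
move=> lin mono.
suff H (s : seq I) h : (forall i, i \notin s -> exists x, h i = fun k => x ^+ k) ->
    Phi h = 0.
  by move=> h; apply: (H (enum I)) => i; rewrite mem_enum.
elim: s h => [|i s IH] h hs.
  have /choice[x hx] : forall i, exists x, h i = fun k => x ^+ k by move=> i; apply: hs.
  by rewrite (_ : h = fun i k => x i ^+ k) //; apply/funext => i.
have [q qE] := lin i h.
have q0 : q = 0.
  apply: horner_eq0 => x; rewrite -umbral_exp -qE; apply: IH => j js.
  case: eqP => [_|/eqP ji]; first by exists x.
  by apply: hs; rewrite inE negb_or ji.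
have -> : h = fun j => if j == i then h i else h j.
  by apply/funext => j; case: eqP => [->|].
by rewrite qE q0 umbral0.
Qed.

Section MarkedCycles.
Variables (R : realType) (m : nat) (p : R).
Hypotheses (m_ge1 : (1 <= m)%N) (p_gt0 : 0 < p) (p_lt1 : p < 1).

(** Exponent of the generating function of the number of [i]-cycles, as a series
    in the size of the deck whose coefficients are polynomials in the cycle
    marker. The marker 1 gives the series zero. *)
Definition mark (i : nat) : fps {poly R} := fun k =>
  if (i %| k)%N && (0 < k)%N
  then (shelf_B m p i (k %/ i) / k%:R) *: ('X^(k %/ i) - 1) else 0.

Definition mark_at (i : nat) (x : R) : fps R := fun k => (mark i k).[x].

Lemma mark_atE i x k : mark_at i x k =
  if (i %| k)%N && (0 < k)%N
  then shelf_B m p i (k %/ i) / k%:R * (x ^+ (k %/ i) - 1) else 0.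
Proof.
rewrite /mark_at /mark; case: ifP => _; last by rewrite horner0.
by rewrite hornerZ hornerD hornerN hornerXn hornerC.
Qed.

Lemma mark_at_0 i x : mark_at i x 0%N = 0.
Proof. by rewrite mark_atE andbF. Qed.

Lemma fder_mark_at i x k : (0 < k)%N -> fder (mark_at i x) k =
  ((x ^+ (k %/ i) - 1) * shelf_B m p i (k %/ i)) *+ (i %| k)%N.
Proof.
move=> k0; rewrite /fder mark_atE k0 andbT; case: ifP => _; last by rewrite mul0rn.
rewrite mulr1n -[LHS]mulr_natr mulrAC divfK ?pnatr_eq0 -?lt0n //.
by rewrite mulrC.
Qed.

Section Markers.
Variables (I : finType) (ell : I -> nat).
Hypothesis ell_inj : injective ell.

Let y (x : I -> R) (k : nat) : R := \prod_i x i ^+ (k == ell i).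

Let y_exp x k e : y x k ^+ e - 1 = \sum_i (x i ^+ e - 1) *+ (ell i == k).
Proof.
case: (pickP (fun i => ell i == k)) => [i /eqP ik|no].
  have ne j : j != i -> (ell j == k) = false.
    by move=> ji; rewrite -ik (inj_eq ell_inj) (negPf ji).
  rewrite (bigD1 i) //= ik eqxx big1 ?addr0; last by move=> j /ne ->.
  rewrite /y (bigD1 i) //= ik eqxx big1 ?mulr1 ?expr1 // => j /ne.
  by rewrite eq_sym => ->.
rewrite big1; last by move=> i _; rewrite no.
rewrite /y big1 ?expr1n ?subrr // => i _.
by rewrite eq_sym no.
Qed.

Lemma cycle_monomial_markers x n (s : 'S_n) :
  cycle_monomial (y x) s = \prod_i x i ^+ ncycles (ell i) s.
Proof.
rewrite /cycle_monomial /y exchange_big /=; apply: eq_bigr => i _.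
rewrite -expr_sum; congr (_ ^+ _).
rewrite /ncycles -sum1_card big_mkcond [RHS]big_mkcond /=.
by apply: eq_bigr => C _; rewrite inE; case: (C \in _) => //=; case: eqP.
Qed.

(** The logarithmic derivative prescribed by [shelf_cycle_index] splits into
    that of [1 / (1 - X)], by [sum_shelf_B], and one term for each marked
    length. *)
Lemma shelf_monomial_sum x n :
  \sum_(s : 'S_n) shelf_law m p s * \prod_i x i ^+ ncycles (ell i) s =
  (fgeo 1 1 * \prod_i fexp (mark_at (ell i) (x i))) n.
Proof.
transitivity (\sum_(s : 'S_n) shelf_law m p s * cycle_monomial (y x) s).
  by apply: eq_bigr => s _; rewrite cycle_monomial_markers.
apply: (@shelf_cycle_index _ _ _ m_ge1 p_gt0 p_lt1 (y x) _
  (dlog_fgeo 1 1 + \sum_i fder (mark_at (ell i) (x i)))).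
- rewrite fpsM_0 fps_prod_0 big1 ?mulr1 => [|i _]; last exact: fexp_0.
  by rewrite /fgeo dvdn0 expr1n.
- rewrite fpsDE fps_sumE big1 => [|i _]; last by rewrite /fder mulr0n.
  by rewrite /dlog_fgeo andbF addr0.
- rewrite fderM fder_fgeo // (@fder_prod _ _ _ _ _ (fun i => fder (mark_at (ell i) (x i)))).
    by rewrite [RHS]mulrDl [in LHS]mulrCA -[in LHS]mulrA.
  by move=> i _; apply: fder_fexp; apply: mark_at_0.
move=> j j0; rewrite fpsDE fps_sumE /dlog_fgeo dvd1n j0 expr1n mulr1n /=.
rewrite -[in LHS](sum_shelf_B p m_ge1 j0).
under [X in _ + X]eq_bigr do rewrite fder_mark_at //.
under [X in _ + X]eq_bigr do rewrite -(sum_divisors_pick _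
  (fun k => (x _ ^+ (j %/ k) - 1) * shelf_B m p k (j %/ k))) //.
rewrite exchange_big -big_split /=; apply: eq_bigr => k _.
rewrite -[y x k ^+ _](subrK 1) mulrDl mul1r addrC; congr (_ + _).
rewrite y_exp mulr_suml; apply: eq_bigr => i _.
by rewrite mulrnAl.
Qed.

(** Coefficients of the series whose product governs the joint law of the
    cycle counts, for a function [h] of the number of [i]-cycles. *)
Definition count_series (i : nat) (h : nat -> R) : fps R :=
  fun j => umbral (fexp_poly (mark i) j) h.

Lemma count_series_exp i x :
  count_series i (fun k => x ^+ k) = fexp (mark_at i x).
Proof. by apply/funext => j; rewrite /count_series umbral_exp horner_fexp. Qed.

Definition shelf_mean n (h : I -> nat -> R) : R :=
  \sum_(s : 'S_n) shelf_law m p s * \prod_i h i (ncycles (ell i) s).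

(** The identity [shelf_monomial_sum] is polynomial in each marker, and
    multilinearity extends it from powers to arbitrary functions. *)
Lemma shelf_meanE n h :
  shelf_mean n h = (fgeo 1 1 * \prod_i count_series (ell i) (h i)) n.
Proof.
apply/eqP; rewrite -subr_eq0; apply/eqP.
pose Phi h := shelf_mean n h - (fgeo 1 1 * \prod_i count_series (ell i) (h i)) n.
apply: (@umbral_multilinear _ _ Phi) => [i {}h|x]; last first.
  rewrite /Phi /shelf_mean shelf_monomial_sum.
  rewrite (_ : \prod_i count_series (ell i) (fun k => x i ^+ k) =
      \prod_i fexp (mark_at (ell i) (x i))) ?subrr //.
  by apply: eq_bigr => i _; apply: count_series_exp.
pose q1 := \sum_(s : 'S_n)
  (shelf_law m p s * \prod_(j | j != i) h j (ncycles (ell j) s)) *: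
    'X^(ncycles (ell i) s) : {poly R}.
pose r := fgeo 1 1 * \prod_(j | j != i) count_series (ell j) (h j).
pose q2 := \sum_(a < n.+1) r a *: fexp_poly (mark (ell i)) (n - a)%N.
exists (q1 + (-1) *: q2) => g.
rewrite umbralD umbralZ mulN1r /Phi; congr (_ - _).
  rewrite umbral_sum; apply: eq_bigr => s _.
  rewrite umbralZ umbralXn -mulrA; congr (_ * _).
  rewrite (bigD1 i) //= eqxx mulrC; congr (_ * _).
  by apply: eq_bigr => j /negPf ->.
rewrite umbral_sum (bigD1 i) //= eqxx [_ * \prod_(_ | _) _]mulrC mulrA.
rewrite (eq_bigr (fun j => count_series (ell j) (h j))); last by move=> j /negPf ->.
rewrite -/r fpsME; apply: eq_bigr => a _.
by rewrite umbralZ.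
Qed.

End Markers.
End MarkedCycles.

(** * Convergence of the series *)

Section ShelfSums.
Variables (R : realType) (m : nat) (p : R).
Hypotheses (m_ge1 : (1 <= m)%N) (p_gt0 : 0 < p) (p_lt1 : p < 1).

Let theta : R := Num.max p (1 - p).

Let theta_ge0 : 0 <= theta. Proof. by rewrite le_max (ltW p_gt0). Qed.
Let theta_lt1 : theta < 1. Proof. by rewrite gt_max p_lt1 ltrBlDr ltrDl. Qed.

Lemma powsum_bound r : (0 < r)%N -> `|powsum (@shelf_weight R m p) r| <= 2 * theta ^+ r.
Proof.
move=> r0; rewrite powsum_shelf // normrM.
have m1 : (1 : R) <= m%:R by rewrite ler1n.
have m0 : (0 : R) < m%:R by rewrite ltr0n.
apply: (@le_trans _ _ (1 * (2 * theta ^+ r))); last by rewrite mul1r.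
apply: ler_pM => //.
  rewrite ger0_norm ?mulr_ge0 ?invr_ge0 ?exprn_ge0 ?(ltW m0) //.
  by rewrite ler_pdivrMr ?exprn_gt0 // mul1r ler_eXnr.
rewrite mulr2n mulrDl !mul1r (le_trans (ler_normB _ _)) // lerD // normrX.
  by rewrite ler_pXn2r ?nnegrE ?normr_ge0 // ger0_norm ?(ltW p_gt0) // le_max lexx.
rewrite ler_pXn2r ?nnegrE ?normr_ge0 // normrN ger0_norm ?subr_ge0 ?(ltW p_lt1) //.
by rewrite le_max lexx orbT.
Qed.

Lemma moebius_bound d : `|(moebius d)%:~R : R| <= 1.
Proof.
by rewrite /moebius; case: ifP => _; rewrite ?normr0 // rmorphXn /= normrX normrN1 expr1n.
Qed.

Lemma shelf_B_bound i r : (0 < i)%N -> (0 < r)%N ->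
  `|shelf_B m p i r| <= (\sum_(d <- divisors i) 2 ^+ i) * theta ^+ (i * r).
Proof.
move=> i0 r0; rewrite shelf_B_powsum // (le_trans (ler_norm_sum _ _ _)) //.
rewrite mulr_suml big_seq [leRHS]big_seq; apply: ler_sum => d.
rewrite -dvdn_divisors // => di; have d0 := dvdn_gt0 i0 di.
rewrite normrM normrX -[leRHS]mul1r; apply: ler_pM; rewrite ?normr_ge0 ?exprn_ge0 //.
  exact: moebius_bound.
apply: (@le_trans _ _ ((2 * theta ^+ (d * r)) ^+ (i %/ d))).
  by apply: lerXn2r; rewrite ?nnegrE ?powsum_bound ?mulr_ge0 ?exprn_ge0 // muln_gt0 d0.
rewrite exprMn -exprM mulnAC [(d * _)%N]mulnC divnK //.
apply: ler_wpM2r; first exact: exprn_ge0.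
by rewrite ler_weXn2l ?leq_div // ler1n.
Qed.

Lemma mark_0 i : mark m p i 0%N = 0. Proof. by rewrite /mark andbF. Qed.

(** Since [m^(1-k) (p^k - (-q)^k)] is at most [2 theta^k] in absolute value, with
    [theta] the larger of [p] and [q = 1 - p], the numbers [shelf_B m p i r]
    decay geometrically in [r]. *)
Lemma l1norm_mark i : (0 < i)%N ->
  bounded_sums (fun k => l1norm (mark m p i k)).
Proof.
move=> i0; pose C := (\sum_(d <- divisors i) 2 ^+ i : R) * 2.
have C0 : 0 <= C by rewrite mulr_ge0 // sumr_ge0 // => d _; rewrite exprn_ge0.
have [[D HD] _] := fgeo_sum theta_ge0 theta_lt1.
have g k : `|fgeo theta 1 k| = theta ^+ k.
  by rewrite /fgeo dvd1n divn1 ger0_norm // exprn_ge0.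
exists (C * D) => N; apply: (@le_trans _ _ (\sum_(k < N) C * theta ^+ k)).
  apply: ler_sum => k _; rewrite /mark; case: ifP => [/andP[ik k0]|_]; last first.
    by rewrite l1norm0 mulr_ge0 // exprn_ge0.
  have ki0 : (0 < k %/ i)%N by rewrite divn_gt0 // dvdn_leq.
  rewrite (le_trans (l1normZ _ _)) // /C mulrAC; apply: ler_pM => //.
  - exact: l1norm_ge0.
  - rewrite normrM normfV normr_nat; apply: (@le_trans _ _ `|shelf_B m p i (k %/ i)|).
      by rewrite ler_piMr // invf_le1 ?ltr0n // ler1n.
    have := shelf_B_bound i0 ki0.
    by rewrite [(i * _)%N]mulnC divnK.
  - rewrite -scaleN1r (le_trans (l1normD _ _)) // l1normXn.
    rewrite (le_trans (lerD (lexx _) (l1normZ _ _))) //.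
    by rewrite normrN1 l1norm1 mul1r.
rewrite -mulr_sumr; apply: ler_wpM2l => //.
by under eq_bigr do rewrite -g.
Qed.

(** It bounds the coefficients of [count_series i h] uniformly for [h] bounded
    by 1; its summability is what makes the counts of large decks converge. *)
Definition majorant (i : nat) : fps R := fexp (fun k => l1norm (mark m p i k)).

Lemma majorant_bounded i : (0 < i)%N -> bounded_sums (majorant i).
Proof.
move=> i0.
have [l Hl] : exists l, fps_sum (fun k => l1norm (mark m p i k)) l.
  apply: abs_sum_exists; apply: bounded_sums_le (l1norm_mark i0) => k.
  by rewrite ger0_norm ?l1norm_ge0.
have c0 : l1norm (mark m p i 0%N) = 0 by rewrite mark_0 l1norm0.
have [HC _] := fexp_sum (c := fun k => l1norm (mark m p i k)) c0 Hl.
by apply: bounded_sums_le HC => k; apply: ler_norm.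
Qed.

Lemma count_series_bound i h j : (forall k, `|h k| <= 1) ->
  `|count_series m p i h j| <= majorant i j.
Proof. by move=> h1; apply: le_trans (umbral_le _ h1) (l1norm_fexp _ _). Qed.

Lemma majorant_ge0 i j : 0 <= majorant i j.
Proof. by apply: le_trans (count_series_bound i j (h := fun=> 0) _); rewrite ?normr0. Qed.

Lemma size_mark i k : (size (mark m p i k) <= k.+1)%N.
Proof.
rewrite /mark; case: ifP => [/andP[ik k0]|_]; last by rewrite size_poly0.
rewrite (leq_trans (size_scale_leq _ _)) // (leq_trans (size_polyD _ _)) //.
rewrite geq_max size_polyXn ltnS leq_div size_polyN size_poly1 //.
Qed.

Lemma count_series_vanish i h K j : (forall k, (k < K)%N -> h k = 0) -> (j < K)%N ->
  count_series m p i h j = 0.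
Proof.
move=> h0 jK; rewrite /count_series (umbralE h (size_fexp _ (size_mark i))).
rewrite big1 // => k _; rewrite h0 ?mulr0 //.
by apply: leq_ltn_trans jK; rewrite -ltnS.
Qed.

Lemma count_series_sum u i h : (0 < i)%N -> `|u| <= 1 -> (forall k, `|h k| <= 1) ->
  exists l, fps_sum (fscale u (count_series m p i h)) l.
Proof.
move=> i0 u1 h1; apply/abs_sum_exists/bounded_sums_scale => //.
apply: bounded_sums_le (majorant_bounded i0) => j.
exact: count_series_bound.
Qed.

(** For [u < 1], the expectation of [h] of the number of [i]-cycles in a deck of
    geometric size; for [u = 1], its limit for large decks. *)
Definition count_mean (u : R) (i : nat) (h : nat -> R) : R :=
  limn (fun N => \sum_(j < N) fscale u (count_series m p i h) j).

Lemma count_meanP u i h : (0 < i)%N -> `|u| <= 1 -> (forall k, `|h k| <= 1) ->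
  fps_sum (fscale u (count_series m p i h)) (count_mean u i h).
Proof.
move=> i0 u1 h1; have [l [bl cl]] := count_series_sum i0 u1 h1.
by split=> //; rewrite /count_mean (cvg_lim _ cl).
Qed.

Lemma shelf_exponent_sum u i x K : (0 < i)%N ->
  \sum_(1 <= r < K) shelf_exponent_term m p u i x r =
  \sum_(j < (i * K.-1).+1) fscale u (mark_at m p i x) j.
Proof.
move=> i0; case: K => [|K].
  by rewrite muln0 big_geq // big_ord1 /fscale mark_at_0 mul0r.
elim: K => [|K IH] /=.
  by rewrite muln0 big_geq // big_ord1 /fscale mark_at_0 mul0r.
rewrite big_nat_recr //= IH /=.
rewrite (@sum_ord_cat _ _ (i * K).+1 (i * K.+1).+1) ?ltnS ?leq_mul2l ?leqnSn ?orbT //.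
congr (_ + _).
have lt : ((i * K).+1 <= i * K.+1)%N by rewrite mulnS -addn1 addnC leq_add2r.
rewrite big_nat_recr //= big_nat_cond big1 ?add0r.
  rewrite /fscale mark_atE dvdn_mulr // muln_gt0 i0 /= mulKn // /shelf_exponent_term.
  by ring.
move=> j /andP[/andP[h1 h2] _]; rewrite /fscale mark_atE.
case: ifP => [/andP[/dvdnP[e je] _]|_]; last by rewrite mul0r.
move: h1 h2; rewrite je [(e * i)%N]mulnC !ltn_pmul2l // => Ke.
by rewrite ltnS leqNgt Ke.
Qed.

Lemma count_mean_pgf u i x : (0 < i)%N -> `|u| <= 1 -> `|x| <= 1 ->
  shelf_pgf_defined m p u i x /\
  count_mean u i (fun k => x ^+ k) = shelf_pgf m p u i x.
Proof.
move=> i0 u1 x1; have xk k : `|x ^+ k| <= 1 by rewrite normrX exprn_ile1.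
have [l Hl] : exists l, fps_sum (fscale u (mark_at m p i x)) l.
  apply/abs_sum_exists/bounded_sums_scale => //.
  apply: bounded_sums_le (l1norm_mark i0) => k.
  by rewrite /mark_at -umbral_exp umbral_le.
have c : (fun k => \sum_(1 <= r < k) shelf_exponent_term m p u i x r) @ \oo --> l.
  under eq_fun do rewrite shelf_exponent_sum //.
  have k_oo : (fun k => (i * k.-1).+1) @ \oo --> \oo.
    move=> A [N _ NA]; exists N.+1 => // k /= Nk; apply: NA => /=.
    rewrite (@leq_trans k.-1) //; first by case: k Nk.
    by rewrite (leq_trans _ (leqnSn _)) // leq_pmull.
  by case: Hl => _ H; apply: cvg_comp k_oo H.
split; first by apply/cvg_ex; exists l.
rewrite /shelf_pgf (cvg_lim _ c) //.
have [_ H1] := count_meanP i0 u1 xk.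
have c0 : fscale u (mark_at m p i x) 0%N = 0 by rewrite /fscale mark_at_0 mul0r.
have [_ H2] := fexp_sum c0 Hl.
apply: cvg_unique H1 _ => //.
by rewrite count_series_exp fscale_exp.
Qed.

(** The coefficient of degree [j] only involves the values of [h] up to [j], as a
    deck of [j] cards has at most [j] cycles. What [h] does beyond [K] thus
    enters through a tail of the majorant. *)
Lemma count_mean_truncate i (h : nat -> R) : (0 < i)%N -> (forall k, `|h k| <= 1) ->
  (fun K => \sum_(k < K) h k * count_mean 1 i (fun l => (l == k)%:R)) @ \oo -->
    count_mean 1 i h.
Proof.
move=> i0 h1; have n1 : `|1 : R| <= 1 by rewrite normr1.
have f1 (f : fps R) : fscale 1 f = f.
  by apply/funext => n; rewrite /fscale expr1n mulr1.
have d1 k (l : nat) : `|(l == k)%:R : R| <= 1.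
  by case: eqP => _; rewrite ?normr1 ?normr0.
pose g K l := if (l < K)%N then 0 else h l.
have g1 K k : `|g K k| <= 1 by rewrite /g; case: ifP => // _; rewrite normr0.
have dec K : count_mean 1 i h =
    \sum_(k < K) h k * count_mean 1 i (fun l => (l == k)%:R) + count_mean 1 i (g K).
  have [_ ch] := count_meanP i0 n1 h1; have [_ cg] := count_meanP i0 n1 (g1 K).
  apply: cvg_unique ch _ => //; rewrite !f1 in cg *.
  have -> : (fun N => \sum_(j < N) count_series m p i h j) = (fun N =>
      \sum_(k < K) h k * (\sum_(j < N) count_series m p i (fun l => (l == k)%:R) j) +
      \sum_(j < N) count_series m p i (g K) j).
    apply/funext => N; under [X in X + _]eq_bigr do rewrite mulr_sumr.
    rewrite exchange_big -big_split /=; apply: eq_bigr => j _.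
    rewrite /count_series /umbral; under [X in X + _]eq_bigr do rewrite mulr_sumr.
    rewrite exchange_big -big_split /=; apply: eq_bigr => l _.
    rewrite /g; case: ltnP => lK.
      rewrite mulr0 addr0 (bigD1 (Ordinal lK)) //= eqxx mulr1 big1 ?addr0.
        by rewrite mulrC.
      by move=> k; rewrite -val_eqE /= eq_sym => /negPf ->; rewrite !mulr0.
    rewrite big1 ?add0r // => k _; rewrite gtn_eqF ?mulr0 //.
    by apply: leq_trans lK.
  apply: cvgD => //; apply: cvg_bigsum => k.
  have [_] := count_meanP i0 n1 (d1 k); rewrite f1 => H.
  by apply: cvgM => //; apply: cvg_cst.
apply/cvgrPdist_le => eps eps0.
have [K HK] := bounded_sums_tail (majorant_ge0 i) (majorant_bounded i0) eps0.
exists K => // K' /= KK'; rewrite (dec K') addrC addKr.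
have [_ cg] := count_meanP i0 n1 (g1 K'); rewrite f1 in cg.
have : (fun N => `|\sum_(j < N) count_series m p i (g K') j|) @ \oo -->
   `|count_mean 1 i (g K')| by apply: cvg_norm.
move=> /cvgr_to_le; apply; exists K => // N /= KN.
rewrite (sum_ord_cat _ KN) big1 ?add0r; last first.
  move=> j _; apply: (@count_series_vanish i _ K') => [k kK|]; first by rewrite /g kK.
  by apply: leq_trans KK'.
apply: le_trans (ler_norm_sum _ _ _) _; apply: le_trans (HK N KN).
by apply: ler_sum => j _; apply: count_series_bound.
Qed.

Section Joint.
Variables (I : finType) (ell : I -> nat).
Hypotheses (ell_inj : injective ell) (ell_gt0 : forall i, (0 < ell i)%N).

Lemma count_mean_prod u (h : I -> nat -> R) : `|u| <= 1 -> (forall i k, `|h i k| <= 1) ->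
  fps_sum (\prod_(i : I) fscale u (count_series m p (ell i) (h i)))
    (\prod_i count_mean u (ell i) (h i)).
Proof.
by move=> u1 h1; apply: fps_sum_prod => i; apply: count_meanP.
Qed.

(** Multiplication by [1 / (1 - X)] forms partial sums. *)
Lemma shelf_mean_cvg (h : I -> nat -> R) : (forall i k, `|h i k| <= 1) ->
  (fun n => shelf_mean m p ell n h) @ \oo --> \prod_i count_mean 1 (ell i) (h i).
Proof.
move=> h1; have n1 : `|1 : R| <= 1 by rewrite normr1.
have f1 (f : fps R) : fscale 1 f = f.
  by apply/funext => n; rewrite /fscale expr1n mulr1.
have [_ H] := count_mean_prod n1 h1.
under eq_fun do rewrite shelf_meanE //.
rewrite -(cvg_shiftn 1) in H; apply: cvg_trans H.
rewrite (_ : (fun n => _) = (fun n => \sum_(j < n + 1)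
    (\prod_(i : I) fscale 1 (count_series m p (ell i) (h i))) j)) //.
apply/funext => n; rewrite mulrC fpsME addn1; apply: eq_bigr => j _.
rewrite /fgeo dvd1n expr1n mulr1.
by rewrite [in RHS](eq_bigr (fun i => count_series m p (ell i) (h i))).
Qed.

(** Summation against [u^n] evaluates the series at [u], where the factor
    [1 / (1 - X)] cancels the normalization of the geometric law. *)
Lemma shelf_mean_geometric u (h : I -> nat -> R) : 0 <= u -> u < 1 -> (forall i k, `|h i k| <= 1) ->
  (fun N => \sum_(n < N) (1 - u) * u ^+ n * shelf_mean m p ell n h) @ \oo -->
    \prod_i count_mean u (ell i) (h i).
Proof.
move=> u0 u1 h1; have n1 : `|u| <= 1 by rewrite ger0_norm // ltW.
have [_ H] := fps_sumM (fgeo_sum u0 u1) (count_mean_prod n1 h1).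
have nz : 1 - u != 0 by rewrite subr_eq0 gt_eqF.
have : (fun N => (1 - u) * \sum_(n < N) (fgeo u 1 *
     \prod_(i : I) fscale u (count_series m p (ell i) (h i))) n) @ \oo -->
    (1 - u) * ((1 - u)^-1 * \prod_i count_mean u (ell i) (h i)).
  by apply: cvgM => //; apply: cvg_cst.
rewrite mulVKf // => {}H; apply: cvg_trans H.
rewrite (_ : (fun N => _) = (fun N => (1 - u) * \sum_(n < N) (fgeo u 1 *
     \prod_(i : I) fscale u (count_series m p (ell i) (h i))) n)) //.
apply/funext => N; rewrite mulr_sumr; apply: eq_bigr => n _; rewrite -mulrA.
congr (_ * _); rewrite shelf_meanE // mulrC -fscale_prod.
have -> : fgeo u 1 = fscale u (fgeo 1 1).
  by apply/funext => k; rewrite /fscale /fgeo dvd1n divn1 expr1n mul1r.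
by rewrite -fscaleM.
Qed.

End Joint.
End ShelfSums.

(** * Discrete random elements *)

Lemma set_of_cons (S : eqType) (s : S) (l : seq S) :
  [set` s :: l] = [set s] `|` [set` l].
Proof.
apply/seteqP; split=> t /=; rewrite inE; first by case/orP=> [/eqP|]; [left|right].
by case=> [->|->]; rewrite ?eqxx ?orbT.
Qed.

Section Discrete.
Context d (T : measurableType d) (R : realType) (P : probability T R).
Variables (S : countType) (phi : T -> S).
Hypothesis fib : forall s, measurable (phi @^-1` [set s]).

Lemma discrete_measurable (B : set S) : measurable (phi @^-1` B).
Proof.
rewrite (_ : phi @^-1` B = \bigcup_s (if s \in B then phi @^-1` [set s] else set0)).
  apply: countable_bigcupT_measurable; first exact: countableP.
  by move=> s; case: ifP => // _; apply: fib.
apply/seteqP; split=> [t Bt|t [s _]].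
  by exists (phi t) => //; rewrite mem_set.
by case: ifP => // /set_mem Bs; rewrite /preimage /= => ->.
Qed.

Lemma discrete_measurable_fun d' (U : measurableType d') (f : S -> U) :
  measurable_fun setT (f \o phi).
Proof. by move=> _ Y _; rewrite setTI comp_preimage; apply: discrete_measurable. Qed.

Definition point_mass (s : S) : R := fine (P (phi @^-1` [set s])).

Lemma point_massE s : P (phi @^-1` [set s]) = (point_mass s)%:E.
Proof. by rewrite /point_mass fineK // fin_num_measure. Qed.

Lemma measure_seq (l : seq S) : uniq l ->
  P (phi @^-1` [set` l]) = (\sum_(s <- l) point_mass s)%:E.
Proof.
elim: l => [_|s l IH]; first by rewrite set_nil preimage_set0 measure0 big_nil.
rewrite cons_uniq => /andP[sl ul]; rewrite set_of_cons preimage_setU.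
have -> : P (phi @^-1` [set s] `|` phi @^-1` [set` l]) =
    (P (phi @^-1` [set s]) + P (phi @^-1` [set` l]))%E.
  apply: measureU => //; first exact: discrete_measurable.
  by apply/seteqP; split=> // t [/= ->]; rewrite (negPf sl).
by rewrite IH // point_massE big_cons EFinD.
Qed.

Lemma integral_seq (f : S -> R) (l : seq S) : uniq l ->
  (\int[P]_(t in phi @^-1` [set` l]) (f (phi t))%:E =
   (\sum_(s <- l) f s * point_mass s)%:E)%E.
Proof.
have mf D : measurable_fun D (EFin \o (f \o phi)).
  by apply: measurable_funTS; apply/measurable_EFinP; apply: discrete_measurable_fun.
elim: l => [_|s l IH].
  by rewrite set_nil preimage_set0 integral_set0 big_nil.
rewrite cons_uniq => /andP[sl ul]; rewrite set_of_cons preimage_setU integral_setU //.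
- rewrite IH // big_cons EFinD; congr (_ + _)%E.
  rewrite (eq_integral (cst (f s)%:E)); last by move=> t; rewrite inE /= => ->.
  by rewrite integral_cst // EFinM -point_massE.
- exact: discrete_measurable.
apply/disj_setPS => t [/= ->]; by rewrite (negPf sl).
Qed.

(** On the finitely many fibers over [l] the variable is a simple function; off
    these fibers it is bounded by [C]. *)
Lemma expectation_discrete (f : S -> R) (C : R) (l : seq S) :
  (forall s, `|f s| <= C) -> uniq l ->
  exists2 e, 'E_P[f \o phi]%E = e%:E &
    `|e - \sum_(s <- l) f s * point_mass s| <= C * (1 - \sum_(s <- l) point_mass s).
Proof.
move=> fC ul; set A := phi @^-1` [set` l].
have mA : measurable A by apply: discrete_measurable.
have mf D : measurable_fun D (EFin \o (f \o phi)).
  by apply: measurable_funTS; apply/measurable_EFinP; apply: discrete_measurable_fun.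
have PC : P (~` A) = (1 - \sum_(s <- l) point_mass s)%:E.
  by rewrite probability_setC // measure_seq.
have bnd : (`| \int[P]_(t in ~` A) (f (phi t))%:E | <=
    (C * (1 - \sum_(s <- l) point_mass s))%:E)%E.
  apply: le_trans (le_abse_integral _ _ _) _ => //; first exact: measurableC.
  rewrite EFinM -PC -integral_cst; last exact: measurableC.
  apply: ge0_le_integral => //.
  - exact: measurableC.
  - by apply: measurableT_comp.
  by move=> t _; rewrite lee_fin (le_trans _ (fC (phi t))).
have fin : (\int[P]_(t in ~` A) (f (phi t))%:E)%E \is a fin_num.
  by rewrite fin_num_abs (le_lt_trans bnd) // ltry.
have E : 'E_P[f \o phi]%E = ((\sum_(s <- l) f s * point_mass s)%:E +
    \int[P]_(t in ~` A) (f (phi t))%:E)%E.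
  rewrite unlock -(setUv A) integral_setU //.
  - by rewrite -integral_seq.
  - exact: measurableC.
  by apply/disj_setPS => t [].
exists (\sum_(s <- l) f s * point_mass s + fine (\int[P]_(t in ~` A) (f (phi t))%:E)%E).
  by rewrite E EFinD fineK.
by rewrite addrC addrA addNr add0r -lee_fin -abse_EFin fineK.
Qed.

Lemma expectation_discrete_lim (f : S -> R) (C v : R) (l : nat -> seq S) :
  (forall s, `|f s| <= C) -> (forall K, uniq (l K)) ->
  (fun K => \sum_(s <- l K) point_mass s) @ \oo --> (1 : R) ->
  (fun K => \sum_(s <- l K) f s * point_mass s) @ \oo --> v ->
  'E_P[f \o phi]%E = v%:E.
Proof.
move=> fC ul l1 lv; have [e Ee _] := expectation_discrete fC (ul 0%N).
rewrite Ee; congr (_ %:E); apply/eqP; rewrite -subr_eq0 -normr_le0.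
have c : (fun K => `|e - \sum_(s <- l K) f s * point_mass s|) @ \oo --> `|e - v|.
  by apply: cvg_norm; apply: cvgB => //; apply: cvg_cst.
have c0 : (fun K => C * (1 - \sum_(s <- l K) point_mass s)) @ \oo --> C * (1 - 1).
  apply: cvgM; first exact: cvg_cst.
  by apply: cvgB => //; apply: cvg_cst.
rewrite subrr mulr0 in c0.
apply: (ler_cvg_to c c0); apply: nearW => K.
have [e' Ee' H] := expectation_discrete fC (ul K).
by move: Ee'; rewrite Ee => -[->].
Qed.

Lemma expectation_finite (f : S -> R) (C : R) (l : seq S) :
  (forall s, `|f s| <= C) -> uniq l -> \sum_(s <- l) point_mass s = 1 ->
  'E_P[f \o phi]%E = (\sum_(s <- l) f s * point_mass s)%:E.
Proof.
move=> fC ul l1; have [e -> ] := expectation_discrete fC ul.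
by rewrite l1 subrr mulr0 normr_le0 subr_eq0 => /eqP ->.
Qed.

Lemma probability_expectation (B : set S) :
  P (phi @^-1` B) = 'E_P[(fun s => (s \in B)%:R) \o phi]%E.
Proof.
rewrite -expectation_indic; last exact: discrete_measurable.
by congr ('E_P[ _ ])%E; apply/funext => t; rewrite indicE.
Qed.

End Discrete.

(** Outside a finite set the limit law has little mass, and so do the laws that
    approach it, since their point masses converge on the finite set and all
    the total masses are 1. *)
Lemma expectation_discrete_cvg (R : realType) (S : countType)
    (d : nat -> measure_display) (T : forall n, measurableType (d n))
    (P : forall n, probability (T n) R) (phi : forall n, T n -> S)
    d' (T' : measurableType d') (Q : probability T' R) (psi : T' -> S)
    (f : S -> R) (C : R) (l : nat -> seq S) :
  (forall n s, measurable (phi n @^-1` [set s])) ->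
  (forall s, measurable (psi @^-1` [set s])) ->
  (forall s, `|f s| <= C) -> (forall K, uniq (l K)) ->
  (forall s, (fun n => point_mass (P n) (phi n) s) @ \oo --> point_mass Q psi s) ->
  (fun K => \sum_(s <- l K) point_mass Q psi s) @ \oo --> (1 : R) ->
  (fun n => 'E_(P n)[f \o phi n]%E) @ \oo --> 'E_Q[f \o psi]%E.
Proof.
move=> fP fQ fC ul pc l1.
have /choice[e He] n : exists e, 'E_(P n)[f \o phi n]%E = e%:E.
  by have [e Ee _] := expectation_discrete (P n) (fP n) fC (ul 0%N); exists e.
have [eQ HQ _] := expectation_discrete Q fQ fC (ul 0%N).
rewrite HQ; under eq_fun do rewrite He.
apply: cvg_EFin; first by apply: nearW.
apply/cvgrPdist_le => eps eps0.
have C0 : 0 <= C.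
  have /cvgr_gt/(_ 0 ltr01)[K _ HK] := l1.
  have := HK K (leqnn K); case: (l K) => [|s l0]; first by rewrite big_nil ltxx.
  by move=> _; apply: le_trans (fC s).
pose M K := \sum_(s <- l K) point_mass Q psi s.
have [K HK] : exists K, C * (1 - M K) <= eps / 4.
  have : (fun K => C * (1 - M K)) @ \oo --> C * (1 - 1).
    apply: cvgM; first exact: cvg_cst.
    by apply: cvgB => //; apply: cvg_cst.
  rewrite subrr mulr0 => /cvgr_le/(_ (eps / 4)); rewrite divr_gt0 // => /(_ isT).
  by case=> K _ HK; exists K; apply: (HK K); apply: leqnn.
pose Mn n := \sum_(s <- l K) point_mass (P n) (phi n) s.
have cM : (fun n => C * (1 - Mn n)) @ \oo --> C * (1 - M K).
  apply: cvgM; first exact: cvg_cst.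
  by apply: cvgB; [apply: cvg_cst | apply: cvg_bigsum].
have cF : (fun n => \sum_(s <- l K) f s * point_mass (P n) (phi n) s) @ \oo -->
    \sum_(s <- l K) f s * point_mass Q psi s.
  by apply: cvg_bigsum => s; apply: cvgM => //; apply: cvg_cst.
have eps4 : 0 < eps / 4 by rewrite divr_gt0.
have nF := (cvgrPdist_le _ _).1 cF _ eps4.
have nM := (cvgrPdist_le _ _).1 cM _ eps4.
near=> n.
have [e1 E1 B1] := expectation_discrete Q fQ fC (ul K).
have [e2 E2 B2] := expectation_discrete (P n) (fP n) fC (ul K).
move: E1 E2; rewrite HQ He => -[e1E] -[e2E]; rewrite -e1E in B1; rewrite -e2E in B2.
(* Up to the factor [C], the mass of [Q] off the finite set costs [eps / 4], the
   mass of [P n] there, within [eps / 4] of it, costs [eps / 2], and the sums over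
   the finite set differ by at most [eps / 4]. *)
have h1 : `|\sum_(s <- l K) f s * point_mass Q psi s -
    \sum_(s <- l K) f s * point_mass (P n) (phi n) s| <= eps / 4.
  by near: n; exact: nF.
have h2 : `|C * (1 - M K) - C * (1 - Mn n)| <= eps / 4 by near: n; exact: nM.
move: h1 h2 B1 B2 HK; rewrite -/(M K) -/(Mn n) !ler_norml.
move: (C * (1 - M K)) (C * (1 - Mn n)) => a b.
move=> /andP[? ?] /andP[? ?] /andP[? ?] /andP[? ?] ? /=; apply/andP; split; lra.
Unshelve. all: by end_near.
Qed.

(** * Independent variables with given laws *)

(** The hypotheses on [f] are arguments so that the probability structure can be
    attached to the definition. *)
Definition pmf_measure (R : realType) (f : nat -> R) (f0 : forall k, 0 <= f k)
    (f1 : (fun K => \sum_(k < K) f k) @ \oo --> (1 : R)) : set nat -> \bar R :=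
  fun U => \esum_(k in U) (f k)%:E.

Section PmfMeasure.
Variables (R : realType) (f : nat -> R) (f0 : forall k, 0 <= f k)
  (f1 : (fun K => \sum_(k < K) f k) @ \oo --> (1 : R)).
Local Notation mu := (pmf_measure f0 f1).

Let mu0 : mu set0 = 0%E. Proof. by rewrite /pmf_measure esum_set0. Qed.

Let mu_ge0 U : (0 <= mu U)%E.
Proof. by apply: esum_ge0 => k _; rewrite lee_fin. Qed.

Let mu_sigma_additive : semi_sigma_additive mu.
Proof.
move=> F mF tF mUF; apply: cvg_toP.
  apply: ereal_nondecreasing_is_cvgn => a b ab.
  by apply: lee_sum_nneg_natr => // n _ _; apply: mu_ge0.
by rewrite /pmf_measure nneseries_sum_bigcup // => i; rewrite lee_fin.
Qed.

HB.instance Definition _ := isMeasure.Build _ _ _ mu mu0 mu_ge0 mu_sigma_additive.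

Let mu_setT : mu setT = 1%E.
Proof.
rewrite /pmf_measure -nneseries_esumT; last by move=> k; rewrite lee_fin.
apply/cvg_lim => //.
rewrite (_ : (fun n => (\sum_(0 <= k < n) (f k)%:E)%E) =
    (fun n => (\sum_(k < n) f k)%:E)).
  by apply: cvg_EFin; [apply: nearW | apply: f1].
by apply/funext => n; rewrite sumEFin big_mkord.
Qed.

HB.instance Definition _ := @Measure_isProbability.Build _ _ R mu mu_setT.

Definition pmf_probability : probability nat R := mu.

Lemma pmf_probability1 k : pmf_probability [set k] = (f k)%:E.
Proof. by rewrite /pmf_probability /= /pmf_measure esum_set1 // lee_fin. Qed.

End PmfMeasure.

(** The variables are the coordinates of iterated product measures. *)
Lemma independent_family (R : realType) (I : choiceType) (mu : I -> probability nat R)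
    (s : seq I) : uniq s ->
  exists (d : measure_display) (T : measurableType d) (Q : probability T R)
    (Z : I -> T -> nat), (forall i, measurable_fun setT (Z i)) /\
    forall A : I -> set nat,
      Q (\big[setI/setT]_(i <- s) (Z i @^-1` A i)) = (\prod_(i <- s) mu i (A i))%E.
Proof.
elim: s => [_|i s IH].
  exists default_measure_display, nat, \d_0%N, (fun _ _ => 0%N); split.
    by move=> i; apply: measurable_cst.
  by move=> A; rewrite !big_nil probability_setT.
rewrite cons_uniq => /andP[is_ us].
have [d [T [Q [Z [mZ HZ]]]]] := IH us.
exists _, (T * nat)%type, (Q \x mu i)%E,
  (fun j t => if j == i then t.2 else Z j t.1); split.
  move=> j; case: eqP => _; first exact: measurable_snd.
  exact: (measurableT_comp (mZ j) measurable_fst).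
move=> A; rewrite !big_cons eqxx -HZ muleC.
have -> : (fun t : T * nat => t.2) @^-1` A i `&`
    \big[setI/setT]_(j <- s) ((fun t : T * nat => if j == i then t.2 else Z j t.1)
       @^-1` A j) =
    (\big[setI/setT]_(j <- s) (Z j @^-1` A j)) `*` A i.
  rewrite -!bigcap_seq; apply/seteqP; split=> -[t k] /= [Ak At]; split=> // j js.
    have := At j js; rewrite /preimage /=; case: eqP => // ji.
    by move: js is_; rewrite /= ji => ->.
  rewrite /preimage /=; case: eqP => [ji|_]; last exact: Ak.
  by move: js is_; rewrite /= ji => ->.
apply: product_measure1E => //; elim/big_ind: _ => //.
  by move=> B D mB mD; apply: measurableI.
by move=> j _; rewrite -[_ @^-1` _]setTI; apply: mZ.
Qed.

(** * The cycle counts of a shelf shuffle *)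

Section CountLaw.
Variables (R : realType) (m : nat) (p : R).
Hypotheses (m_ge1 : (1 <= m)%N) (p_gt0 : 0 < p) (p_lt1 : p < 1).

Lemma shelf_mean_const n (h : void -> nat -> R) :
  shelf_mean m p (fun _ : void => 1%N) n h = 1.
Proof.
rewrite shelf_meanE //; try by case.
by rewrite big_pred0 ?mulr1; [rewrite /fgeo dvd1n expr1n | case].
Qed.

Lemma sum_shelf_law n : \sum_(s : 'S_n) shelf_law m p s = 1.
Proof.
rewrite -[RHS](shelf_mean_const n (fun _ _ => 1)); apply: eq_bigr => s _.
by rewrite big1 ?mulr1.
Qed.

Lemma shelf_law_ge0 n (s : 'S_n) : 0 <= shelf_law m p s.
Proof.
apply: sumr_ge0 => w _; apply: prodr_ge0 => c _.
exact: ltW (shelf_weight_gt0 m_ge1 p_gt0 p_lt1 (w c)).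
Qed.

Definition count_pmf (i k : nat) : R := count_mean m p 1 i (fun l => (l == k)%:R).

Let indic_le1 (b : bool) : `|b%:R : R| <= 1.
Proof. by case: b; rewrite ?normr1 ?normr0. Qed.

Let single_cvg i (h : nat -> R) : (0 < i)%N -> (forall k, `|h k| <= 1) ->
  (fun n => shelf_mean m p (fun _ : unit => i) n (fun _ => h)) @ \oo -->
    count_mean m p 1 i h.
Proof.
move=> i0 h1; have := @shelf_mean_cvg R m p m_ge1 p_gt0 p_lt1 unit (fun _ => i).
move=> /(_ _ _ (fun _ => h)).
rewrite big_const card_unit /= mulr1; apply=> //.
by case=> -[].
Qed.

Lemma count_pmf_ge0 i k : (0 < i)%N -> 0 <= count_pmf i k.
Proof.
move=> i0; have := single_cvg i0 (fun l => indic_le1 (l == k)).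
move=> /cvgr_to_ge; apply; apply: nearW => n.
apply: sumr_ge0 => s _; rewrite mulr_ge0 ?shelf_law_ge0 //.
by apply: prodr_ge0 => j _; apply: ler0n.
Qed.

Lemma count_pmf_sum i : (0 < i)%N -> (fun K => \sum_(k < K) count_pmf i k) @ \oo --> (1 : R).
Proof.
move=> i0; have one1 (k : nat) : `|1 : R| <= 1 by rewrite normr1.
have <- : count_mean m p 1 i (fun=> 1) = 1.
  have c := single_cvg i0 one1; apply: cvg_unique c _ => //.
  rewrite (_ : (fun n => _) = fun=> 1); first exact: cvg_cst.
  apply/funext => n; rewrite -[RHS](sum_shelf_law n); apply: eq_bigr => s _.
  by rewrite big1 ?mulr1.
have := count_mean_truncate m_ge1 p_gt0 p_lt1 i0 one1.
by under eq_fun do under eq_bigr do rewrite mul1r.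
Qed.

Section Geometric.
Variables (u : R) (d : measure_display) (T : measurableType d) (P : probability T R)
  (N : {RV P >-> nat}) (sigma : forall w : T, 'S_(N w)).
Hypotheses (u_gt0 : 0 < u) (u_lt1 : u < 1).
Hypothesis sigma_meas : forall n (s : 'S_n),
  measurable [set w | sized_perm (sigma w) = sized_perm s].
Hypothesis N_law : forall n, P (N @^-1` [set n]) = ((1 - u) * u ^+ n)%:E.
Hypothesis sigma_law : forall n (s : 'S_n),
  cond_prob P [set w | sized_perm (sigma w) = sized_perm s] (N @^-1` [set n]) =
  shelf_law m p s.

Let S : countType := {k : nat & 'S_k}.
Let phi (w : T) : S := sized_perm (sigma w).

Let fib (s : S) : measurable (phi @^-1` [set s]).
Proof. by case: s => n s; apply: sigma_meas. Qed.

Let mass n (s : 'S_n) : point_mass P phi (sized_perm s) = (1 - u) * u ^+ n * shelf_law m p s.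
Proof.
rewrite -sigma_law /cond_prob N_law /= mulrC divfK.
  congr (fine (P _)); apply/seteqP; split=> w /=; last by case.
  by move=> e; split=> //; have := congr1 tag e.
by rewrite mulf_neq0 ?expf_neq0 ?(gt_eqF u_gt0) // subr_eq0 gt_eqF.
Qed.

Let levels K : seq S := [seq sized_perm s | n <- iota 0 K, s <- enum 'S_n].

Let levels_uniq K : uniq (levels K).
Proof.
apply: allpairs_uniq_dep; first exact: iota_uniq.
  by move=> n _; apply: enum_uniq.
by move=> [n s] [n' s'] _ _ /= e; exact: e.
Qed.

Let sum_levels (F : S -> R) K :
  \sum_(s <- levels K) F s * point_mass P phi s =
  \sum_(n < K) (1 - u) * u ^+ n * \sum_(s : 'S_n) shelf_law m p s * F (sized_perm s).
Proof.
rewrite big_allpairs_dep /= -{1}[K]subn0 -/(index_iota 0 K) big_mkord.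
apply: eq_bigr => n _; rewrite big_enum /= mulr_sumr; apply: eq_bigr => s _.
by rewrite mass mulrC mulrA.
Qed.

(** The total mass is the case of an empty family of cycle lengths. *)
Let levels_mass : (fun K => \sum_(s <- levels K) point_mass P phi s) @ \oo --> (1 : R).
Proof.
have le1 (i : void) (k : nat) : `|1 : R| <= 1 by case: i.
have := shelf_mean_geometric m_ge1 p_gt0 p_lt1 (ell := fun _ : void => 1%N)
  (h := fun _ _ => 1) _ _ (ltW u_gt0) u_lt1 le1.
rewrite (_ : \prod_(i : void) _ = 1); last by rewrite big_pred0 //; case.
move=> H; rewrite (_ : (fun K => _) = fun K => \sum_(n < K) (1 - u) * u ^+ n *
  shelf_mean m p (fun _ : void => 1%N) n (fun _ _ => 1)); first by apply: H; case.
apply/funext => K; rewrite (eq_bigr (fun s => 1 * point_mass P phi s)); last first.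
  by move=> s _; rewrite mul1r.
rewrite (sum_levels (fun=> 1)); apply: eq_bigr => n _; congr (_ * _).
rewrite shelf_mean_const -[RHS](sum_shelf_law n).
by apply: eq_bigr => s _; rewrite mulr1.
Qed.

Lemma geometric_expectation (I : finType) (ell : I -> nat) (h : I -> nat -> R) :
  injective ell -> (forall i, (0 < ell i)%N) -> (forall i k, `|h i k| <= 1) ->
  'E_P[fun w => (\prod_i h i (ncycles (ell i) (sigma w)))%R]%E =
  (\prod_i count_mean m p u (ell i) (h i))%:E.
Proof.
move=> ell_inj ell_gt0 h1.
pose F (s : S) : R := \prod_i h i (ncycles (ell i) (tagged s)).
have F1 s : `|F s| <= 1.
  by rewrite normr_prod; apply: prodr_ile1 => i _; rewrite normr_ge0 h1.
rewrite -[X in 'E_P[X]%E]/(F \o phi).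
apply: (expectation_discrete_lim fib F1 levels_uniq).
  exact: levels_mass.
under eq_fun do rewrite sum_levels.
exact: shelf_mean_geometric (ltW u_gt0) u_lt1 h1.
Qed.

Let cap_expectation (I : finType) (ell : I -> nat) (A : I -> set nat) :
  injective ell -> (forall i, (0 < ell i)%N) ->
  P (\bigcap_(i in [set: I]) ((fun w => ncycles (ell i) (sigma w)) @^-1` A i)) =
  (\prod_i count_mean m p u (ell i) (fun k => (k \in A i)%:R))%:E.
Proof.
move=> ell_inj ell_gt0; rewrite -geometric_expectation //.
pose B : set S := [set s | forall i, A i (ncycles (ell i) (tagged s))].
rewrite (_ : \bigcap_(i in _) _ = phi @^-1` B); last first.
  by apply/seteqP; split=> [w H i|w H i _]; apply: H.
rewrite (probability_expectation P fib); congr ('E_P[_])%E; apply/funext => w /=.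
case: (boolP (phi w \in B)) => [/set_mem Bw|nB].
  by rewrite big1 // => i _; rewrite mem_set //; apply: Bw.
suff [i Ai] : exists i, ncycles (ell i) (sigma w) \notin A i.
  by rewrite (bigD1 i) //= (negPf Ai) mul0r.
apply: contrapT => H; move/negP: nB; apply; apply/mem_set => i.
apply/set_mem; apply: contrapT => /negP nA; apply: H.
by exists i.
Qed.

Lemma geometric_independence (I : finType) (ell : I -> nat) :
  injective ell -> (forall i, (0 < ell i)%N) ->
  mutually_independent P (fun i w => ncycles (ell i) (sigma w)).
Proof.
move=> ell_inj ell_gt0 A _; rewrite cap_expectation // -prodEFin.
apply: eq_bigr => i _.
have := @cap_expectation unit (fun=> ell i) (fun=> A i) _ (fun=> ell_gt0 i).
rewrite big_const card_unit /= mulr1 => <-; last by case=> -[].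
by congr (P _); apply/seteqP; split=> [w H|w H _ _] //; apply: (H tt).
Qed.

Lemma geometric_pgf i x : (0 < i)%N -> `|x| <= 1 ->
  'E_P[fun w => (x ^+ ncycles i (sigma w))%R]%E = (shelf_pgf m p u i x)%:E.
Proof.
move=> i0 x1; have u1 : `|u| <= 1 by rewrite ger0_norm ltW.
have [_ <-] := count_mean_pgf m_ge1 p_gt0 p_lt1 i0 u1 x1.
have := @geometric_expectation unit (fun=> i) (fun=> fun k => x ^+ k) _ (fun=> i0).
rewrite big_const card_unit /= mulr1 => <-.
- by congr ('E_P[_])%E; apply/funext => w; rewrite big_const card_unit /= mulr1.
- by case=> -[].
by move=> _ k; rewrite normrX exprn_ile1.
Qed.

End Geometric.

End CountLaw.

Lemma cvg_bigprod (R : realType) (I : Type) (r : seq I) (v : I -> nat -> R) (l : I -> R) :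
  (forall i, v i @ \oo --> l i) ->
  (fun N => \prod_(i <- r) v i N) @ \oo --> \prod_(i <- r) l i.
Proof.
move=> vl; elim: r => [|i r IH].
  by rewrite big_nil; under eq_fun do rewrite big_nil; apply: cvg_cst.
by rewrite big_cons; under eq_fun do rewrite big_cons; apply: cvgM.
Qed.

Definition mfun_of d d' (T : measurableType d) (U : measurableType d') (f : T -> U)
    (mf : measurable_fun setT f) : {mfun T >-> U} :=
  HB.pack f (isMeasurableFun.Build _ _ _ _ f mf).

Section LargeDecks.
Variables (R : realType) (m : nat) (p : R).
Hypotheses (m_ge1 : (1 <= m)%N) (p_gt0 : 0 < p) (p_lt1 : p < 1).
Variables (I : finType) (ell : I -> nat).
Hypotheses (ell_inj : injective ell) (ell_gt0 : forall i, (0 < ell i)%N).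

Let mu i : probability nat R :=
  pmf_probability (fun k => count_pmf_ge0 m_ge1 p_gt0 p_lt1 k (ell_gt0 i))
    (count_pmf_sum m_ge1 p_gt0 p_lt1 (ell_gt0 i)).

Let mu1 i k : mu i [set k] = (count_pmf m p (ell i) k)%:E.
Proof. exact: pmf_probability1. Qed.

Lemma limit_family : exists (d : measure_display) (T : measurableType d)
    (Q : probability T R) (Z : I -> {RV Q >-> nat}),
  mutually_independent Q (fun i => (Z i : T -> nat)) /\
  forall i A, Q (Z i @^-1` A) = mu i A.
Proof.
have [d [T [Q [Z [mZ HZ]]]]] := independent_family mu (enum_uniq I).
have marg i A : Q (Z i @^-1` A) = mu i A.
  have := HZ (fun j => if j == i then A else setT).
  rewrite !big_enum /= (bigD1 i) //= eqxx big1 ?setIT; last first.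
    by move=> j /negPf ->; rewrite preimage_setT.
  rewrite (bigD1 i) //= eqxx big1 ?mule1 // => j /negPf ->.
  exact: probability_setT.
exists d, T, Q, (fun i => mfun_of (mZ i)); split=> [A _|]; last exact: marg.
have -> : \bigcap_(i in [set: I]) (mfun_of (mZ i) @^-1` A i) =
    \big[setI/setT]_(i <- enum I) (Z i @^-1` A i).
  rewrite -bigcap_seq; apply/seteqP; split=> t H i _; apply: H => //=.
  by rewrite mem_enum.
rewrite HZ big_enum; apply: eq_bigr => i _.
by rewrite -marg.
Qed.

Section Limit.
Variables (d' : measure_display) (T' : measurableType d') (Q : probability T' R)
  (Z : I -> {RV Q >-> nat}).
Hypothesis Z_indep : mutually_independent Q (fun i => (Z i : T' -> nat)).
Hypothesis Z_law : forall i A, Q (Z i @^-1` A) = mu i A.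

Let Zfib i k : measurable (Z i @^-1` [set k]).
Proof. by rewrite -[_ @^-1` _]setTI; apply: measurable_funP. Qed.

Lemma limit_pgf i x : `|x| <= 1 ->
  'E_Q[fun t => (x ^+ Z i t)%R]%E = (shelf_pgf m p 1 (ell i) x)%:E.
Proof.
move=> x1; have n1 : `|1 : R| <= 1 by rewrite normr1.
have xk k : `|x ^+ k| <= 1 by rewrite normrX exprn_ile1.
have [_ <-] := count_mean_pgf m_ge1 p_gt0 p_lt1 (ell_gt0 i) n1 x1.
have pm k : point_mass Q (Z i) k = count_pmf m p (ell i) k.
  by rewrite /point_mass Z_law mu1.
rewrite -[X in 'E_Q[X]%E]/((fun k => x ^+ k) \o Z i).
apply: (expectation_discrete_lim (Zfib i) xk (l := fun K => iota 0 K)).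
- by move=> K; apply: iota_uniq.
- rewrite (_ : (fun K => _) = fun K => \sum_(k < K) count_pmf m p (ell i) k).
    exact: count_pmf_sum.
  apply/funext => K; rewrite -{1}[K]subn0 -/(index_iota 0 K) big_mkord.
  by apply: eq_bigr => k _.
rewrite (_ : (fun K => _) = fun K => \sum_(k < K) x ^+ k * count_pmf m p (ell i) k).
  exact: (count_mean_truncate m_ge1 p_gt0 p_lt1 (ell_gt0 i) xk).
apply/funext => K; rewrite -{1}[K]subn0 -/(index_iota 0 K) big_mkord.
by apply: eq_bigr => k _; rewrite pm.
Qed.

Let psi (t : T') : {ffun I -> nat} := [ffun i => Z i t].

Let psi_fiber v : psi @^-1` [set v] = \bigcap_(i in [set: I]) (Z i @^-1` [set v i]).
Proof.
apply/seteqP; split=> [t /= <- i _|t H]; first by rewrite /= ffunE.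
by apply/ffunP => i; rewrite ffunE; apply: H.
Qed.

Let psi_meas v : measurable (psi @^-1` [set v]).
Proof.
rewrite psi_fiber; apply: fin_bigcap_measurable => //.
Qed.

Let psi_mass v : point_mass Q psi v = \prod_i count_pmf m p (ell i) (v i).
Proof.
rewrite /point_mass psi_fiber Z_indep // (eq_bigr (fun i => (count_pmf m p (ell i) (v i))%:E)).
  by rewrite prodEFin.
by move=> i _; rewrite Z_law mu1.
Qed.

Let box K : seq {ffun I -> nat} :=
  [seq [ffun i => val (v i)] | v : {ffun I -> 'I_K}].

Let box_uniq K : uniq (box K).
Proof.
rewrite map_inj_uniq ?enum_uniq // => v v' /ffunP e; apply/ffunP => i.
by apply/val_inj; have := e i; rewrite !ffunE.
Qed.

Let box_mass : (fun K => \sum_(v <- box K) point_mass Q psi v) @ \oo --> (1 : R).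
Proof.
rewrite (_ : (fun K => _) = fun K => \prod_i \sum_(k < K) count_pmf m p (ell i) k).
  have := cvg_bigprod (r := index_enum I) (fun i => count_pmf_sum m_ge1 p_gt0 p_lt1 (ell_gt0 i)).
  by rewrite big1.
apply/funext => K; rewrite bigA_distr_bigA /= big_map big_enum /=.
apply: eq_bigr => v _; rewrite psi_mass; apply: eq_bigr => i _.
by rewrite ffunE.
Qed.

Variables (d : nat -> measure_display) (T : forall n, measurableType (d n))
  (P : forall n, probability (T n) R) (sigma : forall n, T n -> 'S_n).
Hypothesis sigma_meas : forall n (s : 'S_n), measurable (@sigma n @^-1` [set s]).
Hypothesis sigma_law : forall n (s : 'S_n),
  P n (@sigma n @^-1` [set s]) = (shelf_law m p s)%:E.

Let counts n (s : 'S_n) : {ffun I -> nat} := [ffun i => ncycles (ell i) s].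

Let counts_meas n v : measurable ((@counts n \o @sigma n) @^-1` [set v]).
Proof. by rewrite comp_preimage; apply: discrete_measurable (@sigma_meas n) _. Qed.

Let counts_mass n v : point_mass (P n) (@counts n \o @sigma n) v =
  shelf_mean m p ell n (fun i k => (k == v i)%:R).
Proof.
have pm s : point_mass (P n) (@sigma n) s = shelf_law m p s.
  by rewrite /point_mass sigma_law.
rewrite /point_mass comp_preimage (probability_expectation (P n) (@sigma_meas n)).
rewrite (expectation_finite (@sigma_meas n) (C := 1) (l := enum 'S_n)) /=.
- rewrite big_enum /=; apply: eq_bigr => s _; rewrite pm mulrC; congr (_ * _).
  case: (boolP (s \in _)) => [/set_mem <-|nB].
    by rewrite big1 // => i _; rewrite ffunE eqxx.
  have [i ni] : exists i, ncycles (ell i) s != v i.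
    apply: contrapT => H; move/negP: nB; apply; apply/mem_set/ffunP => i.
    rewrite ffunE; apply: contrapT => /eqP ne; apply: H; by exists i.
  by rewrite (bigD1 i) //= (negPf ni) mul0r.
- by move=> s; case: (s \in _); rewrite ?normr1 ?normr0.
- exact: enum_uniq.
rewrite big_enum /= -[RHS](sum_shelf_law m_ge1 p_gt0 p_lt1 n).
by apply: eq_bigr => s _; rewrite pm.
Qed.

Lemma counts_cvg (f : {ffun I -> nat} -> R) (C : R) : (forall v, `|f v| <= C) ->
  (fun n => 'E_(P n)[f \o (@counts n \o @sigma n)]%E) @ \oo --> 'E_Q[f \o psi]%E.
Proof.
move=> fC.
apply: (expectation_discrete_cvg counts_meas psi_meas fC box_uniq _ box_mass) => v.
under eq_fun do rewrite counts_mass.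
rewrite psi_mass; apply: (shelf_mean_cvg m_ge1 p_gt0 p_lt1 ell_inj ell_gt0) => i k.
by case: (k == _); rewrite ?normr1 ?normr0.
Qed.

Lemma large_deck_cvg : cvg_in_distribution (V := {ptws I -> R}) P
  (fun n w => (fun i : I => (ncycles (ell i) (@sigma n w))%:R : R)) Q
  (fun w => (fun i : I => (Z i w)%:R : R)).
Proof.
move=> f _ [C fC].
have := @counts_cvg (fun v => f (fun i => (v i)%:R)) C (fun v => fC _).
rewrite (_ : _ \o psi = f \o (fun w => (fun i : I => (Z i w)%:R : R))).
  rewrite (_ : (fun n => 'E_(P n)[_]%E) = (fun n => 'E_(P n)[f \o
    (fun w => (fun i : I => (ncycles (ell i) (@sigma n w))%:R : R))]%E)) //.
  apply/funext => n; congr ('E_(P n)[_])%E; apply/funext => w /=.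
  by congr (f _); apply/funext => i; rewrite ffunE.
by apply/funext => w /=; congr (f _); apply/funext => i; rewrite ffunE.
Qed.

End Limit.
End LargeDecks.

Theorem corollary2p5 (R : realType) (m : nat) (p u : R)
    (m_ge1 : (1 <= m)%N) (p_gt0 : 0 < p) (p_lt1 : p < 1)
    (u_gt0 : 0 < u) (u_lt1 : u < 1) :
  (forall (d : measure_display) (T : measurableType d) (P : probability T R)
      (N : {RV P >-> nat}) (sigma : forall w : T, 'S_(N w)),
    (forall n (s : 'S_n),
       measurable [set w | sized_perm (sigma w) = sized_perm s]) ->
    (forall n, P (N @^-1` [set n]) = ((1 - u) * u ^+ n)%:E) ->
    (forall n (s : 'S_n),
       cond_prob P [set w | sized_perm (sigma w) = sized_perm s]
         (N @^-1` [set n]) = shelf_law m p s) ->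
    (forall I : {fset nat}, (forall i : I, (0 < fsval i)%N) ->
       mutually_independent P (fun (i : I) w => ncycles (fsval i) (sigma w))) /\
    (forall (i : nat) (x : R), (0 < i)%N -> `|x| <= 1 ->
       shelf_pgf_defined m p u i x /\
       ('E_P[fun w => (x ^+ ncycles i (sigma w))%R])%E = (shelf_pgf m p u i x)%:E))
  /\
  (forall (d : nat -> measure_display) (T : forall n, measurableType (d n))
      (P : forall n, probability (T n) R) (sigma : forall n, T n -> 'S_n),
    (forall n (s : 'S_n), measurable (sigma n @^-1` [set s])) ->
    (forall n (s : 'S_n), P n (sigma n @^-1` [set s]) = (shelf_law m p s)%:E) ->
    forall I : {fset nat}, (forall i : I, (0 < fsval i)%N) ->
    exists (d' : measure_display) (T' : measurableType d')
        (Q : probability T' R) (Z : I -> {RV Q >-> nat}),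
      mutually_independent Q (fun (i : I) => (Z i : T' -> nat)) /\
      (forall (i : I) (x : R), `|x| <= 1 ->
         shelf_pgf_defined m p 1 (fsval i) x /\
         ('E_Q[fun w => (x ^+ Z i w)%R])%E = (shelf_pgf m p 1 (fsval i) x)%:E) /\
      cvg_in_distribution (V := {ptws I -> R}) P
        (fun n w => (fun i : I => (ncycles (fsval i) (sigma n w))%:R : R)) Q
        (fun w => (fun i : I => (Z i w)%:R : R))).
Proof.
have n1 : `|1 : R| <= 1 by rewrite normr1.
split=> [d T P N sigma sigma_meas N_law sigma_law|
         d T P sigma sigma_meas sigma_law I I_gt0].
  split=> [I I_gt0|i x i0 x1].
    exact: (geometric_independence m_ge1 p_gt0 p_lt1 u_gt0 u_lt1 sigma_meas N_law
      sigma_law (@val_inj _ _ _) I_gt0).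
  split; last exact: geometric_pgf.
  by have [] := count_mean_pgf m_ge1 p_gt0 p_lt1 i0 (_ : `|u| <= 1) x1;
    rewrite ?ger0_norm ?ltW.
have [d' [T' [Q [Z [Z_indep Z_law]]]]] := limit_family m_ge1 p_gt0 p_lt1 I_gt0.
exists d', T', Q, Z; split=> //; split=> [i x x1|].
  split; last exact: (limit_pgf Z_law).
  by have [] := count_mean_pgf m_ge1 p_gt0 p_lt1 (I_gt0 i) n1 x1.
exact: (large_deck_cvg (@val_inj _ _ _) Z_indep Z_law sigma_meas sigma_law).
Qed.
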